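(* Let $N=1$, $S^-=(a_1,a_2)$ with $a_1<a_2$, and let $u$ be a classical solution of the first or second boundary value problem for $u_{,xx}-c^{-2}u_{,tt}=G$ in $(a_1,a_2)\times\{t>0\}$ with initial data $u_0,\dot u_0$. Then $\hat u(x,t)=u(x,t)H_S^-(x)H(t)$ has the following integral representation: $$\begin{aligned}2\hat u(x,t)=&\;c\,H(ct-|x-a_2|)\int_{|x-a_2|/c}^t u_{,x}(a_2,\tau)\,d\tau-c\,H(ct-|x-a_1|)\int_{|x-a_1|/c}^t u_{,x}(a_1,\tau)\,d\tau\\&+\operatorname{sgn}(x-a_1)\,H(ct-|x-a_1|)\,u\!\left(a_1,t-\frac{|x-a_1|}{c}\right)-\operatorname{sgn}(x-a_2)\,H(ct-|x-a_2|)\,u\!\left(a_2,t-\frac{|x-a_2|}{c}\right)\\&+c^{-1}\int_{a_1}^{a_2}\dot u_0(y)H(ct-|x-y|)\,dy+u_0(x+ct)H_S^-(x+ct)+u_0(x-ct)H_S^-(x-ct).\end{aligned}$$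
   Context: Constant $c>0$; $\dot u=u_{,t}=\partial u/\partial t$, $u_{,x}=\partial u/\partial x$. $G$ is a regular (locally integrable) function. A wave front is a curve in the $(x,\tau)$-plane, $\tau=ct$, with unit normal $(\nu_1,\nu_\tau)$, $\nu_\tau=-|\nu_1|<0$, i.e. a point $F_t$ moving with speed $c$ in the direction $n_1=\nu_1/|\nu_1|=\pm1$; $[f]_{F_t}=\lim_{\varepsilon\to+0}(f(x+\varepsilon n_1,t)-f(x-\varepsilon n_1,t))$ at $x=F_t$. A classical solution is a function $u$ which, with its first and second derivatives, is continuous outside a finite or countable number of wave fronts, satisfies the equation there, and on each front satisfies $[u]_{F_t}=0$ and $[\dot u+c\,n_1u_{,x}]_{F_t}=0$. Boundary value problem: $u(x,0)=u_0(x)$ on $[a_1,a_2]$, $u_{,t}(x,0)=\dot u_0(x)$ on $(a_1,a_2)$, and either the values $u(a_k,t)$, $k=1,2$, are prescribed for $t\ge0$ (first BVP, with $u(a_k,0)=u_0(a_k)$) or the derivatives of $u$ along the external normals at $a_1,a_2$ are prescribed for $t\ge0$ (second BVP). $u_0$ and the boundary values of $u$ are continuous; $\dot u_0$ and the boundary values of the normal derivative are piecewise continuous. $H_S^-(x)$ equals $1$ on $(a_1,a_2)$, $1/2$ at $a_1,a_2$, $0$ elsewhere; $H$ is the Heaviside function with $H(0)=1/2$; $\operatorname{sgn}0=0$, $\operatorname{sgn}x=\pm1$ for $\pm x>0$. $\hat u$ and $u_0H_S^-$ are $0$ outside $[a_1,a_2]$.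
   Formalization: In the two time integrals u_{,x}(a_k,τ) is replaced by u_{,x}(a_k,t-τ); the missing source term -c∫_{a_1}^{a_2}∫_0^t G(y,s)H(c(t-s)-|x-y|) ds dy is added on the right; the formula is asserted for t>0 only (all real x). *)

(* Defs.v *)
From HB Require Import structures.
From mathcomp Require Import all_boot all_order all_algebra.
From mathcomp Require Import all_classical all_reals all_analysis.

Set Implicit Arguments.
Unset Strict Implicit.
Unset Printing Implicit Defensive.

Import Order.TTheory GRing.Theory Num.Theory.
Import numFieldNormedType.Exports.

Local Open Scope classical_set_scope.
Local Open Scope ring_scope.

Definition heaviside (R : realType) (x : R) : R :=
  if 0 < x then 1 else if x == 0 then 2^-1 else 0.

(* H_S^-, the characteristic function of (a1, a2) with value 1/2 at the ends *)
Definition interval_char (R : realType) (a1 a2 x : R) : R :=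
  if a1 < x < a2 then 1 else if (x == a1) || (x == a2) then 2^-1 else 0.

(* Functions of the position x and the time t are curried: u x t. *)
Definition dx (R : realType) (u : R -> R -> R) (x t : R) : R :=
  derive1 (fun y => u y t) x.

Definition dt (R : realType) (u : R -> R -> R) (x t : R) : R := derive1 (u x) t.

Definition uncur (R : realType) (u : R -> R -> R) (q : R * R) : R := u q.1 q.2.

(* [derive1] is total, hence the explicit derivability requirements *)
Definition C1_at (R : realType) (u : R -> R -> R) (q : R * R) : Prop :=
  [/\ derivable (fun y => u y q.2) q.1 1, derivable (u q.1) q.2 1,
      {for q, continuous (uncur (dx u))} & {for q, continuous (uncur (dt u))}].

Definition C2_at (R : realType) (u : R -> R -> R) (q : R * R) : Prop :=
  [/\ {for q, continuous (uncur u)}, C1_at u q, C1_at (dx u) q &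
      C1_at (dt u) q].

Definition half_strip (R : realType) (a1 a2 : R) : set (R * R) :=
  [set q | a1 < q.1 < a2 /\ 0 < q.2].

Definition closed_half_strip (R : realType) (a1 a2 : R) : set (R * R) :=
  [set q | a1 <= q.1 <= a2 /\ 0 <= q.2].

(* A point moving with speed c in a fixed direction +1 or -1: the pair (b, s)
   stands for the moving point s + n c t, with n = 1 if b and n = -1 otherwise.
   A front which exists only for part of the time is covered by the full line:
   where u is smooth the jump conditions below hold trivially. *)
Definition front (R : realType) := (bool * R)%type.

Definition front_dir (R : realType) (F : front R) : R :=
  if F.1 then 1 else -1.

Definition front_pos (R : realType) (c : R) (F : front R) (t : R) : R :=
  F.2 + front_dir F * c * t.

Definition on_fronts (R : realType) (c : R) (Phi : set (front R)) :
    set (R * R) :=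
  [set q | exists2 F, Phi F & q.1 = front_pos c F q.2].

(* [f]_{F_t} = l; the limit is taken along the e for which neither point lies on
   a front, since f involves derivatives which need not exist on the fronts *)
Definition jump_is (R : realType) (c : R) (Phi : set (front R))
    (f : R -> R -> R) (F : front R) (t l : R) : Prop :=
  let x := front_pos c F t in
  let n := front_dir F in
  (f (x + e * n) t - f (x - e * n) t)
    @[e --> within [set e | ~ on_fronts c Phi (x + e * n, t) /\
                            ~ on_fronts c Phi (x - e * n, t)] (0 : R)^'+]
    --> l.

Record classical_solution (R : realType) (c a1 a2 : R) (G u : R -> R -> R)
    (Phi : set (front R)) : Prop := {
  cs_fronts : countable Phi;
  cs_continuous : {within closed_half_strip a1 a2, continuous (uncur u)};
  cs_regular : forall q, closed_half_strip a1 a2 q -> ~ on_fronts c Phi q ->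
    \forall q' \near q, half_strip a1 a2 q' -> C2_at u q';
  cs_equation : forall x t, half_strip a1 a2 (x, t) ->
    ~ on_fronts c Phi (x, t) ->
    dx (dx u) x t - c ^- 2 * dt (dt u) x t = G x t;
  (* At a point where fronts cross, the limits from the two sides of one front
     are separated by the other front as well; no condition is imposed there. *)
  cs_jump : forall F t, Phi F -> half_strip a1 a2 (front_pos c F t, t) ->
    ~ on_fronts c (Phi `\ F) (front_pos c F t, t) ->
    jump_is c Phi u F t 0 /\
    jump_is c Phi (fun x s => dt u x s + c * front_dir F * dx u x s) F t 0
}.

(* The values at the finitely many exceptional points and at a, b are free. *)
Definition piecewise_continuous (R : realType) (a b : R) (f : R -> R) : Prop :=
  [/\ exists s : seq R,
        forall x, a < x < b -> x \notin s -> {for x, continuous f},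
      forall x, a <= x < b -> cvg (f y @[y --> x^'+]) &
      forall x, a < x <= b -> cvg (f y @[y --> x^'-])].

(* f(q') -> l as q' tends to q from inside the half-strip *)
Definition trace_is (R : realType) (a1 a2 : R) (f : R -> R -> R) (q : R * R)
    (l : R) : Prop :=
  f q'.1 q'.2 @[q' --> within (half_strip a1 a2) (nbhs q)] --> l.

Record initial_data (R : realType) (c a1 a2 : R) (u : R -> R -> R)
    (Phi : set (front R)) (u0 v0 : R -> R) : Prop := {
  id_u0 : {within `[a1, a2], continuous u0};
  id_v0 : piecewise_continuous a1 a2 v0;
  id_value : forall x, a1 <= x <= a2 -> u x 0 = u0 x;
  id_velocity : forall x, a1 < x < a2 -> ~ on_fronts c Phi (x, 0) ->
    trace_is a1 a2 (dt u) (x, 0) (v0 x)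
}.

(* p is the boundary function t |-> u_{,x}(a, t), a being a1 or a2 *)
Record boundary_dx (R : realType) (c a1 a2 : R) (u : R -> R -> R)
    (Phi : set (front R)) (a : R) (p : R -> R) : Prop := {
  bd_pc : forall T, 0 < T -> piecewise_continuous 0 T p;
  bd_trace : forall t, 0 < t -> ~ on_fronts c Phi (a, t) ->
    trace_is a1 a2 (dx u) (a, t) (p t)
}.

Definition first_bvp (R : realType) (a1 a2 : R) (u : R -> R -> R) (u0 : R -> R)
    (b1 b2 : R -> R) : Prop :=
  [/\ {within `[0, +oo[, continuous b1}, {within `[0, +oo[, continuous b2},
      b1 0 = u0 a1, b2 0 = u0 a2 &
      forall t, 0 <= t -> u a1 t = b1 t /\ u a2 t = b2 t].

(* The external normal is -1 at a1 and +1 at a2. *)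
Definition second_bvp (R : realType) (c a1 a2 : R) (u : R -> R -> R)
    (Phi : set (front R)) (b1 b2 : R -> R) : Prop :=
  [/\ forall T, 0 < T -> piecewise_continuous 0 T b1,
      forall T, 0 < T -> piecewise_continuous 0 T b2,
      forall t, 0 < t -> ~ on_fronts c Phi (a1, t) ->
        trace_is a1 a2 (fun x s => - dx u x s) (a1, t) (b1 t) &
      forall t, 0 < t -> ~ on_fronts c Phi (a2, t) ->
        trace_is a1 a2 (dx u) (a2, t) (b2 t)].

Definition locally_integrable_source (R : realType) (a1 a2 : R)
    (G : R -> R -> R) : Prop :=
  forall T, 0 < T ->
    (@lebesgue_measure R \x @lebesgue_measure R)%E.-integrable
      (`[a1, a2] `*` `[0, T]) (EFin \o uncur G).

Definition uhat (R : realType) (a1 a2 : R) (u : R -> R -> R) (x t : R) : R :=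
  u x t * interval_char a1 a2 x * heaviside t.

(* Main.v *)
(* In the characteristic coordinates x - ct, x + ct fronts are coordinate lines,
   countably many of them, and the equation says that 2u + c * (potential of G
   over the backward cone) has vanishing second-order difference over small
   rectangles away from them.  A separately continuous function whose difference
   over a rectangle is small compared with the area, near every point off
   countably many horizontal and vertical lines, has zero difference over every
   rectangle: otherwise, bisect a bad rectangle, avoiding the exceptional lines
   one after the other by continuity.  So fronts may accumulate.

   Continue the difference of the two sides of the representation to the whole
   plane, by outgoing waves outside [a1, a2] and by 0 for t <= 0.  Across the
   walls and the initial line, d'Alembert's formula in small triangles with base
   on the boundary, where the traces are integrated over the base, shows that
   the continued function again has locally vanishing differences.  Hence it is
   f(x - ct) + g(x + ct); it is 0 for t <= 0, so it is 0. *)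
Require Import Defs.
From HB Require Import structures.
From mathcomp Require Import all_boot all_order all_algebra.
From mathcomp Require Import all_classical all_reals all_analysis.
From mathcomp Require Import measurable_realfun.
From mathcomp Require Import lra ring.

Set Implicit Arguments.
Unset Strict Implicit.
Unset Printing Implicit Defensive.

Import Order.TTheory GRing.Theory Num.Theory.
Import numFieldNormedType.Exports.

Local Open Scope classical_set_scope.
Local Open Scope ring_scope.

(** * Second-order differences over rectangles *)

(** Second-order differences are used because derivatives of [u] exist only off the fronts, while
    differences over whole rectangles ask for no more than separate continuity. Several terms of the
    representation jump, so the argument runs on a continuous substitute, [defect], in which [u] and
    the data are extended by constants; the Heaviside factors with their values 1/2 are restored at
    the very end, pointwise. The constants come from one count. In characteristic coordinates a
    smooth [u] has difference close to [G] / 4 times the area of the rectangle. The corresponding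
    set in the plane of x and t has only 1 / (2 c) of that area, and the potential has minus the
    integral of [G] over it as its difference. Hence 2 u + c times the potential is balanced. The
    triangle identities at the boundary hold only for short bases around a point off the fronts,
    because it is the trace at such a point that bounds the nearby derivatives. Where fronts
    accumulate they cannot be added up along the boundary; [ddiff_gauge] does the gluing, and its
    exceptional lines also absorb the two corners. *)

Definition ddiff (R : realType) (V : R -> R -> R) (x1 x2 y1 y2 : R) : R :=
  V x2 y2 - V x1 y2 - V x2 y1 + V x1 y1.

(** If an interval is steep, so is one of its pieces under any cut, by the triangle inequality. A
    cut at the midpoint halves the length. If [e] is still inside, a cut at [e] leaves a steep piece
    ending there; steepness is a strict inequality and [F] is continuous, so this end can be moved
    off [e]. *)
Lemma steep_subinterval (R : realType) (F : R -> R) (e k p q : R) :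
  continuous F -> p <= q -> k * (q - p) < `|F q - F p| ->
  exists p' q', [/\ p <= p', p' <= q', q' <= q, q' - p' <= (q - p) / 2 &
    k * (q' - p') < `|F q' - F p'| /\ ~ p' <= e <= q'].
Proof.
move=> Fc pq steep.
pose good (a b : R) := k * (b - a) < `|F b - F a|.
have split a m b : good a b -> good a m \/ good m b.
  rewrite /good => ab.
  have [am|am] := ltP (k * (m - a)) `|F m - F a|; first by left.
  right; have := ler_normD (F b - F m) (F m - F a).
  rewrite addrA subrK; lra.
have [a [b [pa ab bq hw gab]]] : exists a b,
    [/\ p <= a, a <= b, b <= q, b - a <= (q - p) / 2 & good a b].
  have [g|g] := split p ((p + q) / 2) q steep.
    by exists p, ((p + q) / 2); split => //; lra.
  by exists ((p + q) / 2), q; split => //; lra.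
have [eab|neab] := pselect (a <= e <= b); last by exists a, b; split.
have /andP[ae eb] := eab.
(* A single point is never steep, so the piece ending at [e] has positive length and leaves room for
   moving its end. *)
have ne x : ~ good x x by rewrite /good !subrr mulr0 normr0 ltxx.
have [gae|geb] := split a e b gab.
  have {}ae : a < e by rewrite lt_neqAle ae andbT; apply/eqP => E; move: gae; rewrite E; exact: ne.
  have : \forall z \near e, 0 < `|F z - F a| - k * (z - a).
    have : (fun z => `|F z - F a| - k * (z - a)) z @[z --> e]
        --> `|F e - F a| - k * (e - a).
      apply: cvgB; first by apply: cvg_norm; apply: cvgB; [exact: Fc|exact: cvg_cst].
      by apply: cvgM; [exact: cvg_cst|apply: cvgB; [exact: cvg_id|exact: cvg_cst]].
    by move/cvgr_gt; apply; rewrite subr_gt0.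
  move=> /nbhs_ballP[r /= r0 br].
  pose z := Num.max a (e - r / 2).
  have za : a <= z by rewrite le_max lexx.
  have ze : z < e by rewrite gt_max ae /=; lra.
  have zr : e - r / 2 <= z by rewrite le_max lexx orbT.
  have gz : good a z.
    rewrite /good -subr_gt0; apply: br.
    by rewrite /ball /= ger0_norm; lra.
  exists a, z; split => //; [lra|lra|split => //].
  by apply/negP; rewrite negb_and -!ltNge ze orbT.
have {}eb : e < b by rewrite lt_neqAle eb andbT; apply/eqP => E; move: geb; rewrite E; exact: ne.
have : \forall z \near e, 0 < `|F b - F z| - k * (b - z).
  have : (fun z => `|F b - F z| - k * (b - z)) z @[z --> e]
      --> `|F b - F e| - k * (b - e).
    apply: cvgB; first by apply: cvg_norm; apply: cvgB; [exact: cvg_cst|exact: Fc].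
    by apply: cvgM; [exact: cvg_cst|apply: cvgB; [exact: cvg_cst|exact: cvg_id]].
  by move/cvgr_gt; apply; rewrite subr_gt0.
move=> /nbhs_ballP[r /= r0 br].
pose z := Num.min b (e + r / 2).
have za : z <= b by rewrite ge_min lexx.
have ze : e < z by rewrite lt_min eb /=; lra.
have zr : z <= e + r / 2 by rewrite ge_min lexx orbT.
have gz : good z b.
  rewrite /good -subr_gt0; apply: br.
  by rewrite /ball /= ltr0_norm; lra.
exists z, b; split => //; [lra|lra|split => //].
by apply/negP; rewrite negb_and -!ltNge ze.
Qed.

(** Inclusion in a range rather than equality, so that the empty set is covered. *)
Lemma countable_sub_range (R : realType) (A : set R) :
  countable A -> exists e : nat -> R, A `<=` range e.
Proof.
move=> /countable_injP[f finj].
exists (fun n => xget 0 [set x | A x /\ f x = n]) => x Ax.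
exists (f x) => //; case: xgetP => [y _ [Ay fyx]|/(_ x)]; last by case.
by apply: finj => //; rewrite inE.
Qed.

Lemma nested_intervals (R : realType) (p q : nat -> R) :
  (forall n, p n <= p n.+1) -> (forall n, q n.+1 <= q n) ->
  (forall n, p n <= q n) -> exists x, forall n, p n <= x <= q n.
Proof.
move=> pS qS pq.
have pm m n : (m <= n)%N -> p m <= p n.
  by move=> mn; apply: (@homo_leq _ p <=%R) mn => //; exact: le_trans.
have qm m n : (m <= n)%N -> q n <= q m.
  by move=> mn; apply: (@homo_leq _ q (fun x y => y <= x)) mn => // y x z xy yz; exact: le_trans yz xy.
have pqmn m n : p m <= q n.
  have [mn|/ltnW nm] := leqP m n; first exact: le_trans (pm _ _ mn) (pq n).
  exact: le_trans (pq m) (qm _ _ nm).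
exists (sup (range p)) => n; apply/andP; split.
  by apply: ub_le_sup; [exists (q n) => _ [m _ <-]|exists n].
by apply: ge_sup; [exists (p n), n|move=> _ [m _ <-]].
Qed.

(* A rectangle with a large double difference contains a smaller one which
   avoids the first n exceptional lines; the common point of such a nested
   sequence lies on no exceptional line. *)
Lemma ddiff_gauge (R : realType) (V : R -> R -> R) (A B : set R)
    (a b c d : R) :
  countable A -> countable B -> a <= b -> c <= d ->
  (forall y, continuous (V ^~ y)) -> (forall x, continuous (V x)) ->
  (forall x y, a <= x <= b -> c <= y <= d -> ~ A x -> ~ B y ->
    forall k : R, 0 < k -> exists2 r : R, 0 < r & forall x1 x2 y1 y2,
      a <= x1 -> x1 <= x2 -> x2 <= b -> c <= y1 -> y1 <= y2 -> y2 <= d ->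
      x - r < x1 -> x2 < x + r -> y - r < y1 -> y2 < y + r ->
      `|ddiff V x1 x2 y1 y2| <= k * (x2 - x1) * (y2 - y1)) ->
  ddiff V a b c d = 0.
Proof.
move=> /countable_sub_range[eA AeA] /countable_sub_range[eB BeB] ab cd Vx Vy loc.
apply: contrapT => D0.
have [k k0 kD] : exists2 k : R, 0 < k & k * (b - a) * (d - c) < `|ddiff V a b c d|.
  pose D := `|ddiff V a b c d|; pose S := (b - a) * (d - c).
  have Dp : 0 < D by rewrite normr_gt0; apply/eqP.
  have S0 : 0 <= S by apply: mulr_ge0; lra.
  (* Dividing by S + 1 rather than S allows rectangles of area zero. *)
  exists (D / (S + 1)); first by rewrite divr_gt0// ltr_wpDl.
  rewrite -mulrA -/S mulrAC ltr_pdivrMr ?ltr_wpDl//.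
  by rewrite mulrDr mulr1 ltrDl.
pose good (Q : R * R * R * R) := let: (x1, x2, y1, y2) := Q in
  [/\ x1 <= x2, y1 <= y2 & k * (x2 - x1) * (y2 - y1) < `|ddiff V x1 x2 y1 y2|].
(* The second component counts the steps: step n avoids the nth exceptional line of each family. *)
pose next (Qn Qm : (R * R * R * R) * nat) :=
  let: (x1, x2, y1, y2) := Qn.1 in let: (z1, z2, w1, w2) := Qm.1 in
  [/\ Qm.2 = Qn.2.+1, [/\ x1 <= z1, z2 <= x2, y1 <= w1 & w2 <= y2],
    z2 - z1 <= (x2 - x1) / 2 /\ w2 - w1 <= (y2 - y1) / 2,
    ~ z1 <= eA Qn.2 <= z2 /\ ~ w1 <= eB Qn.2 <= w2 & good Qm.1].
have step (Qn : {Qn : (R * R * R * R) * nat | good Qn.1}) :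
    {Qm : {Qn : (R * R * R * R) * nat | good Qn.1} | next (sval Qn) (sval Qm)}.
  case: Qn => -[[[[x1 x2] y1] y2] n] /= gQ; have [x12 y12 kQ] := gQ.
  apply: cid.
  (* The difference over a rectangle is an increment in x and also an increment in y. The cut in x
     has slope k * (y2 - y1); the cut in y then has slope k * (z2 - z1), over the new range of x. *)
  have Fc : continuous (fun x => V x y2 - V x y1).
    by move=> x; apply: cvgB; exact: Vx.
  have [] := @steep_subinterval _ (fun x => V x y2 - V x y1) (eA n) (k * (y2 - y1)) x1 x2 Fc x12.
    rewrite mulrAC (_ : V x2 y2 - V x2 y1 - (V x1 y2 - V x1 y1) = ddiff V x1 x2 y1 y2) //.
    by rewrite /ddiff; ring.
  move=> z1 [z2 [xz1 z12 zx2 hz [kz Az]]].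
  have Gc : continuous (fun y => V z2 y - V z1 y).
    by move=> y; apply: cvgB; exact: Vy.
  have [] := @steep_subinterval _ (fun y => V z2 y - V z1 y) (eB n) (k * (z2 - z1)) y1 y2 Gc y12.
    rewrite mulrAC (_ : V z2 y2 - V z1 y2 - (V z2 y1 - V z1 y1) = V z2 y2 - V z2 y1 - (V z1 y2 - V z1 y1)) //.
    by ring.
  move=> w1 [w2 [yw1 w12 wy2 hw [kw Bw]]].
  have gQ' : good (z1, z2, w1, w2).
    split => //; rewrite (_ : ddiff V z1 z2 w1 w2 = V z2 w2 - V z1 w2 - (V z2 w1 - V z1 w1)) //.
    by rewrite /ddiff; ring.
  by exists (exist _ ((z1, z2, w1, w2), n.+1) gQ').
have g0 : good (a, b, c, d) by split.
have [f [f0 fS]] := dependent_choice step (exist _ ((a, b, c, d), 0%N) g0).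
pose X1 n := (sval (f n)).1.1.1.1; pose X2 n := (sval (f n)).1.1.1.2.
pose Y1 n := (sval (f n)).1.1.2; pose Y2 n := (sval (f n)).1.2.
have facts n : [/\ (sval (f n.+1)).2 = (sval (f n)).2.+1,
   [/\ X1 n <= X1 n.+1, X2 n.+1 <= X2 n, Y1 n <= Y1 n.+1 & Y2 n.+1 <= Y2 n],
    X2 n.+1 - X1 n.+1 <= (X2 n - X1 n) / 2 /\ Y2 n.+1 - Y1 n.+1 <= (Y2 n - Y1 n) / 2 &
    ~ X1 n.+1 <= eA (sval (f n)).2 <= X2 n.+1 /\ ~ Y1 n.+1 <= eB (sval (f n)).2 <= Y2 n.+1].
  have := fS n; rewrite /next /X1 /X2 /Y1 /Y2.
  by case: (sval (f n)) => -[[[x1 x2] y1] y2] m /=; case: (sval (f n.+1)) => -[[[z1 z2] w1] w2] l /= [].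
have goods n : [/\ X1 n <= X2 n, Y1 n <= Y2 n & k * (X2 n - X1 n) * (Y2 n - Y1 n) < `|ddiff V (X1 n) (X2 n) (Y1 n) (Y2 n)|].
  have := proj2_sig (f n); rewrite /good /X1 /X2 /Y1 /Y2 /=.
  by case: (sval (f n)) => -[[[x1 x2] y1] y2] m.
have idx n : (sval (f n)).2 = n.
  by elim: n => [|n IH]; [rewrite f0|have [-> _ _ _] := facts n; rewrite IH].
have [x xP] : exists x, forall n, X1 n <= x <= X2 n.
  by apply: nested_intervals => n; [have [_ []] := facts n|have [_ []] := facts n|have [] := goods n].
have [y yP] : exists y, forall n, Y1 n <= y <= Y2 n.
  by apply: nested_intervals => n; [have [_ []] := facts n|have [_ []] := facts n|have [] := goods n].
have nAx : ~ A x.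
  move=> /AeA[n _ enx]; have [_ _ _ [+ _]] := facts n; rewrite idx enx; apply; exact: xP.
have nBy : ~ B y.
  move=> /BeB[n _ eny]; have [_ _ _ [_ +]] := facts n; rewrite idx eny; apply; exact: yP.
have bnd n : [/\ a <= X1 n, X2 n <= b, c <= Y1 n & Y2 n <= d].
  elim: n => [|n [? ? ? ?]]; first by rewrite /X1 /X2 /Y1 /Y2 f0.
  have [_ [h1 h2 h3 h4] _ _] := facts n.
  by split; [exact: le_trans h1|exact: le_trans h2 _|exact: le_trans h3|exact: le_trans h4 _].
have wid n : X2 n - X1 n <= (b - a) * (2^-1) ^+ n /\ Y2 n - Y1 n <= (d - c) * (2^-1) ^+ n.
  elim: n => [|n [? ?]]; first by rewrite /X1 /X2 /Y1 /Y2 f0 expr0 !mulr1.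
  by have [_ _ [? ?] _] := facts n; rewrite exprS; split; lra.
have xab : a <= x <= b by have := xP 0%N; rewrite /X1 /X2 f0.
have ycd : c <= y <= d by have := yP 0%N; rewrite /Y1 /Y2 f0.
have [r r0 hr] := loc x y xab ycd nAx nBy k k0.
have small (w : R) : \forall n \near \oo, w * (2^-1) ^+ n < r.
  have : geometric w (2^-1 : R) n @[n --> \oo] --> (0 : R).
    by apply: cvg_geometric; rewrite ger0_norm ?invr_ge0// invf_lt1 // ltr1n.
  by move/cvgr_lt; apply.
near \oo => n.
have wX : (b - a) * (2^-1) ^+ n < r by near: n; exact: small.
have wY : (d - c) * (2^-1) ^+ n < r by near: n; exact: small.
have [? ? ? ?] := bnd n; have [? ? kn] := goods n; have [dX dY] := wid n.
have /andP[x1 x2] := xP n; have /andP[y1 y2] := yP n.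
have : `|ddiff V (X1 n) (X2 n) (Y1 n) (Y2 n)| <= k * (X2 n - X1 n) * (Y2 n - Y1 n).
  by apply: hr => //; clear - wX wY dX dY x1 x2 y1 y2; lra.
by rewrite leNgt kn.
Unshelve. all: by end_near.
Qed.

(** * Integrals against discontinuous kernels *)

Lemma heaviside_ge0 (R : realType) (x : R) : 0 <= heaviside x.
Proof. by rewrite /heaviside; case: ltrP => // _; case: eqP => // _; rewrite invr_ge0. Qed.

Lemma heaviside_le1 (R : realType) (x : R) : heaviside x <= 1.
Proof.
by rewrite /heaviside; case: ltrP => // _; case: eqP => // _; rewrite invf_le1 // ler1n.
Qed.

Lemma heaviside_gt0 (R : realType) (x : R) : 0 < x -> heaviside x = 1.
Proof. by rewrite /heaviside => ->. Qed.

Lemma heaviside_lt0 (R : realType) (x : R) : x < 0 -> heaviside x = 0.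
Proof. by rewrite /heaviside => x0; rewrite ltNge (ltW x0) /= lt_eqF. Qed.

Lemma heaviside0 (R : realType) : heaviside (0 : R) = 2^-1.
Proof. by rewrite /heaviside ltxx eqxx. Qed.

(** The value 1/2 at 0 makes this true at 0 as well, so reflected kernels can be rewritten
    pointwise. *)
Lemma heavisideN (R : realType) (x : R) : heaviside (- x) = 1 - heaviside x.
Proof.
have [x0|x0|->] := ltrgt0P x.
- by rewrite heaviside_lt0 ?oppr_lt0// heaviside_gt0// subrr.
- by rewrite heaviside_gt0 ?oppr_gt0// heaviside_lt0// subr0.
- by rewrite oppr0 heaviside0; field.
Qed.

Lemma heaviside_homo (R : realType) : {homo (@heaviside R) : x y / x <= y}.
Proof.
move=> x y xy; have [y0|y0|y0] := ltrgt0P y.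
- by rewrite [leRHS]heaviside_gt0// heaviside_le1.
- by rewrite !heaviside_lt0//; lra.
- have [x0|x0|x0] := ltrgt0P x; [lra|by rewrite heaviside_lt0// heaviside_ge0|by rewrite x0 y0].
Qed.

Lemma measurable_heaviside (R : realType) (D : set R) :
  measurable_fun D (@heaviside R).
Proof.
apply: (@measurable_funS _ _ _ _ setT) => //.
by apply: nondecreasing_measurable => // x y; exact: heaviside_homo.
Qed.

Lemma heaviside_near (R : realType) (x : R) : x != 0 ->
  \forall y \near x, heaviside y = heaviside x.
Proof.
rewrite neq_lt => /orP[x0|x0].
  near=> y; rewrite !heaviside_lt0//; near: y.
  by apply: (cvgr_lt x) => //; exact: cvg_id.
near=> y; rewrite !heaviside_gt0//; near: y.
by apply: (cvgr_gt x) => //; exact: cvg_id.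
Unshelve. all: by end_near. Qed.

Section kernels.
Context d (T : measurableType d) (R : realType).
Implicit Types (m : {measure set T -> \bar R}) (D N : set T) (g K : T -> R).

Lemma integrable_kernel m D g K : measurable D ->
  m.-integrable D (EFin \o g) -> measurable_fun D K ->
  (forall z, D z -> `|K z| <= 1) ->
  m.-integrable D (EFin \o (fun z => g z * K z)).
Proof.
move=> mD ig mK K1; apply: (le_integrable mD _ _ ig).
  apply/measurable_EFinP; apply: measurable_funM => //.
  by move/integrableP : ig => [/measurable_EFinP].
by move=> z Dz /=; rewrite lee_fin normrM ler_piMr// K1.
Qed.

Lemma Rintegral_ae_eq m D N (f g : T -> R) : measurable D -> measurable N -> m N = 0%E ->
  measurable_fun D f -> measurable_fun D g ->
  (forall z, D z -> ~ N z -> f z = g z) ->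
  \int[m]_(z in D) f z = \int[m]_(z in D) g z.
Proof.
move=> mD mN N0 mf mg fg; rewrite /Rintegral; congr fine.
apply: ae_eq_integral => //; [exact/measurable_EFinP|exact/measurable_EFinP|].
exists N; split => // z /= nfg; apply: contrapT => Nz; apply: nfg => Dz.
by rewrite fg.
Qed.

(** Dominated convergence with |g| as the bound. [N] is meant for the points where a Heaviside
    kernel sits on its jump and need not converge. *)
Lemma Rintegral_kernel_cvg m D N g (K_ : nat -> T -> R) K :
  measurable D -> measurable N -> m N = 0%E -> m.-integrable D (EFin \o g) ->
  (forall n, measurable_fun D (K_ n)) -> measurable_fun D K ->
  (forall n z, D z -> `|K_ n z| <= 1) ->
  (forall z, D z -> ~ N z -> K_ n z @[n --> \oo] --> K z) ->
  (\int[m]_(z in D) (g z * K_ n z)) @[n --> \oo]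
    --> \int[m]_(z in D) (g z * K z).
Proof.
move=> mD mN N0 ig mK_ mK K1 cK.
have mg : measurable_fun D g by move/integrableP : ig => [/measurable_EFinP].
have [igK _ cv] : [/\ m.-integrable D (EFin \o (fun z => g z * K z)), (fun n => \int[m]_(z in D) `|(g z * K_ n z)%:E - (g z * K z)%:E|)%E @ \oo --> 0%E &
   (fun n => \int[m]_(z in D) (g z * K_ n z)%:E)%E @ \oo --> (\int[m]_(z in D) (g z * K z)%:E)%E].
  apply: (@dominated_convergence _ _ _ m D mD (fun n z => (g z * K_ n z)%:E)
    (fun z => (g z * K z)%:E) (fun z => (`|g z|)%:E)).
  - by move=> n; apply/measurable_EFinP; apply: measurable_funM.
  - by apply/measurable_EFinP; apply: measurable_funM.
  - exists N; split => // z /= nz; apply: contrapT => Nz; apply: nz => Dz.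
    apply: cvg_EFin; first exact: nearW.
    by apply: cvgM; [exact: cvg_cst|exact: cK].
  - exact: integrable_norm.
  - by apply: aeW => z n Dz /=; rewrite lee_fin normrM ler_piMr// K1.
apply: fine_cvg; rewrite fineK//.
exact: integrable_fin_num.
Qed.

Lemma continuous_Rintegral_kernel m D N g (K : R -> T -> R) r0 :
  measurable D -> measurable N -> m N = 0%E -> m.-integrable D (EFin \o g) ->
  (forall r, measurable_fun D (K r)) ->
  (forall r z, D z -> `|K r z| <= 1) ->
  (forall z, D z -> ~ N z -> {for r0, continuous (K ^~ z)}) ->
  {for r0, continuous (fun r => \int[m]_(z in D) (g z * K r z))}.
Proof.
move=> mD mN N0 ig mK K1 cK.
apply/(@cvg_nbhsP _ R^o) => w wr0.
apply: (@Rintegral_kernel_cvg m D N g (fun n => K (w n)) (K r0)) => //.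
- by move=> n z; exact: K1.
- move=> z Dz Nz; have := cK z Dz Nz.
  by move/(@cvg_nbhsP _ R^o); apply.
Qed.

(** When [X] and [Y] are the characteristic coordinates of z, the kernel is the indicator of the
    backward cone of (x, y), up to its edges. [X] and [Y] stay abstract because at the walls the
    same potential is needed with space and time exchanged. *)
Definition quadrant (m : {measure set T -> \bar R}) D g (X Y : T -> R)
    (x y : R) : R :=
  \int[m]_(z in D) (g z * (heaviside (X z - x) * heaviside (y - Y z))).

Lemma measurable_heavisideBl D (X : T -> R) x :
  measurable_fun D X -> measurable_fun D (fun z => heaviside (X z - x)).
Proof.
move=> mX; apply: (measurableT_comp (@measurable_heaviside R setT)).
exact: measurable_funB.
Qed.

Lemma measurable_heavisideBr D (X : T -> R) x :
  measurable_fun D X -> measurable_fun D (fun z => heaviside (x - X z)).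
Proof.
move=> mX; apply: (measurableT_comp (@measurable_heaviside R setT)).
exact: measurable_funB.
Qed.

Lemma measurable_quadrant_kernel D (X Y : T -> R) x y :
  measurable_fun D X -> measurable_fun D Y ->
  measurable_fun D (fun z => heaviside (X z - x) * heaviside (y - Y z)).
Proof.
by move=> mX mY; apply: measurable_funM; [exact: measurable_heavisideBl|exact: measurable_heavisideBr].
Qed.

Lemma quadrant_kernel_ge0 (a b : R) : 0 <= heaviside a * heaviside b.
Proof. by rewrite mulr_ge0 ?heaviside_ge0. Qed.

Lemma quadrant_kernel_le1 (a b : R) : `|heaviside a * heaviside b| <= 1.
Proof.
rewrite ger0_norm ?quadrant_kernel_ge0//.
by rewrite mulr_ile1 ?heaviside_ge0 ?heaviside_le1.
Qed.

Lemma continuous_quadrantl m D g (X Y : T -> R) y :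
  measurable D -> m.-integrable D (EFin \o g) ->
  measurable_fun setT X -> measurable_fun setT Y ->
  (forall r, m (X @^-1` [set r]) = 0%E) ->
  continuous (quadrant m D g X Y ^~ y).
Proof.
move=> mD ig mX mY X0 x.
have mXx : measurable (X @^-1` [set x]) by rewrite -[X in measurable X]setTI; exact: mX.
apply: (@continuous_Rintegral_kernel m D (X @^-1` [set x]) g
  (fun x z => heaviside (X z - x) * heaviside (y - Y z))) => //.
- by move=> r; apply: measurable_quadrant_kernel; exact: measurable_funTS.
- by move=> r z _; exact: quadrant_kernel_le1.
- move=> z _ /= /eqP Xzx; apply: cvgM; last exact: cvg_cst.
  apply: cvg_near_cst.
  have h : X z - x != 0 by rewrite subr_eq0.
  have c : (X z - r) @[r --> x] --> X z - x by apply: cvgB; [exact: cvg_cst|exact: cvg_id].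
  exact: (c _ (heaviside_near h)).
Qed.

Lemma continuous_quadrantr m D g (X Y : T -> R) x :
  measurable D -> m.-integrable D (EFin \o g) ->
  measurable_fun setT X -> measurable_fun setT Y ->
  (forall r, m (Y @^-1` [set r]) = 0%E) ->
  continuous (quadrant m D g X Y x).
Proof.
move=> mD ig mX mY Y0 y.
have mYy : measurable (Y @^-1` [set y]) by rewrite -[X in measurable X]setTI; exact: mY.
apply: (@continuous_Rintegral_kernel m D (Y @^-1` [set y]) g
  (fun y z => heaviside (X z - x) * heaviside (y - Y z))) => //.
- by move=> r; apply: measurable_quadrant_kernel; exact: measurable_funTS.
- by move=> r z _; exact: quadrant_kernel_le1.
- move=> z _ /= /eqP Yzy; apply: cvgM; first exact: cvg_cst.
  apply: cvg_near_cst.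
  have h : y - Y z != 0 by rewrite subr_eq0 eq_sym.
  have c : (r - Y z) @[r --> y] --> y - Y z by apply: cvgB; [exact: cvg_id|exact: cvg_cst].
  exact: (c _ (heaviside_near h)).
Qed.

Definition window (x1 x2 r : R) : R := heaviside (r - x1) - heaviside (r - x2).

(** The kernel is a nonincreasing function of x times a nondecreasing function of y; this accounts
    for the minus sign. *)
Lemma ddiff_quadrant m D g (X Y : T -> R) x1 x2 y1 y2 :
  measurable D -> m.-integrable D (EFin \o g) ->
  measurable_fun D X -> measurable_fun D Y ->
  ddiff (quadrant m D g X Y) x1 x2 y1 y2 =
  - \int[m]_(z in D) (g z * (window x1 x2 (X z) * window y1 y2 (Y z))).
Proof.
move=> mD ig mX mY; rewrite /ddiff /quadrant.
have ik x y : m.-integrable D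
    (EFin \o (fun z => g z * (heaviside (X z - x) * heaviside (y - Y z)))).
  apply: integrable_kernel => //; first exact: measurable_quadrant_kernel.
  by move=> z _; exact: quadrant_kernel_le1.
pose k x y z := g z * (heaviside (X z - x) * heaviside (y - Y z)).
have iB x y x' y' : m.-integrable D (EFin \o (fun z => k x y z - k x' y' z)).
  by have := integrableB mD (ik x y) (ik x' y'); apply: eq_integrable.
have iBB x y x' y' x'' y'' :
    m.-integrable D (EFin \o (fun z => k x y z - k x' y' z - k x'' y'' z)).
  by have := integrableB mD (iB x y x' y') (ik x'' y''); apply: eq_integrable.
have -> : (fun z => g z * (window x1 x2 (X z) * window y1 y2 (Y z))) =
    (fun z => - 1 * (k x2 y2 z - k x1 y2 z - k x2 y1 z + k x1 y1 z)).
  apply/funext => z; rewrite /window /k.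
  rewrite -[y1 - Y z]opprB -[y2 - Y z]opprB !heavisideN; ring.
rewrite RintegralZl//; last first.
  have := integrableD mD (iBB x2 y2 x1 y2 x2 y1) (ik x1 y1).
  by apply: eq_integrable.
rewrite mulN1r opprK.
rewrite (RintegralD mD (iBB x2 y2 x1 y2 x2 y1) (ik x1 y1)).
by rewrite (RintegralB mD (iB x2 y2 x1 y2) (ik x2 y1)) (RintegralB mD (ik x2 y2) (ik x1 y2)).
Qed.

End kernels.

(** * Areas of characteristic rectangles in the plane *)

Section plane.
Context (R : realType).
Local Notation mu := (@lebesgue_measure R).
Local Notation mu2 := (@lebesgue_measure R \x @lebesgue_measure R)%E.

Definition slant (k : R) (z : R * R) : R := z.1 + k * z.2.

Lemma measurable_slant (k : R) (D : set (R * R)) : measurable_fun D (slant k).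
Proof.
apply: (@measurable_funS _ _ _ _ setT) => //.
by apply: measurable_funD => //; exact: measurable_funM.
Qed.

Lemma product_measure12 (A : set (R * R)) :
  measurable A -> mu2 A = (\int[mu]_y mu (ysection A y))%E.
Proof.
move=> mA; apply: (@product_measure_unique _ _ _ _ _ mu mu
  (product_measure2 mu mu)) => // B C mB mC; exact: product_measure2E.
Qed.

Lemma slant_level_null (k r : R) : k != 0 -> mu2 (slant k @^-1` [set r]) = 0%E.
Proof.
move=> k0; rewrite /product_measure1 /=.
apply: integral0_eq => x _.
rewrite (_ : xsection _ _ = [set (r - x) / k]) ?lebesgue_measure_set1//.
apply/seteqP; split=> t; rewrite /xsection /= /slant inE /=.
  by move=> <-; field.
by move=> ->; field.
Qed.

Lemma measurable_slant_level (k r : R) : measurable (slant k @^-1` [set r]).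
Proof. by rewrite -[X in measurable X]setTI; exact: measurable_slant. Qed.

Lemma measurable_slab (k p q : R) : measurable [set z | p <= slant k z <= q].
Proof.
rewrite (_ : [set _ | _] = setT `&` slant k @^-1` `[p, q]).
  by apply: measurable_slant => //; exact: measurable_itv.
by rewrite setTI; apply/seteqP; split => z /=; rewrite in_itv.
Qed.

Lemma lebesgue_measure_segment (p q : R) : mu `[p, q] = (Num.max 0 (q - p))%:E.
Proof.
rewrite lebesgue_measure_itv /= lte_fin; case: ltP => pq.
  by rewrite -EFinD max_r// subr_ge0 ltW.
by rewrite max_l// subr_le0.
Qed.

(** The passage to characteristic coordinates has Jacobian 2 c. A shear moves each horizontal
    section without changing its length; after it, all nonempty vertical sections are segments of
    the same length (y2 - y1) / (2 c). *)
Lemma diamond_area (c x1 x2 y1 y2 : R) : 0 < c -> x1 <= x2 -> y1 <= y2 ->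
  mu2 [set z | x1 <= slant (- c) z <= x2 /\ y1 <= slant c z <= y2] =
  ((x2 - x1) * (y2 - y1) / (2 * c))%:E.
Proof.
move=> c0 x12 y12.
have mSS k l : measurable [set z | x1 <= slant k z <= x2 /\ y1 <= slant l z <= y2].
  by apply: measurableI; exact: measurable_slab.
(* shear the diamond along the first axis *)
transitivity (mu2 [set z | x1 <= slant 0 z <= x2 /\ y1 <= slant (2 * c) z <= y2]).
  rewrite product_measure12; last exact: mSS.
  rewrite product_measure12; last exact: mSS.
  apply: eq_integral => s _.
  rewrite [X in mu X = _](_ : _ = [set` `[Num.max (x1 + c * s) (y1 - c * s),
      Num.min (x2 + c * s) (y2 - c * s)]]); last first.
    apply/seteqP; split => y; rewrite /ysection /= /slant inE /= in_itv /= ge_max le_min.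
      by move=> [/andP[? ?] /andP[? ?]]; apply/andP; split; apply/andP; split; lra.
    by move=> /andP[/andP[? ?] /andP[? ?]]; split; apply/andP; split; lra.
  rewrite [X in _ = mu X](_ : _ = [set` `[Num.max (x1 + c * s) (y1 - c * s) - c * s,
      Num.min (x2 + c * s) (y2 - c * s) - c * s]]); last first.
    apply/seteqP; split => y; rewrite /ysection /= /slant inE /= in_itv /= lerBlDr lerBrDr ge_max le_min.
      by move=> [/andP[? ?] /andP[? ?]]; apply/andP; split; apply/andP; split; lra.
    by move=> /andP[/andP[? ?] /andP[? ?]]; split; apply/andP; split; lra.
  by rewrite !lebesgue_measure_segment; congr (Num.max _ _)%:E; ring.
rewrite /product_measure1 /=.
transitivity (\int[mu]_(z in `[x1, x2]) ((y2 - y1) / (2 * c))%:E)%E.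
  rewrite [RHS]integral_mkcond; apply: eq_integral => z _.
  rewrite patchE; case: ifPn => [|]; rewrite ?inE ?notin_setE /= in_itv /= => zx.
    rewrite (_ : xsection _ _ = [set` `[(y1 - z) / (2 * c), (y2 - z) / (2 * c)]]).
      rewrite lebesgue_measure_segment max_r; last first.
        by rewrite -mulrBl divr_ge0; lra.
      by congr (_%:E); rewrite -mulrBl; congr (_ / _); ring.
    apply/seteqP; split => t; rewrite /xsection /= /slant inE /= in_itv /= ler_pdivrMr ?ler_pdivlMr ?mulr_gt0//.
      by move=> [_ /andP[? ?]]; apply/andP; split; lra.
    by move=> /andP[? ?]; split; apply/andP; split; move: zx => /andP[? ?]; lra.
  rewrite (_ : xsection _ _ = set0) ?measure0//.
  apply/seteqP; split => t //; rewrite /xsection /= /slant inE /= mul0r addr0.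
  by move=> [].
rewrite integral_cst//= lebesgue_measure_segment max_r ?subr_ge0// -EFinM.
by congr (_%:E); field; lra.
Qed.

Lemma window_ge0 (x1 x2 r : R) : x1 <= x2 -> 0 <= window x1 x2 r.
Proof. by move=> x12; rewrite /window subr_ge0; apply: heaviside_homo; lra. Qed.

Lemma window_le1 (x1 x2 r : R) : window x1 x2 r <= 1.
Proof.
by rewrite /window; have := heaviside_le1 (r - x1); have := heaviside_ge0 (r - x2); lra.
Qed.

Lemma window_in (x1 x2 r : R) : x1 < r < x2 -> window x1 x2 r = 1.
Proof.
by move=> /andP[? ?]; rewrite /window heaviside_gt0 ?heaviside_lt0 ?subr0//; lra.
Qed.

Lemma window_out (x1 x2 r : R) : x1 <= x2 -> ~ x1 <= r <= x2 -> window x1 x2 r = 0.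
Proof.
move=> x12 /negP; rewrite negb_and -!ltNge => /orP[?|?]; rewrite /window.
  by rewrite !heaviside_lt0 ?subr0//; lra.
by rewrite !heaviside_gt0 ?subrr//; lra.
Qed.

Lemma measurable_window d (T : measurableType d) (D : set T) (X : T -> R) x1 x2 :
  measurable_fun D X -> measurable_fun D (fun z => window x1 x2 (X z)).
Proof. by move=> mX; apply: measurable_funB; exact: measurable_heavisideBl. Qed.

(** Off the four lines through its edges, the product of the windows is the indicator of the
    diamond. *)
Lemma integral_window (c x1 x2 y1 y2 : R) (D : set (R * R)) :
  0 < c -> x1 <= x2 -> y1 <= y2 -> measurable D ->
  (forall z, x1 <= slant (- c) z <= x2 -> y1 <= slant c z <= y2 -> D z) ->
  \int[mu2]_(z in D) (window x1 x2 (slant (- c) z) * window y1 y2 (slant c z)) =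
  (x2 - x1) * (y2 - y1) / (2 * c).
Proof.
move=> c0 x12 y12 mD sD.
pose S : set (R * R) := [set z | x1 <= slant (- c) z <= x2 /\ y1 <= slant c z <= y2].
have mSS : measurable S by apply: measurableI; exact: measurable_slab.
pose N := (slant (- c) @^-1` [set x1] `|` slant (- c) @^-1` [set x2]) `|`
  (slant c @^-1` [set y1] `|` slant c @^-1` [set y2]).
have mN : measurable N.
  by apply: measurableU; apply: measurableU; exact: measurable_slant_level.
have cN : - c != 0 by rewrite oppr_eq0 gt_eqF.
have cP : c != 0 by rewrite gt_eqF.
have N0 : mu2 N = 0%E.
  have h k p q : k != 0 ->
      mu2 (slant k @^-1` [set p] `|` slant k @^-1` [set q]) = 0%E.
    by move=> k0; apply: null_set_setU; [exact: measurable_slant_level|exact: measurable_slant_level|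
      exact: slant_level_null|exact: slant_level_null].
  by apply: null_set_setU; [| |exact: h|exact: h];
    apply: measurableU; exact: measurable_slant_level.
rewrite (@Rintegral_ae_eq _ _ _ mu2 D N _ (\1_S : R * R -> R))//.
- rewrite /Rintegral integral_indic//.
  have -> : S `&` D = S by apply/setIidPl => z [? ?]; exact: sD.
  by transitivity (fine (mu2 S)); [|rewrite /S diamond_area].
- by apply: measurable_funM; apply: measurable_window; exact: measurable_slant.
- move=> z Dz; rewrite indicE; case: (boolP (z \in S)); rewrite ?inE ?notin_setE.
    move=> [/andP[x1z zx2] /andP[y1z zy2]] Nz; rewrite !window_in ?mul1r//.
      by rewrite !lt_neqAle y1z zy2 !andbT; apply/andP; split; apply/eqP => E;
         apply: Nz; right; [left|right].
    by rewrite !lt_neqAle x1z zx2 !andbT; apply/andP; split; apply/eqP => E;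
       apply: Nz; left; [left|right].
  move=> /not_andP[h|h] _; rewrite (window_out _ h)//; by rewrite ?mul0r ?mulr0.
Qed.

End plane.

(** * Integrals over thin layers and averages of shifts *)

Lemma measurable_le_nat d (T : measurableType d) (R : realType) (D : set T)
    (f g : T -> R) : measurable_fun D f -> measurable_fun D g ->
  measurable_fun D (fun z => (f z <= g z)%R%:R : R).
Proof.
move=> mf mg mD.
have -> : (fun z => (f z <= g z)%R%:R : R) = (fun z => if f z <= g z then 1 else 0).
  by apply/funext => z; case: ifP.
by apply: (measurable_fun_if mD (measurable_fun_ler mf mg)) => //; exact: measurable_cst.
Qed.

(* Tonelli: averaging over s in [q1, q2] costs a factor 2 h on the layer
   P <= h, since |Q z - s| <= h holds for a set of s of measure 2 h. *)
Lemma average_layer_bound d (T : measurableType d) (R : realType)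
    (m : {sigma_finite_measure set T -> \bar R}) (D : set T) (g P Q : T -> R)
    (K : R -> T -> R) (q1 q2 h : R) :
  measurable D -> m.-integrable D (EFin \o g) ->
  measurable_fun setT P -> measurable_fun setT Q -> 0 <= h ->
  (forall s, measurable_fun D (K s)) ->
  (forall s z, D z -> `|K s z| <= (P z <= h)%R%:R * (`|Q z - s| <= h)%R%:R) ->
  lebesgue_measure.-integrable `[q1, q2]
    (EFin \o (fun s => \int[m]_(z in D) (g z * K s z))) ->
  `| \int[lebesgue_measure]_(s in `[q1, q2]) \int[m]_(z in D) (g z * K s z) |
    <= 2 * h * \int[m]_(z in D) (`|g z| * (P z <= h)%R%:R).
Proof.
move=> mD ig mP mQ h0 mK Kle iF.
set F := fun s => \int[m]_(z in D) (g z * K s z) in iF *.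
have mF : measurable_fun `[q1, q2] F.
  by apply/measurable_EFinP; exact: measurable_int iF.
have mg : measurable_fun D g by move/integrableP : ig => [/measurable_EFinP].
have iagP : m.-integrable D (EFin \o (fun z => `|g z| * (P z <= h)%R%:R)).
  apply: integrable_kernel => //; first exact: integrable_norm.
    by apply: measurable_le_nat => //; exact: measurable_funTS.
  by move=> z _; case: (P z <= h); rewrite ?normr0 ?normr1.
have K1 s z : D z -> `|K s z| <= 1.
  move=> Dz; apply: le_trans (Kle s z Dz) _.
  by case: (P z <= h); case: (`|_| <= h); rewrite ?mul0r ?mulr0 ?mul1r.
(* Extension by zero, so that Tonelli can be applied on the whole product space. *)
pose f0 := (fun z => `|g z| * (P z <= h)%R%:R) \_ D.
have f0_ge0 z : 0 <= f0 z.
  by rewrite /f0 patchE; case: ifP => // _; rewrite mulr_ge0.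
have mf0 : measurable_fun setT f0.
  apply/(measurable_restrictT _ mD); apply: measurable_funM.
    exact: measurableT_comp.
  by apply: measurable_le_nat => //; exact: measurable_funTS.
pose B (zs : T * R) := (f0 zs.1 * (`|Q zs.1 - zs.2| <= h)%R%:R)%:E.
have mB : measurable_fun setT B.
  apply/measurable_EFinP; apply: measurable_funM; first exact: measurableT_comp.
  apply: measurable_le_nat => //; apply: measurableT_comp => //.
  by apply: measurable_funB => //; exact: measurableT_comp.
have B0 zs : (0 <= B zs)%E by rewrite lee_fin mulr_ge0.
have FB s : (`|F s|%:E <= \int[m]_z B (z, s))%E.
  rewrite /F EFin_normr_Rintegral//; last first.
    by apply: integrable_kernel => // z; exact: K1.
  apply: le_trans (le_abse_integral _ mD _) _.
    by apply/measurable_EFinP; exact: measurable_funM.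
  rewrite (_ : (\int[m]_z B (z, s) = \int[m]_(z in D) B (z, s))%E); last first.
    rewrite [RHS]integral_mkcond; apply: eq_integral => z _.
    rewrite patchE; case: ifPn => //; rewrite /B /f0 /= patchE => /negbTE ->.
    by rewrite mul0r.
  apply: ge0_le_integral => //.
  - by apply/measurable_EFinP; apply: measurableT_comp => //; exact: measurable_funM.
  - apply: measurable_funTS; apply: (measurableT_comp mB) => //.
  - move=> z Dz; rewrite lee_fin /f0 patchE mem_set// normrM -mulrA.
    by rewrite ler_wpM2l// Kle.
rewrite -lee_fin.
apply: (@le_trans _ _ (\int[lebesgue_measure]_(s in `[q1, q2]) `|F s|%:E)%E).
  rewrite EFin_normr_Rintegral//; apply: le_abse_integral => //.
  exact: measurable_int iF.
(* The integrand is nonnegative, so s may range over the whole line; the inner integral is then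
   exactly 2 h times [f0]. *)
apply: (@le_trans _ _ (\int[lebesgue_measure]_s \int[m]_z B (z, s))%E).
  rewrite [leLHS]integral_mkcond.
  apply: ge0_le_integral => //.
  - by move=> s _; rewrite patchE; case: ifP.
  - apply/(measurable_restrictT _ (measurable_itv _)); apply/measurable_EFinP.
    exact: (measurableT_comp _ mF).
  - exact: measurable_fun_fubini_tonelli_G.
  - move=> s _; rewrite patchE; case: ifP => // _.
    exact: integral_ge0.
rewrite -fubini_tonelli//.
have -> : (\int[m]_z \int[lebesgue_measure]_s B (z, s) = \int[m]_z ((2 * h)%:E * (f0 z)%:E))%E.
  apply: eq_integral => z _.
  rewrite (_ : (fun s => B (z, s)) = (fun s => (f0 z)%:E * (\1_(`[Q z - h, Q z + h]%classic : set R) s)%:E)%E).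
    rewrite ge0_integralZl//; last by rewrite lee_fin.
      rewrite integral_indic// setIT muleC; congr (_ * _)%E.
      transitivity (lebesgue_measure `[Q z - h, Q z + h]%classic) => //.
      by rewrite lebesgue_measure_segment max_r; [congr (_%:E); ring|lra].
    by apply/measurable_EFinP; exact: measurable_indic.
  apply/funext => s; rewrite /B /= EFinM; congr (_ * _%:E)%E.
  by rewrite indicE mem_setE in_itv /= distrC ler_distl.
rewrite ge0_integralZl//; last first.
- by rewrite lee_fin; lra.
- by move=> z _; rewrite lee_fin.
- exact/measurable_EFinP.
rewrite [X in (_ <= X)%E]EFinM /Rintegral fineK; last exact: integrable_fin_num.
rewrite [X in (_ <= _ * X)%E]integral_mkcond le_eqVlt; apply/orP; left; apply/eqP.
by congr (_ * _)%E; apply: eq_integral => z _; rewrite /f0 !patchE; case: ifP.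
Qed.

Lemma layer_integral0 d (T : measurableType d) (R : realType)
    (m : {measure set T -> \bar R}) (D : set T) (g P : T -> R) :
  measurable D -> m.-integrable D (EFin \o g) -> measurable_fun setT P ->
  (forall z, D z -> 0 <= P z) -> m (P @^-1` [set 0]) = 0%E ->
  \int[m]_(z in D) (`|g z| * (P z <= 0)%R%:R) = 0.
Proof.
move=> mD ig mP P0 N0.
have mN : measurable (P @^-1` [set 0]).
  by rewrite -[X in measurable X]setTI; exact: mP.
rewrite (@Rintegral_ae_eq _ _ _ m D (P @^-1` [set 0]) _ (cst 0))//.
- by rewrite Rintegral_cst// mul0r.
- apply: measurable_funM; last first.
    by apply: measurable_le_nat => //; exact: measurable_funTS.
  apply: measurableT_comp => //.
  by move/integrableP : ig => [/measurable_EFinP].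
- move=> z Dz /= Pz; rewrite leNgt lt_neqAle P0// andbT eq_sym.
  by case: eqP => //= _; rewrite mulr0.
Qed.

(** A point with P z > 0 leaves the layer as soon as h is small, and the remaining points form a
    null set. *)
Lemma layer_integral_cvg0 d (T : measurableType d) (R : realType)
    (m : {measure set T -> \bar R}) (D : set T) (g P : T -> R) :
  measurable D -> m.-integrable D (EFin \o g) -> measurable_fun setT P ->
  (forall z, D z -> 0 <= P z) -> m (P @^-1` [set 0]) = 0%E ->
  (\int[m]_(z in D) (`|g z| * (P z <= h)%R%:R)) @[h --> (0 : R)] --> (0 : R).
Proof.
move=> mD ig mP P0 N0.
have mN : measurable (P @^-1` [set 0]).
  by rewrite -[X in measurable X]setTI; exact: mP.
have le1 (b : bool) : `|b%:R : R| <= 1 by case: b; rewrite ?normr0 ?normr1.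
have mK (h : R) : measurable_fun D (fun z => (P z <= h)%R%:R : R).
  by apply: measurable_le_nat => //; exact: measurable_funTS.
have := @continuous_Rintegral_kernel _ _ R m D (P @^-1` [set 0])
  (fun z => `|g z|) (fun h z => (P z <= h)%R%:R) 0 mD mN N0 (integrable_norm ig) mK.
rewrite -[X in _ --> X](layer_integral0 mD ig mP P0 N0); apply => [h z _|z Dz Pz]; first exact: le1.
apply: cvg_near_cst.
have Pz0 : 0 < P z by rewrite lt_neqAle P0// andbT eq_sym; apply/eqP.
near=> h; rewrite !leNgt Pz0 (_ : h < P z)//.
by near: h; apply: (cvgr_lt (0 : R)) => //; exact: cvg_id.
Unshelve. all: by end_near. Qed.

Lemma derivable_cvg_derive1 (R : realType) (f : R -> R) (x : R) :
  derivable f x 1 ->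
  (h^-1 * (f (x + h) - f x)) @[h --> (0 : R)^'] --> derive1 f x.
Proof.
move=> df; rewrite derive1E.
have : (fun h => h^-1 *: (f (h *: 1 + x) - f x)) @ 0^' --> 'D_1 f x by exact: df.
apply: cvg_trans; apply: near_eq_cvg; apply: nearW => h /=.
by rewrite [h *: _]mulr1 [h + x]addrC.
Qed.

Lemma integrable_continuous_segment (R : realType) (f : R -> R) (a b : R) :
  continuous f -> lebesgue_measure.-integrable `[a, b] (EFin \o f).
Proof.
move=> fc; apply: continuous_compact_integrable; first exact: segment_compact.
exact: continuous_subspaceT.
Qed.

Lemma continuous_primitive (R : realType) (f : R -> R) (a b : R) :
  continuous f -> exists F : R -> R, forall x, a < x < b ->
    derivable F x 1 /\ derive1 F x = f x.
Proof.
move=> fc.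
exists (fun x => \int[lebesgue_measure]_(t in `[a, x]) f t) => x /andP[ax xb].
apply: (@continuous_FTC1_closed _ f a x b) => //; last exact: fc.
exact: integrable_continuous_segment.
Qed.

(** [f] is merely continuous, so its own difference quotients need not converge. With a primitive F
    of [f], the average equals the difference quotient of F at b minus the one at a. *)
Lemma shift_average (R : realType) (f : R -> R) (a b : R) :
  continuous f -> a <= b ->
  (k^-1 * \int[lebesgue_measure]_(s in `[a, b]) (f (s + k) - f s))
    @[k --> (0 : R)^'] --> f b - f a.
Proof.
move=> fc; rewrite le_eqVlt => /predU1P[<-|ab].
  under eq_fun do rewrite set_itv1 Rintegral_set1 mulr0.
  by rewrite subrr; exact: cvg_cst.
(* The margin 2 leaves room for a neighbourhood of radius 1 of [a, b] and for shifts by less than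
   1. *)
have [F FP] := @continuous_primitive R f (a - 2) (b + 2) fc.
have Fa : a - 2 < a < b + 2 by lra.
have Fb : a - 2 < b < b + 2 by lra.
have [dFa Fa'] := FP a Fa; have [dFb Fb'] := FP b Fb.
have : (k^-1 * (F (b + k) - F b) - k^-1 * (F (a + k) - F a)) @[k --> (0 : R)^']
    --> f b - f a.
  by rewrite -Fa' -Fb'; apply: cvgB; exact: derivable_cvg_derive1.
apply: cvg_trans; apply: near_eq_cvg; near=> k.
have k1 : `|k| < 1 by near: k; exact: dnbhs0_lt.
move: k1; rewrite ltr_norml => /andP[k1 k1'].
rewrite -mulrBr; congr (_ * _).
have FTC (r : R) : -1 < r -> r < 1 ->
    \int[lebesgue_measure]_(s in `[a, b]) f (s + r) = F (b + r) - F (a + r).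
  move=> r1 r1'; rewrite /Rintegral.
  have dFr x : a - 1 <= x <= b + 1 -> is_derive x 1 (fun s => F (s + r)) (f (x + r)).
    move=> /andP[? ?]; have [|dF F'] := FP (x + r); first by lra.
    have dFx : is_derive (x + r) 1 F (f (x + r)).
      by rewrite -F' derive1E; exact: derivableP.
    have dx : is_derive x 1 (fun s => s + r) 1.
      by rewrite -[X in is_derive _ _ _ X]addr0; apply: is_deriveD.
    by rewrite -[f _]mulr1; exact: (@is_derive1_comp _ F (fun s => s + r)).
  transitivity (fine ((F (b + r))%:E - (F (a + r))%:E)%E); last by [].
  congr fine.
  apply: (@continuous_FTC2 _ (fun s => f (s + r)) (fun s => F (s + r)) a b) => //.
  - apply: continuous_subspaceT => x; apply: continuous_comp; last exact: fc.
    by apply: cvgD; [exact: cvg_id|exact: cvg_cst].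
  - have cF x : a - 1 <= x <= b + 1 -> {for x, continuous (fun s => F (s + r))}.
      move=> /dFr dFx; apply: differentiable_continuous; apply/derivable1_diffP.
      by case: dFx.
    split.
    + by move=> x; rewrite in_itv/= => /andP[? ?]; have [] : is_derive x 1 (fun s => F (s + r)) (f (x + r)) by apply: dFr; lra.
    + by apply: cvg_at_right_filter; apply: cF; lra.
    + by apply: cvg_at_left_filter; apply: cF; lra.
  - move=> x; rewrite in_itv/= => /andP[? ?]; rewrite derive1E.
    by have [] : is_derive x 1 (fun s => F (s + r)) (f (x + r)) by apply: dFr; lra.
have fr r : continuous (fun s => f (s + r)).
  move=> x; apply: continuous_comp; last exact: fc.
  by apply: cvgD; [exact: cvg_id|exact: cvg_cst].
rewrite RintegralB//; do ?exact: integrable_continuous_segment.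
have E0 : \int[lebesgue_measure]_(s in `[a, b]) f s = F b - F a.
  transitivity (F (b + 0) - F (a + 0)); last by rewrite !addr0.
  rewrite -FTC; [|lra|lra].
  by apply: eq_Rintegral => x _; rewrite addr0.
by rewrite FTC// E0; ring.
Unshelve. all: by end_near. Qed.

(** * Characteristic triangles with base on the boundary *)

Lemma continuous_affine (R : realType) (f : R -> R) (a b : R) :
  (forall x, f x = a * x + b) -> continuous f.
Proof.
move=> /funext -> x; apply: cvgD; last exact: cvg_cst.
by apply: cvgM; [exact: cvg_cst|exact: cvg_id].
Qed.

Lemma continuous_uncur_comp (T : topologicalType) (R : realType)
    (w : R -> R -> R) (f h : T -> R) :
  continuous (uncur w) -> continuous f -> continuous h ->
  continuous (fun x => w (f x) (h x)).
Proof.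
move=> wc fc hc x; apply: continuous2_cvg; [exact: (wc (f x, h x))|exact: fc|exact: hc].
Qed.

(* Off the boundary line p = 0, w minus the potential of the source is
   f (q - p) + g (q + p); the difference quotients of w in p, integrated along
   the base, converge to the integral of the trace by bounded convergence,
   while those of f and g converge to increments over [q1, q2]. *)
Lemma boundary_triangle d (T : measurableType d) (R : realType)
    (m : {sigma_finite_measure set T -> \bar R}) (D : set T) (g P Q : T -> R)
    (w : R -> R -> R) (b : R) (tr : R -> R) (E : set R)
    (lo hi r M q1 q2 : R) :
  let pot := quadrant m D g (fun z => Q z - P z) (fun z => Q z + P z) in
  let J x y := w ((y - x) / 2) ((x + y) / 2) - b * pot x y in
  measurable D -> m.-integrable D (EFin \o g) ->
  measurable_fun setT P -> measurable_fun setT Q ->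
  (forall z, D z -> 0 <= P z) -> m (P @^-1` [set 0]) = 0%E ->
  (forall a, m ((fun z => Q z - P z) @^-1` [set a]) = 0%E) ->
  (forall a, m ((fun z => Q z + P z) @^-1` [set a]) = 0%E) ->
  continuous (uncur w) -> b != 0 ->
  (forall x1 x2 y1 y2, lo < x1 -> x1 <= x2 -> x2 <= y1 -> y1 <= y2 -> y2 < hi ->
    ddiff J x1 x2 y1 y2 = 0) ->
  countable E -> 0 < r ->
  (forall p s, 0 < p < r -> lo < s < hi ->
    derivable (w ^~ s) p 1 /\ `|derive1 (w ^~ s) p| <= M) ->
  (forall s, lo < s < hi -> ~ E s ->
    derive1 (w ^~ s) p @[p --> 0^'+] --> tr s) ->
  measurable_fun `[q1, q2] tr -> lo < q1 -> q1 <= q2 -> q2 < hi ->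
  2 * J q1 q2 = w 0 q1 + w 0 q2 + \int[lebesgue_measure]_(s in `[q1, q2]) tr s.
Proof.
move=> pot J mD ig mP mQ P0 N0 Xnull Ynull wc b0 Jex cE r0 wder wtr mtr loq q12 qhi.
have mX : measurable_fun setT (fun z => Q z - P z) by exact: measurable_funB.
have mY : measurable_fun setT (fun z => Q z + P z) by exact: measurable_funD.
(* [Jex] asks for strict bounds, so the fixed corner used to separate variables is chosen strictly
   between. *)
pose lo' := (lo + q1) / 2; pose hi' := (q2 + hi) / 2.
have lolo' : lo < lo' by rewrite /lo'; lra.
have lo'q : lo' < q1 by rewrite /lo'; lra.
have qhi' : q2 < hi' by rewrite /hi'; lra.
have hi'hi : hi' < hi by rewrite /hi'; lra.
have wcl s : continuous (w ^~ s).
  by apply: continuous_uncur_comp => // x; [exact: cvg_id|exact: cvg_cst].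
have wcr p : continuous (w p).
  by apply: continuous_uncur_comp => // x; [exact: cvg_cst|exact: cvg_id].
have potl y : continuous (pot ^~ y) by exact: continuous_quadrantl.
have potr x : continuous (pot x) by exact: continuous_quadrantr.
(* The vanishing difference over the rectangle with sides [lo', x] and [y, hi'] separates the
   variables: J x y = f x + h y. *)
pose f x := J x hi' - J lo' hi'; pose h y := J lo' y.
have fc : continuous f.
  move=> x; apply: cvgB; last exact: cvg_cst.
  apply: cvgB; last by apply: cvgM; [exact: cvg_cst|exact: potl].
  apply: (@continuous_uncur_comp _ _ _ (fun x => (hi' - x) / 2) (fun x => (x + hi') / 2)) => //.
    by apply: (@continuous_affine _ _ (- 2^-1) (hi' / 2)) => z; lra.
  by apply: (@continuous_affine _ _ 2^-1 (hi' / 2)) => z; lra.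
have hc : continuous h.
  move=> y; apply: cvgB; last by apply: cvgM; [exact: cvg_cst|exact: potr].
  apply: (@continuous_uncur_comp _ _ _ (fun y => (y - lo') / 2) (fun y => (lo' + y) / 2)) => //.
    by apply: (@continuous_affine _ _ 2^-1 (- lo' / 2)) => z; lra.
  by apply: (@continuous_affine _ _ 2^-1 (lo' / 2)) => z; lra.
have JE x y : lo' <= x -> x <= y -> y <= hi' -> J x y = f x + h y.
  move=> lox xy yhi; have := Jex lo' x y hi' lolo' lox xy yhi hi'hi.
  by clear; rewrite /ddiff /f /h; lra.
(* The cone of the point at height k above s lies over [s - k, s + k] and below height k. This is
   the localization that [average_layer_bound] needs. *)
have kerP k s z : D z ->
    `|heaviside (Q z - P z - (s - k)) * heaviside (s + k - (Q z + P z))| <=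
    (P z <= k)%R%:R * (`|Q z - s| <= k)%R%:R.
  move=> Dz; have Pz := P0 z Dz.
  have [?|?] := ltP (Q z - P z - (s - k)) 0.
    by rewrite heaviside_lt0// mul0r normr0 mulr_ge0.
  have [?|?] := ltP (s + k - (Q z + P z)) 0.
    by rewrite [X in _ * X]heaviside_lt0// mulr0 normr0 mulr_ge0.
  have -> : P z <= k by lra.
  have -> : `|Q z - s| <= k by rewrite ler_distl; apply/andP; split; lra.
  by rewrite mulr1 quadrant_kernel_le1.
have mker k s : measurable_fun D
    (fun z => heaviside (Q z - P z - (s - k)) * heaviside (s + k - (Q z + P z))).
  by apply: measurable_quadrant_kernel; exact: measurable_funTS.
have pot0 s : pot s s = 0.
  have mN : measurable (P @^-1` [set 0]).
    by rewrite -[X in measurable X]setTI; exact: mP.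
  have mg : measurable_fun D g by move/integrableP : ig => [/measurable_EFinP].
  rewrite /pot /quadrant (@Rintegral_ae_eq _ _ _ m D (P @^-1` [set 0]) _ (cst 0))//.
  - by rewrite Rintegral_cst// mul0r.
  - apply: measurable_funM => //.
    by apply: measurable_quadrant_kernel; exact: measurable_funTS.
  - move=> z Dz /= /eqP Pz; have := kerP 0 s z Dz.
    have -> : (P z <= 0)%R = false.
      by apply/negbTE; rewrite -ltNge lt_neqAle eq_sym Pz P0.
    by rewrite subr0 addr0 mul0r normr_le0 => /eqP ->; rewrite mulr0.
have w0E s : lo' <= s <= hi' -> w 0 s = f s + h s.
  move=> /andP[? ?]; rewrite -JE// /J pot0 mulr0 subr0 subrr mul0r; by congr w; clear; lra.
have wkE k s : 0 <= k -> lo' <= s - k -> s + k <= hi' ->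
    w k s = f (s - k) + h (s + k) + b * pot (s - k) (s + k).
  move=> k0 ? ?; rewrite -JE//; last by lra.
  by rewrite /J subrK; congr w; clear; lra.
(* Steps of size at most r' stay strictly below r and keep s - k and s + k within [lo', hi'] for s
   in [q1, q2]. *)
pose r' := Num.min (r / 2) (Num.min (q1 - lo') (hi' - q2)).
have r'0 : 0 < r' by rewrite !lt_min divr_gt0// !subr_gt0 lo'q.
have r'r : r' < r by rewrite /r'; have := ge_min (r/2) (r/2) (Num.min (q1 - lo') (hi' - q2)); rewrite lexx /=; lra.
have r'lo : r' <= q1 - lo' by rewrite /r' !ge_min lexx ?orbT.
have r'hi : r' <= hi' - q2 by rewrite /r' !ge_min lexx ?orbT.
pose k n := r' / n.+1%:R.
have k0 n : 0 < k n by rewrite divr_gt0.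
have kr n : k n <= r'.
  by rewrite ler_pdivrMr// ler_peMr ?(ltW r'0)// ler1n.
have slo s : q1 <= s <= q2 -> lo' <= s <= hi' by clear - lo'q qhi'; lra.
have sin s : q1 <= s <= q2 -> lo < s < hi by clear - loq qhi; lra.
have skn n s : q1 <= s <= q2 -> lo' <= s - k n /\ s + k n <= hi'.
  by have := kr n; clear - r'lo r'hi; lra.
have pkr n p : 0 < p < k n -> 0 < p < r by have := kr n; clear - r'r; lra.
have kcvg : k n @[n --> \oo] --> (0 : R).
  rewrite -[X in _ --> X](mulr0 r'); apply: cvgM; first exact: cvg_cst.
  exact: cvg_harmonic.
have kcvg' : k n @[n --> \oo] --> (0 : R)^'.
  move=> A [e /= e0 eA]; have /cvgrPdist_lt/(_ e e0) := kcvg.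
  apply: filterS => n kn; apply: eA => //.
  by rewrite gt_eqF.
pose quot n s := (k n)^-1 * (w (k n) s - w 0 s).
have quotc n : continuous (quot n).
  move=> s; apply: cvgM; first exact: cvg_cst.
  by apply: cvgB; exact: wcr.
have limtr : (\int[lebesgue_measure]_(s in `[q1, q2]) quot n s) @[n --> \oo] -->
    \int[lebesgue_measure]_(s in `[q1, q2]) tr s.
  (* Dividing the quotients by a positive bound turns them into kernels of size at most 1, with the
     constant M' in the role of the integrable function; M alone might not be positive. *)
  pose M' := Num.max M 1.
  have M'0 : 0 < M' by rewrite lt_max ltr01 orbT.
  have M'K x : M' * (x / M') = x by field; rewrite gt_eqF.
  have mE : measurable E by exact: countable_measurable.
  have := @Rintegral_kernel_cvg _ _ R lebesgue_measure `[q1, q2] E (cst M')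
    (fun n s => quot n s / M') (fun s => tr s / M') (measurable_itv _) mE
    (countable_lebesgue_measure0 cE).
  have -> : (fun n => \int[lebesgue_measure]_(s in `[q1, q2]) (cst M' s * (quot n s / M'))) =
      (fun n => \int[lebesgue_measure]_(s in `[q1, q2]) quot n s).
    by apply/funext => n; apply: eq_Rintegral => s _; rewrite M'K.
  have -> : \int[lebesgue_measure]_(s in `[q1, q2]) (cst M' s * (tr s / M')) =
      \int[lebesgue_measure]_(s in `[q1, q2]) tr s.
    by apply: eq_Rintegral => s _; rewrite M'K.
  have mvt n s : q1 <= s <= q2 -> exists2 p, 0 < p < k n & quot n s = derive1 (w ^~ s) p.
    move=> sq.
    have [||p pk wE] := @MVT R (w ^~ s) (fun p => derive1 (w ^~ s) p) 0 (k n) (k0 n).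
    - move=> p; rewrite in_itv /= => pk.
      have [dw _] := wder p s (pkr n p pk) (sin s sq).
      by rewrite derive1E; exact: derivableP.
    - exact: continuous_subspaceT.
    - move: pk wE; rewrite in_itv /= subr0 => pk wE; exists p => //.
      by rewrite /quot wE mulrC mulfK// gt_eqF.
  apply.
  - apply: integrable_continuous_segment; exact: cst_continuous.
  - move=> n; apply: measurable_funM => //; apply: measurable_funTS.
    exact: continuous_measurable_fun.
  - by apply: measurable_funM.
  - move=> n s; rewrite /= in_itv /= => sq.
    have [p pk ->] := mvt n s sq.
    have [_ dM] := wder p s (pkr n p pk) (sin s sq).
    rewrite normrM (gtr0_norm (_ : 0 < M'^-1)) ?invr_gt0// ler_pdivrMr// mul1r.
    by rewrite (le_trans dM)// le_max lexx.
  - move=> s; rewrite /= in_itv /= => sq nEs.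
    apply: cvgM; last exact: cvg_cst.
    apply/cvgrPdist_lt => e e0.
    have /cvgrPdist_lt/(_ e e0) [e' /= e'0 he'] := wtr s (sin s sq) nEs.
    have /cvgrPdist_lt/(_ e' e'0) := kcvg.
    apply: filterS => n; rewrite sub0r normrN gtr0_norm// => kn.
    have [p /andP[p0 pk] ->] := mvt n s sq.
    apply: he' => //=; rewrite sub0r normrN gtr0_norm//; exact: lt_trans pk kn.
have limfh : (\int[lebesgue_measure]_(s in `[q1, q2]) quot n s) @[n --> \oo] -->
    - (f q2 - f q1) + (h q2 - h q1) + b * 0.
  pose av (F : R -> R) (a : R) :=
    a^-1 * \int[lebesgue_measure]_(s in `[q1, q2]) (F (s + a) - F s).
  pose ap n := (k n)^-1 * \int[lebesgue_measure]_(s in `[q1, q2]) pot (s - k n) (s + k n).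
  have shc (F : R -> R) a : continuous F -> continuous (fun s => F (s + a)).
    move=> Fc s; apply: (@continuous_comp _ _ _ (fun s => s + a) F); last exact: Fc.
    by apply: cvgD; [exact: cvg_id|exact: cvg_cst].
  have dc (F : R -> R) a : continuous F -> continuous (fun s => F (s + a) - F s).
    by move=> Fc s; apply: cvgB; [exact: shc|exact: Fc].
  have iq (F : R -> R) : continuous F ->
    lebesgue_measure.-integrable `[q1, q2] (EFin \o F) by exact: integrable_continuous_segment.
  (* On [q1, q2] the potential along the shifted base equals this function, continuous on the whole
     line; its integrability in s comes from here. *)
  pose potk n s := b^-1 * (w (k n) s - f (s - k n) - h (s + k n)).
  have potkE n s : s \in `[q1, q2]%classic -> pot (s - k n) (s + k n) = potk n s.
    rewrite inE /= in_itv /= => /(skn n)[? ?].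
    rewrite /potk wkE ?(ltW (k0 n))//.
    by rewrite -addrA addrC -opprD addKr mulKf.
  have potkc n : continuous (potk n).
    move=> s; apply: cvgM; first exact: cvg_cst.
    apply: cvgB; last exact: shc.
    by apply: cvgB; [exact: wcr|exact: shc].
  have -> : (fun n => \int[lebesgue_measure]_(s in `[q1, q2]) quot n s) =
      (fun n => - av f (- k n) + av h (k n) + b * ap n).
    apply/funext => n; rewrite /av /ap.
    rewrite (@eq_Rintegral _ _ _ lebesgue_measure _ (potk n) _ (potkE n)).
    pose A s := f (s - k n) - f s; pose B s := h (s + k n) - h s.
    have cA : continuous A by exact: dc.
    have cB : continuous B by exact: dc.
    have cZ (F : R -> R) a : continuous F -> continuous (fun s => a * F s).
      by move=> Fc s; apply: cvgM; [exact: cvg_cst|exact: Fc].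
    have cBp : continuous (fun s => (k n)^-1 * B s + b * (k n)^-1 * potk n s).
      by move=> s; apply: cvgD; exact: cZ.
    transitivity (\int[lebesgue_measure]_(s in `[q1, q2])
        ((k n)^-1 * A s + ((k n)^-1 * B s + b * (k n)^-1 * potk n s))).
      apply: eq_Rintegral => s sq; rewrite -potkE//.
      move: sq; rewrite inE /= in_itv /= => sq; have [? ?] := skn n s sq.
      by rewrite /quot wkE ?(ltW (k0 n))// (w0E _ (slo s sq)) /A /B; ring.
    rewrite (RintegralD _ (iq _ (cZ _ _ cA)) (iq _ cBp))//.
    rewrite (RintegralD _ (iq _ (cZ _ _ cB)) (iq _ (cZ _ _ (@potkc n))))//.
    rewrite (RintegralZl _ _ (iq _ cA))// (RintegralZl _ _ (iq _ cB))//.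
    rewrite (RintegralZl _ _ (iq _ (@potkc n)))//.
    by rewrite /A /B invrN; ring.
  have kcvgN : (- k n) @[n --> \oo] --> (0 : R)^'.
    move=> A [e /= e0 eA]; have /cvgrPdist_lt/(_ e e0) := kcvg.
    apply: filterS => n kn; apply: eA => /=; first by rewrite opprK add0r -normrN -sub0r.
    by rewrite oppr_eq0 gt_eqF.
  apply: cvgD; first apply: cvgD; first apply: cvgN.
  - exact: (cvg_comp _ _ kcvgN (shift_average fc q12)).
  - exact: (cvg_comp _ _ kcvg' (shift_average hc q12)).
  (* The source contributes nothing in the limit: divided by k n, the integrated potential is at
     most twice the integral of |g| over the layer of height k n. *)
  - apply: cvgM; first exact: cvg_cst.
    have lay : 2 * \int[m]_(z in D) (`|g z| * (P z <= k n)%R%:R) @[n --> \oo] --> (0 : R).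
      rewrite -[X in _ --> X](mulr0 2); apply: cvgM; first exact: cvg_cst.
      exact: (cvg_comp _ _ kcvg (layer_integral_cvg0 mD ig mP P0 N0)).
    have layN : - (2 * \int[m]_(z in D) (`|g z| * (P z <= k n)%R%:R)) @[n --> \oo] --> (0 : R).
      by rewrite -[X in _ --> X]oppr0; apply: cvgN.
    apply: (squeeze_cvgr _ layN lay); apply: nearW => n.
    rewrite -ler_norml /ap normrM (gtr0_norm (_ : 0 < (k n)^-1)) ?invr_gt0//.
    rewrite mulrC ler_pdivrMr// mulrAC.
    apply: (@average_layer_bound _ _ _ m D g P Q (fun s z =>
      heaviside (Q z - P z - (s - k n)) * heaviside (s + k n - (Q z + P z)))) => //.
    - exact: ltW.
    - by move=> s z; exact: kerP.
    - apply: (@eq_integrable _ _ _ lebesgue_measure _ (measurable_itv _) (EFin \o potk n)); last exact: iq.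
      by move=> s sq /=; rewrite -potkE.
have trE : \int[lebesgue_measure]_(s in `[q1, q2]) tr s = - (f q2 - f q1) + (h q2 - h q1).
  have := cvg_unique _ limtr limfh; rewrite mulr0 addr0; apply; exact: norm_hausdorff.
have q1in : lo' <= q1 <= hi' by apply: slo; rewrite lexx.
have q2in : lo' <= q2 <= hi' by apply: slo; rewrite q12 lexx.
by rewrite trE JE ?(ltW lo'q) ?(ltW qhi')// (w0E _ q1in) (w0E _ q2in); ring.
Qed.

(** * Second-order differences of smooth functions *)

Lemma MVT_ball (R : realType) (f : R -> R) (x r h : R) :
  (forall y, `|y - x| < r -> derivable f y 1) -> `|h| < r ->
  exists2 y, `|y - x| <= `|h| & f (x + h) - f x = derive1 f y * h.
Proof.
move=> df hr.
have cf a b : (forall y, a <= y <= b -> `|y - x| < r) -> {within `[a, b], continuous f}.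
  move=> abr; apply: derivable_within_continuous => y.
  by rewrite in_itv /= => yab; apply: df; exact: abr.
have [h0|h0|->] := ltrgt0P h; last first.
- by exists x; rewrite ?subrr ?normr0// addr0 subrr mulr0.
- have rh : - h < r by move: hr; rewrite ltr0_norm.
  have hyp y : x + h <= y <= x -> `|y - x| < r.
    by move=> ?; rewrite ltr_norml; lra.
  have [|||y yxh E] := @MVT R f (derive1 f) (x + h) x; [lra| |exact: cf|].
    move=> y; rewrite in_itv /= => yxh; rewrite derive1E; apply: derivableP.
    by apply: df; apply: hyp; lra.
  move: yxh; rewrite in_itv /= => yxh; exists y.
    by rewrite !ler0_norm; lra.
  by rewrite -[LHS]opprB E; ring.
- have rh : h < r by move: hr; rewrite gtr0_norm.
  have hyp y : x <= y <= x + h -> `|y - x| < r.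
    by move=> ?; rewrite ltr_norml; lra.
  have [|||y yxh E] := @MVT R f (derive1 f) x (x + h); [lra| |exact: cf|].
    move=> y; rewrite in_itv /= => yxh; rewrite derive1E; apply: derivableP.
    by apply: df; apply: hyp; lra.
  move: yxh; rewrite in_itv /= => yxh; exists y.
    by rewrite !ger0_norm; lra.
  by rewrite E; ring.
Qed.

Lemma is_derive1P (R : realType) (f : R -> R) (x df : R) :
  (h^-1 * (f (x + h) - f x)) @[h --> (0 : R)^'] --> df -> is_derive x 1 f df.
Proof.
move=> cf.
have cf' : (fun h => h^-1 *: (f (h *: 1 + x) - f x)) @ 0^' --> df.
  move: cf; apply: cvg_trans; apply: near_eq_cvg; apply: nearW => h /=.
  by rewrite [h *: _]mulr1 [h + x]addrC.
apply: DeriveDef; first by apply/cvg_ex; exists df.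
by apply: cvg_lim => //; exact: norm_hausdorff.
Qed.

Lemma nbhs_pairP (R : realType) (x t : R) (A : set (R * R)) : nbhs (x, t) A ->
  exists2 r : R, 0 < r & forall y s, `|y - x| < r -> `|s - t| < r -> A (y, s).
Proof.
move=> /nbhs_ballP[r /= r0 rA]; exists r => // y s yx st; apply: rA.
by split; rewrite /ball /= distrC.
Qed.

Lemma is_derive_affine (R : realType) (b t z : R) :
  is_derive z 1 (fun z => b * z + t) b.
Proof.
apply: is_derive1P; have : (b : R) @[h --> (0 : R)^'] --> b by exact: cvg_cst.
apply: cvg_trans; apply: near_eq_cvg; near=> h.
have h0 : h != 0 by near: h; exact: nbhs_dnbhs_neq.
by field.
Unshelve. all: by end_near. Qed.

(** The increment is a step in time at x0, treated by the chain rule in one variable, followed by a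
    step in space at the new time, treated by the mean value theorem and the continuity of
    [dx f]. *)
Lemma C1_directional_limit (R : realType) (f : R -> R -> R) (a b x0 t0 : R) :
  (\forall q \near (x0, t0), C1_at f q) ->
  (h^-1 * (f (x0 + a * h) (t0 + b * h) - f x0 t0)) @[h --> (0 : R)^']
    --> a * dx f x0 t0 + b * dt f x0 t0.
Proof.
move=> /nbhs_pairP[r r0 C1f].
have [_ /= dtf cdx _] : C1_at f (x0, t0) by apply: C1f; rewrite subrr normr0.
have d1 : is_derive (b * 0 + t0) 1 (f x0) (dt f x0 t0).
  have E : b * 0 + t0 = t0 by rewrite mulr0 add0r.
  rewrite E; apply: DeriveDef; first exact: dtf.
  exact/esym/derive1E.
have dline := @is_derive1_comp _ (f x0) _ 0 _ _ d1 (is_derive_affine b t0 0).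
have dlim := derivable_cvg_derive1 (@ex_derive _ _ _ _ _ _ _ dline).
rewrite derive1E (@derive_val _ _ _ _ _ _ _ dline) in dlim.
suff lim1 : (h^-1 * (f (x0 + a * h) (t0 + b * h) - f x0 (t0 + b * h)))
    @[h --> (0 : R)^'] --> a * dx f x0 t0.
  have lim2 : (h^-1 * (f (x0 + a * h) (t0 + b * h) - f x0 (t0 + b * h)) +
      h^-1 * (f x0 (t0 + b * h) - f x0 t0)) @[h --> (0 : R)^'] -->
      a * dx f x0 t0 + b * dt f x0 t0.
    apply: cvgD lim1 _; rewrite mulrC; apply: cvg_trans dlim.
    apply: near_eq_cvg; apply: nearW => h /=.
    by rewrite add0r mulr0 add0r [b * h + t0]addrC.
  apply: cvg_trans lim2; apply: near_eq_cvg; apply: nearW => h /=.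
  rewrite -mulrDr; congr (_ * _).
  by rewrite addrA subrK.
apply/cvgrPdist_le => e e0.
have e1 : 0 < e / (`|a| + 1) by rewrite divr_gt0// ltr_wpDl.
have [r1 r10 near1] : exists2 r1 : R, 0 < r1 & forall y s, `|y - x0| < r1 -> `|s - t0| < r1 ->
    `|dx f x0 t0 - dx f y s| <= e / (`|a| + 1).
  by have /cvgrPdist_le/(_ _ e1)/nbhs_pairP := cdx.
(* For |h| below this bound both |a h| and |b h| are below r and r1; the summand 1 keeps the
   denominator positive. *)
pose r2 := Num.min r r1 / (`|a| + `|b| + 1).
have den0 : 0 < `|a| + `|b| + 1 by rewrite ltr_wpDl// addr_ge0.
have r20 : 0 < r2 by rewrite divr_gt0// lt_min r0.
near=> h.
have h0 : h != 0 by near: h; exact: nbhs_dnbhs_neq.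
have hr2 : `|h| < r2 by near: h; exact: dnbhs0_lt.
have hr2' : `|h| * (`|a| + `|b| + 1) < Num.min r r1 by rewrite -ltr_pdivlMr.
have aM : `|a * h| < Num.min r r1.
  apply: le_lt_trans hr2'; rewrite normrM mulrC ler_wpM2l// -addrA lerDl addr_ge0//.
have bM : `|t0 + b * h - t0| < Num.min r r1.
  apply: le_lt_trans hr2'; rewrite addrAC subrr add0r.
  by rewrite normrM mulrC ler_wpM2l//; have := normr_ge0 a; lra.
move: aM bM; rewrite !lt_min => /andP[aM aM1] /andP[bM bM1].
have [|//|y yx E] := @MVT_ball R (f ^~ (t0 + b * h)) x0 r (a * h).
  by move=> y yr; have [/= dd _ _ _] := C1f y (t0 + b * h) yr bM; exact: dd.
rewrite E (_ : h^-1 * _ = a * dx f y (t0 + b * h)); last first.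
  by rewrite /dx; field.
rewrite -mulrBr normrM.
have := near1 y (t0 + b * h) (le_lt_trans yx aM1) bM1.
rewrite ler_pdivlMr ?ltr_wpDl// => nn.
rewrite mulrC; apply: le_trans nn; rewrite ler_wpM2l// lerDl//.
Unshelve. all: by end_near. Qed.

Lemma is_derive_along (R : realType) (f : R -> R -> R) (a b x t z : R) :
  (\forall q \near (a * z + x, b * z + t), C1_at f q) ->
  is_derive z 1 (fun z => f (a * z + x) (b * z + t))
    (a * dx f (a * z + x) (b * z + t) + b * dt f (a * z + x) (b * z + t)).
Proof.
move=> C1f; have lim := @C1_directional_limit R f a b _ _ C1f; apply: is_derive1P.
apply: cvg_trans lim; apply: near_eq_cvg; apply: nearW => h /=.
by rewrite !mulrDr [in RHS]addrAC [b * z + _ + t]addrAC.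
Qed.

(** Mean value theorem in x for F x y2 - F x y1, then in y for [Fx]. The order of differentiation is
    fixed, so no symmetry of mixed derivatives enters. *)
Lemma ddiff_mvt (R : realType) (F Fx Fxy : R -> R -> R) (x1 x2 y1 y2 : R) :
  x1 <= x2 -> y1 <= y2 ->
  (forall x y, x1 <= x <= x2 -> y1 <= y <= y2 -> is_derive x 1 (F ^~ y) (Fx x y)) ->
  (forall x y, x1 <= x <= x2 -> y1 <= y <= y2 -> is_derive y 1 (Fx x) (Fxy x y)) ->
  exists x y, [/\ x1 <= x <= x2, y1 <= y <= y2 &
    ddiff F x1 x2 y1 y2 = Fxy x y * ((x2 - x1) * (y2 - y1))].
Proof.
move=> x12 y12 dF dFx.
have dB x : x1 <= x <= x2 -> is_derive x 1 (fun x => F x y2 - F x y1) (Fx x y2 - Fx x y1).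
  by move=> xx; apply: is_deriveB; apply: dF => //; lra.
have [||x xx E] := @MVT_segment R (fun x => F x y2 - F x y1) (fun x => Fx x y2 - Fx x y1) x1 x2 x12.
- by move=> x; rewrite in_itv /= => xx; apply: dB; lra.
- apply: derivable_within_continuous => x; rewrite in_itv /= => xx.
  by have [] := dB x xx.
move: xx; rewrite in_itv /= => xx.
have [||y yy E'] := @MVT_segment R (Fx x) (Fxy x) y1 y2 y12.
- by move=> y; rewrite in_itv /= => yy; apply: dFx => //; lra.
- apply: derivable_within_continuous => y; rewrite in_itv /= => yy.
  by have [] := dFx x y xx yy.
move: yy; rewrite in_itv /= => yy.
exists x, y; split => //.
have -> : ddiff F x1 x2 y1 y2 = F x2 y2 - F x2 y1 - (F x1 y2 - F x1 y1).
  by rewrite /ddiff; ring.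
by rewrite E E'; ring.
Qed.

Lemma is_derive_lincomb (R : realType) (f g : R -> R) (a b x df dg : R) :
  is_derive x 1 f df -> is_derive x 1 g dg ->
  is_derive x 1 (fun y => a * f y + b * g y) (a * df + b * dg).
Proof.
move=> hf hg.
have -> : (fun y => a * f y + b * g y) = (a \*: f) + (b \*: g) by [].
by apply: is_deriveD; apply: is_deriveZ.
Qed.

(** The arithmetic of [smooth_ddiff], with b = 1 / (2 c): p1, p2, p3, p4 are the values at the
    centre of u_xx, of the two mixed derivatives and of u_tt. The a's and b's are their values at
    the intermediate points given by the two orders of differentiation. *)
Lemma average_estimate (R : realType) (b e p1 p2 p3 p4 a1 a2 a3 a4 b1 b2 b3 b4 : R) :
  0 < b -> `|p1 - a1| <= e -> `|p2 - a2| <= e -> `|p3 - a3| <= e -> `|p4 - a4| <= e ->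
  `|p1 - b1| <= e -> `|p2 - b2| <= e -> `|p3 - b3| <= e -> `|p4 - b4| <= e ->
  `|((2^-1 * (2^-1 * a1 + b * a2) + (- b) * (2^-1 * a3 + b * a4)) +
     (2^-1 * (2^-1 * b1 + (- b) * b2) + b * (2^-1 * b3 + (- b) * b4))) / 2 -
    (p1 / 4 - b * b * p4)| <= e * (1 + b + b * b).
Proof.
move=> b0 n1a n2a n3a n4a n1b n2b n3b n4b.
have -> : ((2^-1 * (2^-1 * a1 + b * a2) + (- b) * (2^-1 * a3 + b * a4)) +
     (2^-1 * (2^-1 * b1 + (- b) * b2) + b * (2^-1 * b3 + (- b) * b4))) / 2 -
    (p1 / 4 - b * b * p4) =
  - (8^-1 * ((p1 - a1) + (p1 - b1)))
  + b * (4^-1 * (((p2 - b2) - (p2 - a2)) + ((p3 - a3) - (p3 - b3))))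
  + b * b * (2^-1 * ((p4 - a4) + (p4 - b4))) by field.
have h1 : `|8^-1 * ((p1 - a1) + (p1 - b1))| <= e.
  by move: n1a n1b; rewrite !ler_norml; lra.
have h2 : `|4^-1 * (((p2 - b2) - (p2 - a2)) + ((p3 - a3) - (p3 - b3)))| <= e.
  by move: n2a n2b n3a n3b; rewrite !ler_norml; lra.
have h3 : `|2^-1 * ((p4 - a4) + (p4 - b4))| <= e.
  by move: n4a n4b; rewrite !ler_norml; lra.
apply: le_trans (ler_normD _ _) _; apply: le_trans (lerD (ler_normD _ _) (lexx _)) _.
rewrite normrN [`|b * _|]normrM [`|b * b * _|]normrM (gtr0_norm b0) (gtr0_norm (mulr_gt0 b0 b0)).
have -> : e * (1 + b + b * b) = e + b * e + b * b * e by ring.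
by apply: lerD; [apply: lerD => //; rewrite ler_pM2l|rewrite ler_pM2l ?mulr_gt0].
Qed.

Lemma eq_average (R : realType) (a b d s : R) :
  d = a * s -> d = b * s -> d = (a + b) / 2 * s.
Proof.
move=> ha hb; rewrite mulrAC mulrDl -ha -hb; lra.
Qed.

(* The mixed derivatives enter with opposite signs in the two orders of
   differentiation, so they cancel in the average and need not be equal. *)
Lemma smooth_ddiff (R : realType) (c x0 y0 : R) (u : R -> R -> R) :
  0 < c ->
  (\forall q \near ((x0 + y0) / 2, (y0 - x0) / (2 * c)), C2_at u q) ->
  forall k, 0 < k -> exists2 r, 0 < r & forall x1 x2 y1 y2 : R,
    x1 <= x2 -> y1 <= y2 ->
    x0 - r < x1 -> x2 < x0 + r -> y0 - r < y1 -> y2 < y0 + r ->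
    `|ddiff (fun x y => u ((x + y) / 2) ((y - x) / (2 * c))) x1 x2 y1 y2 -
      (dx (dx u) ((x0 + y0) / 2) ((y0 - x0) / (2 * c)) -
       c ^- 2 * dt (dt u) ((x0 + y0) / 2) ((y0 - x0) / (2 * c))) / 4 *
      ((x2 - x1) * (y2 - y1))| <= k * ((x2 - x1) * (y2 - y1)).
Proof.
move=> c0; set p := (x0 + y0) / 2; set s := (y0 - x0) / (2 * c) => C2u k k0.
pose b := (2 * c)^-1.
have b0 : 0 < b by rewrite invr_gt0 mulr_gt0.
have C2p : C2_at u (p, s) by exact: nbhs_singleton.
have [_ _ [_ _ cxx cxt] [_ _ ctx ctt]] := C2p.
have [r0 r00 near0] := nbhs_pairP (nbhs_interior C2u).
pose e := k / (1 + b + b * b).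
have den : 0 < 1 + b + b * b by rewrite !addr_gt0// mulr_gt0.
have e0 : 0 < e by rewrite divr_gt0.
have near_e (f : R -> R -> R) : {for (p, s), continuous (uncur f)} ->
    exists2 r : R, 0 < r & forall y t, `|y - p| < r -> `|t - s| < r -> `|f p s - f y t| <= e.
  by move=> /cvgrPdist_le/(_ _ e0)/nbhs_pairP.
have [r1 r10 near1] := near_e _ cxx; have [r2 r20 near2] := near_e _ cxt.
have [r3 r30 near3] := near_e _ ctx; have [r4 r40 near4] := near_e _ ctt.
have [r5 r50 [le0 le1 le2 le3 le4]] : exists2 r5 : R, 0 < r5 &
    [/\ r5 <= r0, r5 <= r1, r5 <= r2, r5 <= r3 & r5 <= r4].
  exists (Num.min (Num.min r0 r1) (Num.min r2 (Num.min r3 r4))).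
    by rewrite !lt_min r00 r10 r20 r30 r40.
  by rewrite !ge_min !lexx ?orbT.
(* The time coordinate varies by less than r / c, hence the second bound. *)
have [r r0' [rr rc]] : exists2 r : R, 0 < r & r <= r5 /\ r <= c * r5.
  exists (Num.min r5 (c * r5)); first by rewrite lt_min r50 mulr_gt0.
  by rewrite !ge_min !lexx ?orbT.
exists r => // x1 x2 y1 y2 x12 y12 xr1 xr2 yr1 yr2.
have box x y : x1 <= x <= x2 -> y1 <= y <= y2 ->
    `|(x + y) / 2 - p| < r5 /\ `|(y - x) / (2 * c) - s| < r5.
  move=> xx yy.
  split; first by rewrite /p ltr_norml; lra.
  rewrite /s -mulrBl normrM [X in _ * X]gtr0_norm ?invr_gt0 ?mulr_gt0//.
  rewrite ltr_pdivrMr ?mulr_gt0// (_ : r5 * (2 * c) = c * r5 + c * r5); last by ring.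
  by rewrite ltr_norml; lra.
have C2near x y : x1 <= x <= x2 -> y1 <= y <= y2 ->
    \forall q \near ((x + y) / 2, (y - x) / (2 * c)), C2_at u q.
  move=> xx yy; have [bx bt] := box x y xx yy.
  exact: (near0 _ _ (lt_le_trans bx le0) (lt_le_trans bt le0)).
have dX (f : R -> R -> R) x y :
    (\forall q \near ((x + y) / 2, (y - x) / (2 * c)), C1_at f q) ->
    is_derive x 1 (fun x => f ((x + y) / 2) ((y - x) / (2 * c)))
     (2^-1 * dx f ((x + y) / 2) ((y - x) / (2 * c)) + (- b) * dt f ((x + y) / 2) ((y - x) / (2 * c))).
  have E1 z : (z + y) / 2 = 2^-1 * z + y / 2 by lra.
  have E2 z : (y - z) / (2 * c) = - b * z + y * b by rewrite /b; ring.
  have -> : (fun x => f ((x + y) / 2) ((y - x) / (2 * c))) = (fun x => f (2^-1 * x + y / 2) (- b * x + y * b)).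
    by apply/funext => z; rewrite E1 E2.
  by rewrite E1 E2 => H; exact: is_derive_along.
have dY (f : R -> R -> R) x y :
    (\forall q \near ((x + y) / 2, (y - x) / (2 * c)), C1_at f q) ->
    is_derive y 1 (fun y => f ((x + y) / 2) ((y - x) / (2 * c)))
     (2^-1 * dx f ((x + y) / 2) ((y - x) / (2 * c)) + b * dt f ((x + y) / 2) ((y - x) / (2 * c))).
  have E1 z : (x + z) / 2 = 2^-1 * z + x / 2 by lra.
  have E2 z : (z - x) / (2 * c) = b * z + - (x * b) by rewrite /b; ring.
  have -> : (fun y => f ((x + y) / 2) ((y - x) / (2 * c))) = (fun y => f (2^-1 * y + x / 2) (b * y + - (x * b))).
    by apply/funext => z; rewrite E1 E2.
  by rewrite E1 E2 => H; exact: is_derive_along.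
pose F x y := u ((x + y) / 2) ((y - x) / (2 * c)).
pose at_ (f : R -> R -> R) x y := f ((x + y) / 2) ((y - x) / (2 * c)).
have C1u x y : x1 <= x <= x2 -> y1 <= y <= y2 ->
   [/\ \forall q \near ((x + y) / 2, (y - x) / (2 * c)), C1_at u q,
   \forall q \near ((x + y) / 2, (y - x) / (2 * c)), C1_at (dx u) q &
   \forall q \near ((x + y) / 2, (y - x) / (2 * c)), C1_at (dt u) q].
  by move=> xx yy; split; apply: filterS (C2near x y xx yy) => q [].
have [||xa [ya [xxa yya Ea]]] := @ddiff_mvt R F
  (fun x y => 2^-1 * at_ (dx u) x y + (- b) * at_ (dt u) x y)
  (fun x y => 2^-1 * (2^-1 * at_ (dx (dx u)) x y + b * at_ (dt (dx u)) x y) +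
    (- b) * (2^-1 * at_ (dx (dt u)) x y + b * at_ (dt (dt u)) x y))
  x1 x2 y1 y2 x12 y12.
- by move=> x y xx yy; have [h _ _] := C1u x y xx yy; exact: dX.
- move=> x y xx yy; have [_ h1 h2] := C1u x y xx yy.
  exact: (is_derive_lincomb 2^-1 (- b) (dY _ _ _ h1) (dY _ _ _ h2)).
have [||yb [xb [yyb xxb Eb]]] := @ddiff_mvt R (fun y x => F x y)
  (fun y x => 2^-1 * at_ (dx u) x y + b * at_ (dt u) x y)
  (fun y x => 2^-1 * (2^-1 * at_ (dx (dx u)) x y + (- b) * at_ (dt (dx u)) x y) +
    b * (2^-1 * at_ (dx (dt u)) x y + (- b) * at_ (dt (dt u)) x y))
  y1 y2 x1 x2 y12 x12.
- by move=> y x yy xx; have [h _ _] := C1u x y xx yy; exact: dY.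
- move=> y x yy xx; have [_ h1 h2] := C1u x y xx yy.
  exact: (is_derive_lincomb 2^-1 b (dX _ _ _ h1) (dX _ _ _ h2)).
have EF : ddiff (fun y x => F x y) y1 y2 x1 x2 = ddiff F x1 x2 y1 y2.
  by rewrite /ddiff; ring.
rewrite EF in Eb; rewrite -/F.
set S := (x2 - x1) * (y2 - y1) in Ea *.
have S0 : 0 <= S by rewrite /S mulr_ge0 ?subr_ge0.
have ES : (y2 - y1) * (x2 - x1) = S by rewrite /S mulrC.
rewrite ES in Eb.
have [bxa bta] := box xa ya xxa yya; have [bxb btb] := box xb yb xxb yyb.
have n1a := near1 _ _ (lt_le_trans bxa le1) (lt_le_trans bta le1).
have n1b := near1 _ _ (lt_le_trans bxb le1) (lt_le_trans btb le1).
have n2a := near2 _ _ (lt_le_trans bxa le2) (lt_le_trans bta le2).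
have n2b := near2 _ _ (lt_le_trans bxb le2) (lt_le_trans btb le2).
have n3a := near3 _ _ (lt_le_trans bxa le3) (lt_le_trans bta le3).
have n3b := near3 _ _ (lt_le_trans bxb le3) (lt_le_trans btb le3).
have n4a := near4 _ _ (lt_le_trans bxa le4) (lt_le_trans bta le4).
have n4b := near4 _ _ (lt_le_trans bxb le4) (lt_le_trans btb le4).
set A := 2^-1 * _ + - b * _ in Ea; set B := 2^-1 * _ + b * _ in Eb.
rewrite (eq_average Ea Eb).
rewrite -mulrBl normrM (ger0_norm S0); apply: ler_wpM2r => //.
have -> : (dx (dx u) p s - c ^- 2 * dt (dt u) p s) / 4 = dx (dx u) p s / 4 - b * b * dt (dt u) p s.
  clear -c0; rewrite /b; field; exact: lt0r_neq0.
have -> : k = e * (1 + b + b * b) by rewrite /e divfK// gt_eqF.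
exact: (average_estimate b0 n1a n2a n3a n4a n1b n2b n3b n4b).
Qed.

(** * The wave potential *)

Definition clampr (R : realType) (a b x : R) : R := Num.max a (Num.min b x).

Lemma clampr_in (R : realType) (a b x : R) : a <= b -> a <= clampr a b x <= b.
Proof. by move=> ab; rewrite /clampr le_max lexx ge_max ab ge_min lexx. Qed.

Lemma clampr_id (R : realType) (a b x : R) : a <= x <= b -> clampr a b x = x.
Proof. by move=> /andP[? ?]; rewrite /clampr min_r// max_r. Qed.

Lemma clampr_le (R : realType) (a b x : R) : a <= b -> x <= a -> clampr a b x = a.
Proof. by move=> ? ?; rewrite /clampr max_l// ge_min; apply/orP; right. Qed.

Lemma clampr_ge (R : realType) (a b x : R) : a <= b -> b <= x -> clampr a b x = b.
Proof. by move=> ab bx; rewrite /clampr min_l// max_r. Qed.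

Lemma continuous_clampr (R : realType) (a b : R) : continuous (@clampr R a b).
Proof.
move=> x; apply: continuous_max; first exact: cvg_cst.
by apply: continuous_min; [exact: cvg_cst|exact: cvg_id].
Qed.

(** Composition with the projection onto the closed half-strip: continuous on the plane, with
    constant continuation in x beyond the walls and in t before 0. *)
Definition extend (R : realType) (a1 a2 : R) (u : R -> R -> R) (x t : R) : R :=
  u (clampr a1 a2 x) (Num.max 0 t).

Lemma extendE (R : realType) (a1 a2 : R) (u : R -> R -> R) (x t : R) :
  a1 <= x <= a2 -> 0 <= t -> extend a1 a2 u x t = u x t.
Proof. by move=> xx t0; rewrite /extend clampr_id// max_r. Qed.

Lemma continuous_extend (R : realType) (a1 a2 : R) (u : R -> R -> R) :
  a1 <= a2 -> {within closed_half_strip a1 a2, continuous (uncur u)} ->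
  continuous (uncur (extend a1 a2 u)).
Proof.
move=> a12 /subspace_continuousP uc [x t].
pose pr (q : R * R) := (clampr a1 a2 q.1, Num.max 0 q.2).
have prin q : closed_half_strip a1 a2 (pr q).
  by split; [exact: clampr_in|rewrite le_max lexx].
have prc : pr q @[q --> (x, t)] --> pr (x, t).
  apply: (@continuous2_cvg _ _ _ _ _ _ (fun q : R * R => clampr a1 a2 q.1)
    (fun q : R * R => Num.max 0 q.2) pair).
  - by rewrite (_ : (fun z => _) = id); [exact: cvg_id|apply/funext => -[]].
  - apply: (cvg_comp _ _ (@cvg_fst _ _ (nbhs x) (nbhs t) _)).
    exact: continuous_clampr.
  - apply: (cvg_comp _ _ (@cvg_snd _ _ (nbhs x) (nbhs t) _)).
    by apply: (@continuous_max _ _ (cst 0) id t); [exact: cvg_cst|exact: cvg_id].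
have prw : pr q @[q --> (x, t)] -->
    within (closed_half_strip a1 a2) (nbhs (pr (x, t))).
  move=> A /= /prc nA; change (nbhs (x, t) (pr @^-1` A)).
  by apply: filterS (nA : nbhs (x, t) _) => q /= h; exact: (h (prin q)).
exact: (cvg_comp _ _ prw (uc _ (prin (x, t)))).
Qed.

(** A front moving to the right is a level line of x - ct, one moving to the left a level line of x
    + ct. A single countable set of levels serves both coordinates. *)
Lemma fronts_characteristic (R : realType) (c : R) (Phi : set (front R)) (q : R * R) :
  on_fronts c Phi q ->
  [set F.2 | F in Phi] (slant (- c) q) \/ [set F.2 | F in Phi] (slant c q).
Proof.
move=> [[n s] PF]; rewrite /front_pos /front_dir /slant /=; case: n PF => PF ->.
  by left; exists (true, s) => //=; ring.
by right; exists (false, s) => //=; ring.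
Qed.

Lemma countable_front_values (R : realType) (Phi : set (front R)) :
  countable Phi -> countable [set F.2 | F in Phi].
Proof. by apply: sub_countable; exact: card_image_le. Qed.

Lemma slant_levels_null (R : realType) (k : R) (S : set R) : k != 0 -> countable S ->
  (@lebesgue_measure R \x @lebesgue_measure R)%E.-negligible [set q | S (slant k q)].
Proof.
move=> k0 /countable_sub_range[e Se].
have h : (@lebesgue_measure R \x @lebesgue_measure R)%E.-negligible
    (\bigcup_n (slant k @^-1` [set e n])).
  apply: negligible_bigcup => n; exists (slant k @^-1` [set e n]); split => //.
    exact: measurable_slant_level.
  exact: slant_level_null.
by apply: negligibleS h => q /= /Se[n _ E]; exists n.
Qed.

(** The source is integrable only over bounded times, hence the cut at T; up to time T the backward
    cone does not see it. *)
Definition wave_potential (R : realType) (c a1 a2 T : R) (G : R -> R -> R) : R -> R -> R :=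
  quadrant (@lebesgue_measure R \x @lebesgue_measure R)%E
    (`[a1, a2] `*` `[0, T]) (uncur G) (slant (- c)) (slant c).

(** The windows integrate to the area of the diamond, so replacing [G] by the constant g0 costs at
    most k times that area. [N] will be the union of the characteristics that may carry fronts; off
    it the equation identifies [G]. *)
Lemma source_estimate (R : realType) (c a1 a2 T g0 k : R) (G : R -> R -> R)
    (N : set (R * R)) (x1 x2 y1 y2 : R) :
  0 < c -> 0 <= k ->
  (@lebesgue_measure R \x @lebesgue_measure R)%E.-integrable
    (`[a1, a2] `*` `[0, T]) (EFin \o uncur G) ->
  (@lebesgue_measure R \x @lebesgue_measure R)%E.-negligible N ->
  x1 <= x2 -> y1 <= y2 ->
  (forall z : R * R, x1 <= slant (- c) z <= x2 -> y1 <= slant c z <= y2 ->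
    (`[a1, a2] `*` `[0, T]) z /\ (~ N z -> `|uncur G z - g0| <= k)) ->
  `|ddiff (wave_potential c a1 a2 T G) x1 x2 y1 y2 +
      g0 * ((x2 - x1) * (y2 - y1) / (2 * c))| <=
    k * ((x2 - x1) * (y2 - y1) / (2 * c)).
Proof.
set D : set (R * R) := _ `*` _.
set mu2 := (_ \x _)%E => c0 k0 iG negN x12 y12 near.
have mD : measurable (D : set (measurableTypeR R * measurableTypeR R)).
  by apply: measurableX; exact: measurable_itv.
pose ww (z : R * R) := window x1 x2 (slant (- c) z) * window y1 y2 (slant c z).
have mww : measurable_fun D ww.
  by apply: measurable_funM; apply: measurable_window; exact: measurable_slant.
have ww0 z : 0 <= ww z by apply: mulr_ge0; exact: window_ge0.
have ww1 z : `|ww z| <= 1.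
  by rewrite ger0_norm// mulr_ile1 ?window_ge0// window_le1.
have Earea : \int[mu2]_(z in D) ww z = (x2 - x1) * (y2 - y1) / (2 * c).
  by apply: integral_window => // z ? ?; have [] := near z.
have muD : (mu2 D < +oo)%E.
  have -> : mu2 D = (@lebesgue_measure R `[a1, a2]%classic * @lebesgue_measure R `[0%R, T]%classic)%E.
    by apply: product_measure1E; exact: measurable_itv.
  by rewrite !lebesgue_measure_segment -EFinM ltry.
have i1 (a : R) : mu2.-integrable D (EFin \o cst a).
  apply: measurable_bounded_integrable => //.
  by exists `|a|; split=> // y ay z _; rewrite /= ltW.
have ikw f : mu2.-integrable D (EFin \o f) -> mu2.-integrable D (EFin \o (fun z => f z * ww z)).
  by move=> fi; apply: integrable_kernel.
have mG : measurable_fun D (uncur G) by move/integrableP : iG => [/measurable_EFinP].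
have iGg : mu2.-integrable D (EFin \o (fun z => uncur G z - g0)).
  by have := integrableB mD iG (i1 g0); apply: eq_integrable.
have cw (a : R) : \int[mu2]_(z in D) (a * ww z) = a * ((x2 - x1) * (y2 - y1) / (2 * c)).
  rewrite -Earea RintegralZl//.
  by have := ikw _ (i1 1); apply: eq_integrable => // z _ /=; rewrite mul1r.
rewrite ddiff_quadrant//; do ?exact: measurable_slant.
rewrite -(cw g0) addrC -opprB normrN -(RintegralB mD (ikw _ iG) (ikw _ (i1 g0))).
rewrite (_ : (fun z => _ - _) = (fun z => (uncur G z - g0) * ww z)); last first.
  by apply/funext => z; rewrite mulrBl.
apply: le_trans (le_normr_Rintegral mD (ikw _ iGg)) _; rewrite -(cw k).
have ik : mu2.-integrable D (EFin \o (fun z => k * ww z)) by exact: ikw (i1 k).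
have ia : mu2.-integrable D (EFin \o (fun z => `|(uncur G z - g0) * ww z|)).
  exact: integrable_norm (ikw _ iGg).
rewrite /Rintegral fine_le//; do ?exact: integrable_fin_num.
apply: ae_ge0_le_integral => //.
- exact: measurable_int ia.
- by move=> z Dz; rewrite lee_fin mulr_ge0.
- exact: measurable_int ik.
- case: negN => M [mM M0 NM]; exists M; split => // z /= nz; apply: NM.
  apply: contrapT => Nz; apply: nz => Dz; rewrite lee_fin normrM (ger0_norm (ww0 z)).
  have [xz|xz] := pselect (x1 <= slant (- c) z <= x2); last first.
    by rewrite /ww (window_out x12 xz) mul0r !mulr0.
  have [yz|yz] := pselect (y1 <= slant c z <= y2); last first.
    by rewrite /ww (window_out y12 yz) !mulr0.
  by apply: ler_wpM2r => //; have [_] := near z xz yz; apply.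
Qed.

Lemma countable_setU (T : Type) (A B : set T) :
  countable A -> countable B -> countable (A `|` B).
Proof.
move=> cA cB.
have -> : A `|` B = \bigcup_(b in [set: bool]) (if b then A else B).
  apply/seteqP; split => x [].
  - by exists true.
  - by exists false.
  - by case => _ ?; [left|right].
by apply: bigcup_countable => // -[].
Qed.

Lemma slant_levels (R : realType) (c x y : R) : 0 < c ->
  slant (- c) ((x + y) / 2, (y - x) / (2 * c)) = x /\
  slant c ((x + y) / 2, (y - x) / (2 * c)) = y.
Proof. by move=> c0; rewrite /slant /=; split; field; rewrite gt_eqF. Qed.

Lemma nbhs_strip (R : realType) (a1 a2 T x t : R) : a1 < x < a2 -> 0 < t < T ->
  \forall q \near (x, t), half_strip a1 a2 q /\ q.2 < T.
Proof.
move=> xa tT.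
exists ([set y | a1 < y < a2], [set s | 0 < s < T]) => /=.
  split.
    apply: (@near_in_itvoo R a1 a2 x).
    by rewrite in_itv.
  apply: (@near_in_itvoo R 0 T t).
  by rewrite in_itv.
by move=> [y s] /= [ya /andP[s0 sT]].
Qed.

Lemma continuous_wave_potential (R : realType) (c a1 a2 T : R) (G : R -> R -> R) :
  0 < c ->
  (@lebesgue_measure R \x @lebesgue_measure R)%E.-integrable
    (`[a1, a2] `*` `[0, T]) (EFin \o uncur G) ->
  (forall y, continuous (wave_potential c a1 a2 T G ^~ y)) /\
  (forall x, continuous (wave_potential c a1 a2 T G x)).
Proof.
move=> c0 iG.
have mD : measurable (`[a1, a2] `*` `[0, T] : set (measurableTypeR R * measurableTypeR R)).
  by apply: measurableX; exact: measurable_itv.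
split=> z.
  apply: continuous_quadrantl => //; do ?exact: measurable_slant.
  by move=> r; apply: slant_level_null; rewrite oppr_eq0 gt_eqF.
apply: continuous_quadrantr => //; do ?exact: measurable_slant.
by move=> r; apply: slant_level_null; rewrite gt_eqF.
Qed.

(** * Exact differences inside the half-strip *)

Section classical.
Context (R : realType) (c a1 a2 T : R) (G u : R -> R -> R) (Phi : set (front R)).
Hypotheses (c0 : 0 < c) (a12 : a1 < a2)
  (iG : (@lebesgue_measure R \x @lebesgue_measure R)%E.-integrable
    (`[a1, a2] `*` `[0, T]) (EFin \o uncur G))
  (cs : classical_solution c a1 a2 G u Phi).
Let S : set R := [set F.2 | F in Phi].

Lemma regular_near (x y : R) :
  a1 < (x + y) / 2 < a2 -> 0 < (y - x) / (2 * c) -> ~ S x -> ~ S y ->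
  \forall q \near ((x + y) / 2, (y - x) / (2 * c)), C2_at u q.
Proof.
move=> xa t0 nSx nSy; set p := (_, _).
have hp : half_strip a1 a2 p by [].
have nf : ~ on_fronts c Phi p.
  by have [Ex Ey] := slant_levels x y c0; move/fronts_characteristic; rewrite Ex Ey => -[].
have cp : closed_half_strip a1 a2 p.
  by case/andP: xa => ? ?; rewrite /closed_half_strip /=; split; [lra|exact: ltW].
have := cs_regular cs cp nf.
have := @nbhs_strip R a1 a2 ((y - x) / (2 * c) + 1) _ _ xa.
have tt : 0 < (y - x) / (2 * c) < (y - x) / (2 * c) + 1 by rewrite t0 ltrDl ltr01.
by move=> /(_ _ tt); apply: filterS2 => q [? _]; apply.
Qed.

(** With g the value of the wave operator at a point, the two differences over a small rectangle of
    area A are close to 2 * g A / 4 and - c * g A / (2 c), which cancel. *)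
Definition wave_combination (x y : R) : R :=
  2 * extend a1 a2 u ((x + y) / 2) ((y - x) / (2 * c)) +
  c * wave_potential c a1 a2 T G x y.

Lemma wave_combination_local (x y : R) :
  a1 < (x + y) / 2 < a2 -> 0 < (y - x) / (2 * c) < T -> ~ S x -> ~ S y ->
  forall k, 0 < k -> exists2 r, 0 < r & forall x1 x2 y1 y2,
    x1 <= x2 -> y1 <= y2 -> x - r < x1 -> x2 < x + r -> y - r < y1 -> y2 < y + r ->
    `|ddiff wave_combination x1 x2 y1 y2| <= k * (x2 - x1) * (y2 - y1).
Proof.
move=> xa tT nSx nSy k k0; have /andP[t0 tT'] := tT.
have C2u := regular_near xa t0 nSx nSy.
have k4 : 0 < k / 4 by rewrite divr_gt0.
have [r1 r10 near1] := smooth_ddiff c0 C2u k4.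
set p := (x + y) / 2 in xa C2u near1 *; set s := (y - x) / (2 * c) in t0 tT tT' C2u near1 *.
pose box f (q : R * R) := f q.1 q.2 : R.
pose g0 := dx (dx u) p s - c ^- 2 * dt (dt u) p s.
have [_ _ [_ _ cxx _] [_ _ _ ctt]] : C2_at u (p, s) by exact: nbhs_singleton.
have cg : {for (p, s), continuous (uncur (fun x t => dx (dx u) x t - c ^- 2 * dt (dt u) x t))}.
  by apply: cvgB; [exact: cxx|apply: cvgM; [exact: cvg_cst|exact: ctt]].
have [r2 r20 near2] : exists2 r : R, 0 < r & forall y s', `|y - p| < r -> `|s' - s| < r ->
    [/\ half_strip a1 a2 (y, s'), s' < T &
      `|g0 - (dx (dx u) y s' - c ^- 2 * dt (dt u) y s')| <= k].
  apply: (@nbhs_pairP R p s [set q | [/\ half_strip a1 a2 (q.1, q.2), q.2 < T &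
     `|g0 - (dx (dx u) q.1 q.2 - c ^- 2 * dt (dt u) q.1 q.2)| <= k]]).
  have h1 := nbhs_strip xa tT.
  have /cvgrPdist_le/(_ _ k0) h2 := cg.
  by apply: filterS2 h1 h2 => -[y' s'] /= [].
have [r r0 [rr1 rr2 rc]] : exists2 r : R, 0 < r & [/\ r <= r1, r <= r2 & r <= c * r2].
  exists (Num.min r1 (Num.min r2 (c * r2))).
    by rewrite !lt_min r10 r20 mulr_gt0.
  by rewrite !ge_min !lexx ?orbT.
exists r => // x1 x2 y1 y2 x12 y12 xx1 xx2 yy1 yy2.
have near3 (z : R * R) : x1 <= slant (- c) z <= x2 -> y1 <= slant c z <= y2 ->
    `|z.1 - p| < r2 /\ `|z.2 - s| < r2.
  rewrite /slant => zx zy; split; first by rewrite /p ltr_norml; lra.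
  rewrite -(ltr_pM2l c0) -{1}(gtr0_norm c0) -normrM.
  have -> : c * (z.2 - s) = c * z.2 - (y - x) / 2.
    by rewrite /s; field; rewrite gt_eqF.
  by rewrite ltr_norml; lra.
have near4 x' y' : x1 <= x' <= x2 -> y1 <= y' <= y2 ->
    `|(x' + y') / 2 - p| < r2 /\ `|(y' - x') / (2 * c) - s| < r2.
  move=> xx yy; have [Ex Ey] := slant_levels x' y' c0.
  by apply: (near3 ((x' + y') / 2, (y' - x') / (2 * c))); rewrite ?Ex ?Ey.
have := near1 x1 x2 y1 y2 x12 y12; set v := fun x y => u _ _ => sm.
have {}sm : `|ddiff v x1 x2 y1 y2 - g0 / 4 * ((x2 - x1) * (y2 - y1))| <= k / 4 * ((x2 - x1) * (y2 - y1)).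
  by apply: sm; clear - xx1 xx2 yy1 yy2 rr1; lra.
have ext x' y' : x1 <= x' <= x2 -> y1 <= y' <= y2 ->
    extend a1 a2 u ((x' + y') / 2) ((y' - x') / (2 * c)) = v x' y'.
  move=> xx yy; have [b1 b2] := near4 x' y' xx yy.
  have [[/= ha ht] _ _] := near2 _ _ b1 b2.
  by rewrite extendE ?(ltW ht)//; case/andP: ha => ? ?; rewrite !ltW.
have src : `|ddiff (wave_potential c a1 a2 T G) x1 x2 y1 y2 +
      g0 * ((x2 - x1) * (y2 - y1) / (2 * c))| <=
    k * ((x2 - x1) * (y2 - y1) / (2 * c)).
  apply: (@source_estimate R c a1 a2 T g0 k G
    ([set q | S (slant (- c) q)] `|` [set q | S (slant c q)])) => //.
  - exact: ltW.
  - have cS : countable S by apply: countable_front_values; exact: cs_fronts cs.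
    by apply: negligibleU; apply: slant_levels_null => //; rewrite ?oppr_eq0 gt_eqF.
  - move=> [z1 z2] zx zy; have [b1 b2] := near3 _ zx zy.
    have [hz zT gz] := near2 _ _ b1 b2; case: (hz) => /= za z0.
    split; first by split => /=; rewrite in_itv /= !ltW//; case/andP: za.
    move=> nS; rewrite distrC /uncur /= -(cs_equation cs)//.
    by move/fronts_characteristic => -[?|?]; apply: nS; [left|right].
have -> : ddiff wave_combination x1 x2 y1 y2 =
    2 * ddiff v x1 x2 y1 y2 + c * ddiff (wave_potential c a1 a2 T G) x1 x2 y1 y2.
  rewrite /ddiff /wave_combination !ext ?lexx ?x12 ?y12//; ring.
set A := (x2 - x1) * (y2 - y1) in sm src *; rewrite -mulrA -/A.
set d1 := ddiff v _ _ _ _ in sm *; set d2 := ddiff _ _ _ _ _ in src *.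
have {}src : `|c * d2 + g0 / 2 * A| <= k / 2 * A.
  have -> : c * d2 + g0 / 2 * A = c * (d2 + g0 * (A / (2 * c))) by field; rewrite gt_eqF.
  have -> : k / 2 * A = c * (k * (A / (2 * c))) by field; rewrite gt_eqF.
  by rewrite normrM gtr0_norm// ler_pM2l.
clear -sm src; move: sm src; rewrite !ler_norml; lra.
Qed.

Lemma wave_exact (x1 x2 y1 y2 : R) : x1 <= x2 -> x2 <= y1 -> y1 <= y2 ->
  a1 <= (x1 + y1) / 2 -> (x2 + y2) / 2 <= a2 -> (y2 - x1) / (2 * c) <= T ->
  ddiff wave_combination x1 x2 y1 y2 = 0.
Proof.
move=> x12 xy y12 xa1 xa2 tT.
have [potl potr] := continuous_wave_potential c0 iG.
have uc := continuous_extend (ltW a12) (cs_continuous cs).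
have cS : countable S by apply: countable_front_values; exact: cs_fronts cs.
(* With x1 and x2 declared exceptional, the remaining points have x1 < x < x2. This makes them lie
   strictly between the walls, strictly after time 0 and strictly before T, although the rectangle
   may touch the boundary. *)
pose A := S `|` [set x1; x2].
have cA : countable A.
  by apply: countable_setU => //; apply: finite_set_countable; exact: finite_set2.
apply: (@ddiff_gauge R wave_combination A S) => //.
- move=> y x; apply: cvgD; last by apply: cvgM; [exact: cvg_cst|exact: potl].
  apply: cvgM; first exact: cvg_cst.
  apply: (@continuous_uncur_comp _ _ _ (fun x => (x + y) / 2) (fun x => (y - x) / (2 * c)) uc).
    by apply: (@continuous_affine _ _ 2^-1 (y / 2)) => z; lra.
  by apply: (@continuous_affine _ _ (- (2 * c)^-1) (y / (2 * c))) => z; ring.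
- move=> x y; apply: cvgD; last by apply: cvgM; [exact: cvg_cst|exact: potr].
  apply: cvgM; first exact: cvg_cst.
  apply: (@continuous_uncur_comp _ _ _ (fun y => (x + y) / 2) (fun y => (y - x) / (2 * c)) uc).
    by apply: (@continuous_affine _ _ 2^-1 (x / 2)) => z; lra.
  by apply: (@continuous_affine _ _ (2 * c)^-1 (- x / (2 * c))) => z; ring.
- move=> x y xx yy nAx nSy k k0.
  have xx' : x1 < x < x2.
    rewrite !lt_neqAle; case/andP: xx => -> ->; rewrite !andbT.
    by apply/andP; split; apply/eqP => E; apply: nAx; right; [left|right].
  have nSx : ~ S x by move=> ?; apply: nAx; left.
  have c2 : 0 < 2 * c by rewrite mulr_gt0.
  have [||r r0 h] := @wave_combination_local x y _ _ nSx nSy k k0.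
  + by lra.
  + rewrite divr_gt0//=; last by lra.
    by apply: lt_le_trans tT; rewrite ltr_pM2r ?invr_gt0//; lra.
  + by exists r => // z1 z2 w1 w2 *; apply: h.
Qed.

End classical.

(** * Piecewise continuous data and their primitives *)

Lemma bounded_near_one_sided (R : realType) (f : R -> R) (a b x : R) :
  (a <= x < b -> cvg (f y @[y --> x^'+])) ->
  (a < x <= b -> cvg (f y @[y --> x^'-])) -> a <= x <= b ->
  exists2 M, 0 <= M & \forall y \near x, a <= y <= b -> `|f y| <= M.
Proof.
move=> cr cl /andP[ax xb].
have [Mr Mr0 hr] : exists2 M, 0 <= M & \forall y \near x, x < y -> y <= b -> `|f y| <= M.
  have [xb'|bx] := ltP x b; last first.
    by exists 0; [by []|apply: (@filterE _ (nbhs x))] => y xy yb; move: (lt_le_trans xy yb); rewrite ltNge bx.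
  have /cvg_ex[l /cvgrPdist_le/(_ 1 ltr01)] : cvg (f y @[y --> x^'+]) by apply: cr; rewrite ax.
  move=> h; exists (`|l| + 1); first by rewrite addr_ge0.
  apply: (@filterS _ (nbhs x) _ _ _ _ h) => y + xy _ => /(_ xy) {}h; rewrite -[f y](subKr l).
  by apply: le_trans (ler_normB _ _) _; rewrite lerD2l.
have [Ml Ml0 hl] : exists2 M, 0 <= M & \forall y \near x, y < x -> a <= y -> `|f y| <= M.
  have [ax'|xa] := ltP a x; last first.
    by exists 0; [by []|apply: (@filterE _ (nbhs x))] => y xy yb; move: (le_lt_trans yb xy); rewrite ltNge xa.
  have /cvg_ex[l /cvgrPdist_le/(_ 1 ltr01)] : cvg (f y @[y --> x^'-]) by apply: cl; rewrite ax'.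
  move=> h; exists (`|l| + 1); first by rewrite addr_ge0.
  apply: (@filterS _ (nbhs x) _ _ _ _ h) => y + xy _ => /(_ xy) {}h; rewrite -[f y](subKr l).
  by apply: le_trans (ler_normB _ _) _; rewrite lerD2l.
(* The one-sided limits say nothing about the value at x itself, so it enters the bound
   separately. *)
exists (Mr + Ml + `|f x|); first by rewrite !addr_ge0.
apply: (@filterS2 _ (nbhs x) _ _ _ _ _ hr hl) => y {}hr {}hl /andP[ay yb]; have fx0 := normr_ge0 (f x).
have [yx|xy|->] := ltgtP y x; [have := hl yx ay; lra|have := hr xy yb; lra|lra].
Qed.

(** The one-sided limits give a bound near every point, and compactness of the segment makes it
    uniform. *)
Lemma piecewise_continuous_bounded (R : realType) (a b : R) (f : R -> R) :
  piecewise_continuous a b f ->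
  exists M, forall x, a <= x <= b -> `|f x| <= M.
Proof.
case=> _ cr cl.
have /compact_near_coveringP cpt := @segment_compact R a b.
have : \forall M \near +oo, `[a, b]%classic `<=` [set x | `|f x| <= M].
  have := cpt _ +oo (fun M x => a <= x <= b -> `|f x| <= M) _.
  move=> H; have {}H : \forall M \near +oo, `[a, b]%classic `<=` [set x | a <= x <= b -> `|f x| <= M].
    apply: H => x; rewrite /= in_itv /= => xab.
    have [M M0 hM] := bounded_near_one_sided (cr x) (cl x) xab.
    exists ([set y | a <= y <= b -> `|f y| <= M], [set M' | M <= M']).
      by split => //=; apply: nbhs_pinfty_ge; exact: num_real.
    by move=> [y M'] [/= hy MM'] /hy h; exact: le_trans h MM'.
  by apply: filterS H => M hM x /[dup] xab /hM; apply; move: xab; rewrite /= in_itv.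
move=> [M [_ hM]]; exists (M + 1) => x xab.
by apply: (hM (M + 1)); [rewrite ltrDl|rewrite /= in_itv].
Qed.

Lemma piecewise_continuous_measurable (R : realType) (a b : R) (f : R -> R) :
  piecewise_continuous a b f -> measurable_fun `[a, b] f.
Proof.
case=> -[s sc] _ _.
pose F : set R := [set` a :: b :: s].
have finF : finite_set F by exact: finite_seq.
have cF (A : set R) : measurable (F `&` A).
  apply: countable_measurable; first exact: measurable_set1.
  by apply: finite_set_countable; exact: finite_setIl.
(* On the open part the function is continuous; on the finite remainder every subset is
   measurable. *)
have -> : `[a, b]%classic = (`]a, b[%classic `\` F) `|` (F `&` `[a, b]%classic).
  apply/seteqP; split => x; rewrite /= !in_itv /=.
    move=> /andP[ax xb]; have [xF|nxF] := pselect (F x); first by right; split=> //; rewrite ax.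
    left; split => //; rewrite !lt_neqAle ax xb !andbT.
    apply/andP; split; apply/eqP => E; apply: nxF; rewrite /F /=.
      by rewrite -E !inE eqxx.
    by rewrite E !inE eqxx orbT.
  by case=> [[/andP[ax xb] _]|[]] //; rewrite !ltW.
have oA : open (`]a, b[%classic `\` F).
  rewrite setDE; apply: openI; first exact: interval_open.
  apply: closed_openC; apply: compact_closed; first exact: norm_hausdorff.
  exact: finite_compact.
apply/measurable_funU => //.
  by apply: open_measurable.
split.
  apply: open_continuous_measurable_fun => // x; rewrite inE => -[] /=.
  rewrite in_itv /= => xab nF; apply: sc => //.
  by apply/negP => xs; apply: nF; rewrite /F /= !inE xs !orbT.
move=> _ Y _; rewrite -setIA; exact: cF.
Qed.

Lemma piecewise_continuous_integrable (R : realType) (a b : R) (f : R -> R) :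
  piecewise_continuous a b f ->
  lebesgue_measure.-integrable `[a, b] (EFin \o f).
Proof.
move=> pc; have [M hM] := piecewise_continuous_bounded pc.
apply: measurable_bounded_integrable => //.
- by rewrite /= lebesgue_measure_segment ltry.
- exact: piecewise_continuous_measurable.
- exists M; split; first exact: num_real.
  by move=> y My x /=; rewrite in_itv /= => /hM /le_trans; apply; exact: ltW.
Qed.

Lemma continuous_clampr_comp (R : realType) (a b : R) (f : R -> R) : a <= b ->
  {within `[a, b], continuous f} -> continuous (fun x => f (clampr a b x)).
Proof.
move=> ab /subspace_continuousP fc x.
have inab y : `[a, b]%classic (clampr a b y) by rewrite /= in_itv; exact: clampr_in.
have cw : clampr a b y @[y --> x] --> within `[a, b] (nbhs (clampr a b x)).
  move=> A /= /(@continuous_clampr R a b x) nA; change (nbhs x (clampr a b @^-1` A)).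
  by apply: filterS (nA : nbhs x _) => y /= h; exact: (h (inab y)).
exact: (cvg_comp _ _ cw (fc _ (inab x))).
Qed.

(** Clamping makes the primitive continuous on the whole line with constant tails. These tails
    replace the Heaviside cut-offs of the representation. *)
Definition prim (R : realType) (a b : R) (f : R -> R) (x : R) : R :=
  \int[lebesgue_measure]_(y in `[a, clampr a b x]) f y.

Lemma continuous_prim (R : realType) (a b : R) (f : R -> R) : a <= b ->
  lebesgue_measure.-integrable `[a, b] (EFin \o f) -> continuous (prim a b f).
Proof.
move=> ab fi; apply: (@continuous_clampr_comp R a b (fun x => \int[lebesgue_measure]_(y in `[a, x]) f y)) => //.
exact: parameterized_integral_continuous.
Qed.

Lemma prim_le (R : realType) (a b : R) (f : R -> R) (x : R) : a <= b -> x <= a ->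
  prim a b f x = 0.
Proof. by move=> ab xa; rewrite /prim clampr_le// set_itv1 Rintegral_set1. Qed.

Lemma prim_ge (R : realType) (a b : R) (f : R -> R) (x : R) : a <= b -> b <= x ->
  prim a b f x = prim a b f b.
Proof. by move=> ab xa; rewrite /prim !clampr_ge. Qed.

Lemma primB (R : realType) (a b : R) (f : R -> R) (x y : R) :
  lebesgue_measure.-integrable `[a, b] (EFin \o f) -> a <= x -> x <= y -> y <= b ->
  prim a b f y - prim a b f x = \int[lebesgue_measure]_(z in `[x, y]) f z.
Proof.
move=> fi ax xy yb; rewrite /prim !clampr_id; [|lra|lra].
have iy : lebesgue_measure.-integrable `[a, y] (EFin \o f).
  apply: integrableS fi => //; apply: subset_itvl; rewrite bnd_simp//.
rewrite Rintegral_itvB ?bnd_simp//.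
rewrite Rintegral_itv_obnd_cbnd//.
apply: integrableS fi => //; apply: subset_itv; rewrite bnd_simp//.
Qed.

Lemma heaviside_div (R : realType) (c x : R) : 0 < c -> heaviside (x / c) = heaviside x.
Proof.
move=> c0; have [x0|x0|->] := ltrgt0P x.
- by rewrite !heaviside_gt0// divr_gt0.
- by rewrite !heaviside_lt0// pmulr_llt0// invr_gt0.
- by rewrite mul0r.
Qed.

(** At a = b = 0 the left side is 1/2 and the product 1/4, so the level b = 0 is excluded; it is a
    null set where this is applied. *)
Lemma heaviside_min (R : realType) (a b : R) : b != 0 ->
  heaviside (Num.min a b) = heaviside a * heaviside b.
Proof.
rewrite neq_lt => /orP[b0|b0].
  by rewrite [heaviside b]heaviside_lt0// mulr0 heaviside_lt0// gt_min b0 orbT.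
rewrite [heaviside b]heaviside_gt0// mulr1.
have [ab|ba] := leP a b; first by [].
by rewrite !heaviside_gt0//; exact: lt_trans ba.
Qed.

(** The sum of the coordinates is twice the position. For a source not to the left of the point, Y <
    y forces x < X, so one cone condition implies the other. *)
Lemma quadrant_kernel_left (R : realType) (x y X Y : R) :
  x + y <= X + Y -> Y != y ->
  heaviside (X - x) * heaviside (y - Y) = heaviside (y - Y).
Proof.
move=> h; rewrite neq_lt => /orP[Yy|yY].
  by rewrite [heaviside (X - x)]heaviside_gt0 ?mul1r//; lra.
by rewrite [heaviside (y - Y)]heaviside_lt0 ?mulr0//; lra.
Qed.

Lemma quadrant_kernel_right (R : realType) (x y X Y : R) :
  X + Y <= x + y -> X != x ->
  heaviside (X - x) * heaviside (y - Y) = heaviside (X - x).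
Proof.
move=> h; rewrite neq_lt => /orP[Xx|xX].
  by rewrite [heaviside (X - x)]heaviside_lt0 ?mul0r//; lra.
by rewrite [heaviside (y - Y)]heaviside_gt0 ?mulr1//; lra.
Qed.

Lemma quadrant_kernel_past (R : realType) (x y X Y : R) :
  y <= x -> X <= Y -> X != x -> heaviside (X - x) * heaviside (y - Y) = 0.
Proof.
move=> yx XY; rewrite neq_lt => /orP[Xx|xX].
  by rewrite [heaviside (X - x)]heaviside_lt0 ?mul0r//; lra.
by rewrite [heaviside (y - Y)]heaviside_lt0 ?mulr0//; lra.
Qed.

Lemma slantD (R : realType) (c : R) (z : R * R) : slant (- c) z + slant c z = 2 * z.1.
Proof. by rewrite /slant mulNr; ring. Qed.

(** * The potential outside the strip and as seen from the walls *)

Section potentials.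
Context (R : realType) (c a1 a2 T : R) (G : R -> R -> R).
Hypotheses (c0 : 0 < c)
  (iG : (@lebesgue_measure R \x @lebesgue_measure R)%E.-integrable
    (`[a1, a2] `*` `[0, T]) (EFin \o uncur G)).
Local Notation mu2 := (@lebesgue_measure R \x @lebesgue_measure R)%E.
Local Notation D := (`[a1, a2] `*` `[0, T] : set (R * R)).
Local Notation pot := (wave_potential c a1 a2 T G).

Definition upper_potential (y : R) : R :=
  \int[mu2]_(z in D) (uncur G z * heaviside (y - slant c z)).

Definition lower_potential (x : R) : R :=
  \int[mu2]_(z in D) (uncur G z * heaviside (slant (- c) z - x)).

Let mD : measurable (D : set (measurableTypeR R * measurableTypeR R)).
Proof. by apply: measurableX; exact: measurable_itv. Qed.

Let mG : measurable_fun (D : set (measurableTypeR R * measurableTypeR R)) (uncur G).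
Proof. by move/integrableP : iG => [/measurable_EFinP]. Qed.

Let cN : - c != 0. Proof. by rewrite oppr_eq0 gt_eqF. Qed.

Let cP : c != 0. Proof. by rewrite gt_eqF. Qed.

Let le1 (x : R) : `|heaviside x| <= 1.
Proof. by rewrite ger0_norm ?heaviside_ge0// heaviside_le1. Qed.

Let Deq (f g : R * R -> R) (k r : R) : k != 0 -> measurable_fun D f -> measurable_fun D g ->
  (forall z, D z -> slant k z != r -> f z = g z) ->
  \int[mu2]_(z in D) f z = \int[mu2]_(z in D) g z.
Proof.
move=> k0 mf mg fg.
apply: (@Rintegral_ae_eq _ _ _ mu2 D (slant k @^-1` [set r])) => //.
- exact: measurable_slant_level.
- exact: slant_level_null.
- by move=> z Dz /eqP zr; exact: fg.
Qed.

Let mpot (x y : R) : measurable_fun D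
  (fun z => uncur G z * (heaviside (slant (- c) z - x) * heaviside (y - slant c z))).
Proof.
apply: measurable_funM => //.
by apply: measurable_quadrant_kernel; exact: measurable_slant.
Qed.

Let mup (y : R) : measurable_fun D (fun z => uncur G z * heaviside (y - slant c z)).
Proof.
by apply: measurable_funM => //; apply: measurable_heavisideBr; exact: measurable_slant.
Qed.

Let mlo (x : R) : measurable_fun D (fun z => uncur G z * heaviside (slant (- c) z - x)).
Proof.
by apply: measurable_funM => //; apply: measurable_heavisideBl; exact: measurable_slant.
Qed.

Let DE (z : R * R) : D z -> [/\ a1 <= z.1, z.1 <= a2, 0 <= c * z.2 & z.2 <= T].
Proof.
by move=> [/=]; rewrite !in_itv /= => /andP[? ?] /andP[? ?]; split => //; rewrite mulr_ge0// ltW.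
Qed.

(** To the left of all sources only the left-going characteristic matters, so the potential is
    already an outgoing wave there. *)
Lemma wave_potential_left (x y : R) : x + y <= 2 * a1 -> pot x y = upper_potential y.
Proof.
move=> xy; apply: (Deq (r := y) cP (mpot x y) (mup y)) => z /DE[za _ _ _] zy.
congr (_ * _); apply: quadrant_kernel_left zy.
by rewrite slantD (le_trans xy)// ler_pM2l.
Qed.

Lemma wave_potential_right (x y : R) : 2 * a2 <= x + y -> pot x y = lower_potential x.
Proof.
move=> xy; apply: (Deq (r := x) cN (mpot x y) (mlo x)) => z /DE[_ za _ _] zx.
congr (_ * _); apply: quadrant_kernel_right zx.
by rewrite slantD; apply: le_trans xy; rewrite ler_pM2l.
Qed.

Lemma wave_potential_past (x y : R) : y <= x -> pot x y = 0.
Proof.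
move=> xy; transitivity (\int[mu2]_(z in D) (cst 0 z : R)); last first.
  by rewrite Rintegral_cst// mul0r.
have m0 : measurable_fun D (cst 0 : R * R -> R) by exact: measurable_cst.
apply: (Deq (r := x) cN (mpot x y) m0) => z /DE[_ _ z0 _] zx.
rewrite (quadrant_kernel_past xy _ zx) ?mulr0//.
by rewrite /slant mulNr lerD2l (le_trans _ z0)// oppr_le0.
Qed.

Let iup (y : R) : mu2.-integrable D (EFin \o (fun z => uncur G z * heaviside (y - slant c z))).
Proof.
apply: integrable_kernel => //.
by apply: measurable_heavisideBr; exact: measurable_slant.
Qed.

Let ilo (x : R) : mu2.-integrable D (EFin \o (fun z => uncur G z * heaviside (slant (- c) z - x))).
Proof.
apply: integrable_kernel => //.
by apply: measurable_heavisideBl; exact: measurable_slant.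
Qed.

Let ipot (x y : R) : mu2.-integrable D
  (EFin \o (fun z => uncur G z * (heaviside (slant (- c) z - x) * heaviside (y - slant c z)))).
Proof.
apply: integrable_kernel => //.
  by apply: measurable_quadrant_kernel; exact: measurable_slant.
by move=> z _; exact: quadrant_kernel_le1.
Qed.

(** With travel time from the wall as the normal coordinate, the triangle resting on the wall is
    what a backward cone leaves of the half-plane bounded by its upper characteristic; H(-r) = 1 -
    H(r) turns one into the other. *)
Lemma quadrant_left_wall (x y : R) :
  quadrant mu2 D (uncur G) (fun z => z.2 - (z.1 - a1) / c) (fun z => z.2 + (z.1 - a1) / c) x y =
  upper_potential (a1 + c * y) - pot (a1 - c * x) (a1 + c * y).
Proof.
rewrite /upper_potential /wave_potential /quadrant -(RintegralB mD (iup _) (ipot _ _)).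
apply: eq_Rintegral => z _.
have -> : z.2 - (z.1 - a1) / c - x = - (slant (- c) z - (a1 - c * x)) / c.
  by rewrite /slant; field.
have -> : y - (z.2 + (z.1 - a1) / c) = (a1 + c * y - slant c z) / c.
  by rewrite /slant; field.
by rewrite !heaviside_div// heavisideN; ring.
Qed.

Lemma quadrant_right_wall (x y : R) :
  quadrant mu2 D (uncur G) (fun z => z.2 - (a2 - z.1) / c) (fun z => z.2 + (a2 - z.1) / c) x y =
  lower_potential (a2 - c * y) - pot (a2 - c * y) (a2 + c * x).
Proof.
rewrite /lower_potential /wave_potential /quadrant -(RintegralB mD (ilo _) (ipot _ _)).
apply: eq_Rintegral => z _.
have -> : z.2 - (a2 - z.1) / c - x = - (a2 + c * x - slant c z) / c.
  by rewrite /slant; field.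
have -> : y - (z.2 + (a2 - z.1) / c) = (slant (- c) z - (a2 - c * y)) / c.
  by rewrite /slant; field.
by rewrite !heaviside_div// heavisideN; ring.
Qed.

Lemma quadrant_bottom (x y : R) :
  quadrant mu2 D (uncur G) (fun z => z.1 - c * z.2) (fun z => z.1 + c * z.2) x y = pot x y.
Proof. by apply: eq_Rintegral => z _; rewrite /slant mulNr. Qed.

Lemma wave_potential_cone (x t : R) : t <= T ->
  \int[mu2]_(q in `[a1, a2] `*` `[0, t])
    (G q.1 q.2 * heaviside (c * (t - q.2) - `|x - q.1|)) =
  pot (x - c * t) (x + c * t).
Proof.
move=> tT.
have hmin z : c * (t - z.2) - `|x - z.1| =
    Num.min (slant (- c) z - (x - c * t)) (x + c * t - slant c z).
  rewrite /slant; case: (lerP (x - z.1) 0) => xz.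
    by rewrite ler0_norm// min_r; lra.
  by rewrite gtr0_norm// min_l; lra.
transitivity (\int[mu2]_(z in D) (uncur G z * heaviside (c * (t - z.2) - `|x - z.1|))).
  rewrite Rintegral_mkcond [RHS]Rintegral_mkcond; apply: eq_Rintegral => z _.
  rewrite !patchE; case: ifPn => h1; case: ifPn => h2 //.
    move: h1 h2; rewrite inE notin_setE /= !in_itv /= => -[/andP[? ?] /andP[? ?]] [].
    by split; apply/andP; split => //; lra.
  move: h1 h2; rewrite inE notin_setE /= !in_itv /= => h1 [/andP[? ?] /andP[? ?]].
  rewrite heaviside_lt0 ?mulr0//.
  have zt : t < z.2.
    rewrite ltNge; apply/negP => ?; apply: h1; split; apply/andP; split => //.
  have := normr_ge0 (x - z.1); have : c * (t - z.2) < 0 by rewrite pmulr_rlt0// subr_lt0.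
  lra.
have mdist : measurable_fun D (fun z : R * R => uncur G z * heaviside (c * (t - z.2) - `|x - z.1|)).
  apply: measurable_funM => //.
  apply: (measurableT_comp (@measurable_heaviside R setT)).
  apply: measurable_funTS; apply: measurable_funB.
    by apply: measurable_funM => //; exact: measurable_funB.
  by apply: measurableT_comp => //; exact: measurable_funB.
apply: (Deq cP mdist (mpot _ _) (r := x + c * t)) => z Dz zy.
by rewrite hmin heaviside_min// subr_eq0 eq_sym.
Qed.

End potentials.

(** * Traces on the walls and on the initial line *)

Lemma near_half_strip (R : realType) (a1 a2 : R) (q : R * R) :
  half_strip a1 a2 q -> \forall q' \near q, half_strip a1 a2 q'.
Proof.
case: q => x t [/= xa t0].
have tt : 0 < t < t + 1 by rewrite t0 ltrDl ltr01.
by apply: filterS (nbhs_strip xa tt) => q [].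
Qed.

(* The curves p |-> (b p + X s, b' p + Y s) enter the half-strip at p = 0. *)
Lemma trace_data (R : realType) (a1 a2 b b' s0 r0 l0 : R) (u : R -> R -> R)
    (X Y tr : R -> R) (E : set R) :
  let F x t := b * dx u x t + b' * dt u x t in
  0 < r0 -> continuous X -> continuous Y ->
  (forall p s, 0 < p < r0 -> `|s - s0| < r0 ->
    half_strip a1 a2 (b * p + X s, b' * p + Y s)) ->
  (\forall q \near (X s0, Y s0), half_strip a1 a2 q -> C2_at u q) ->
  trace_is a1 a2 F (X s0, Y s0) l0 ->
  (forall s, `|s - s0| < r0 -> ~ E s -> trace_is a1 a2 F (X s, Y s) (tr s)) ->
  exists r M, [/\ 0 < r,
    forall p s, 0 < p < r -> `|s - s0| < r ->
      derivable (fun p => extend a1 a2 u (b * p + X s) (b' * p + Y s)) p 1 /\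
      `|derive1 (fun p => extend a1 a2 u (b * p + X s) (b' * p + Y s)) p| <= M &
    forall s, `|s - s0| < r -> ~ E s ->
      derive1 (fun p => extend a1 a2 u (b * p + X s) (b' * p + Y s)) p
        @[p --> 0^'+] --> tr s].
Proof.
move=> F r00 Xc Yc hs C2n tr0 trs.
(* The trace at the single point s0 bounds the derivative on a whole neighbourhood within the
   half-strip; every later bound for difference quotients comes from it. *)
have near0 : \forall q \near (X s0, Y s0),
    half_strip a1 a2 q -> (\forall q' \near q, C2_at u q') /\ `|F q.1 q.2| <= `|l0| + 1.
  have /cvgrPdist_le/(_ 1 ltr01) hb := tr0.
  have C2i := nbhs_interior C2n.
  apply: (@filterS2 _ (nbhs (X s0, Y s0)) _ _ _ _ _ C2i hb) => q C2q bq hq; split.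
    have hq' := near_half_strip hq.
    by apply: (@filterS2 _ (nbhs q) _ _ _ _ _ C2q hq') => q' C2 ?; exact: C2.
  rewrite -[F _ _](subKr l0); apply: le_trans (ler_normB _ _) _.
  by rewrite lerD2l; exact: bq.
have curve s : (b * q.1 + X q.2, b' * q.1 + Y q.2) @[q --> (0 : R, s)] --> (X s, Y s).
  apply: (@continuous2_cvg _ _ _ _ _ _ (fun q : R * R => b * q.1 + X q.2)
    (fun q : R * R => b' * q.1 + Y q.2) pair).
  - by rewrite (_ : (fun z => _) = id); [exact: cvg_id|apply/funext => -[]].
  - rewrite -[X in _ --> X]add0r -[0 in X in _ --> X](mulr0 b); apply: cvgD.
      by apply: cvgM; [exact: cvg_cst|exact: cvg_fst].
    by apply: (cvg_comp _ _ (@cvg_snd _ _ (nbhs (0 : R)) (nbhs s) _)); exact: Xc.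
  - rewrite -[X in _ --> X]add0r -[0 in X in _ --> X](mulr0 b'); apply: cvgD.
      by apply: cvgM; [exact: cvg_cst|exact: cvg_fst].
    by apply: (cvg_comp _ _ (@cvg_snd _ _ (nbhs (0 : R)) (nbhs s) _)); exact: Yc.
have /nbhs_pairP[r1 r10 box] := curve s0 _ near0.
have dF p s : 0 < p < Num.min r0 r1 -> `|s - s0| < Num.min r0 r1 ->
    is_derive p 1 (fun p => extend a1 a2 u (b * p + X s) (b' * p + Y s))
      (F (b * p + X s) (b' * p + Y s)) /\ `|F (b * p + X s) (b' * p + Y s)| <= `|l0| + 1.
  rewrite !lt_min => /andP[p0 /andP[pr0 pr1]] /andP[sr0 sr1].
  have hps : half_strip a1 a2 (b * p + X s, b' * p + Y s) by apply: hs => //; rewrite p0.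
  have [|C2ps bF] := box p s _ sr1 hps; first by rewrite subr0 gtr0_norm.
  split => //; apply: (@near_eq_is_derive _ _ _ (fun p => u (b * p + X s) (b' * p + Y s))).
    have pin : p \in `]0, r0[ by rewrite in_itv /= p0.
    apply: filterS (near_in_itvoo pin) => p' p'r.
    have [/= /andP[? ?] ?] : half_strip a1 a2 (b * p' + X s, b' * p' + Y s).
      by apply: hs => //; move: p'r; rewrite in_itv.
    by rewrite extendE// ?ltW// !ltW.
  by apply: is_derive_along; apply: filterS C2ps => q [].
exists (Num.min r0 r1), (`|l0| + 1); split.
- by rewrite lt_min r00.
- move=> p s pr sr; have [dp bp] := dF p s pr sr; split; first exact: ex_derive.
  by rewrite derive1E derive_val.
- move=> s sr nEs; have sr0 : `|s - s0| < r0 by move: sr; rewrite lt_min => /andP[].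
  have ts := trs s sr0 nEs.
  have lim : F (b * p + X s) (b' * p + Y s) @[p --> 0^'+] --> tr s.
    have cw : (b * p + X s, b' * p + Y s) @[p --> (0:R)^'+] -->
        within (half_strip a1 a2) (nbhs (X s, Y s)).
      move=> A /= nA; have /nbhs_pairP[r2 r20 h2] := curve s _ nA.
      change (\forall p \near (0 : R)^'+, A (b * p + X s, b' * p + Y s)).
      near=> p; have p0 : 0 < p by near: p; exact: nbhs_right_gt.
      have pr2 : p < r2 by near: p; exact: nbhs_right_lt.
      have pr0 : p < r0 by near: p; exact: nbhs_right_lt.
      apply: (h2 p s); [by rewrite subr0 gtr0_norm|by rewrite subrr normr0|].
      by apply: hs => //; rewrite p0.
    exact: (cvg_comp _ _ cw ts).
  apply: cvg_trans lim; apply: near_eq_cvg; near=> p.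
  have pr : 0 < p < Num.min r0 r1.
    apply/andP; split; first by near: p; exact: nbhs_right_gt.
    by near: p; apply: nbhs_right_lt; rewrite lt_min r00.
  by have [dp _] := dF p s pr sr; rewrite derive1E derive_val.
Unshelve. all: by end_near. Qed.

(* The canonical sigma-finite structure of the library on product measures is
   restricted to subprobabilities. *)
Lemma sigma_finite_plane (R : realType) :
  sigma_finite setT (@lebesgue_measure R \x @lebesgue_measure R)%E.
Proof.
have /sigma_finiteP[F [TF ndF Foo]] := sigma_finiteT (@lebesgue_measure R).
exists (fun n => F n `*` F n).
  rewrite -setXTT TF predeqE => -[x y]; split.
    move=> [/= [n _ Fnx] [k _ Gky]]; exists (maxn n k) => //; split.
    - by move: x Fnx; exact/subsetPset/ndF/leq_maxl.
    - by move: y Gky; exact/subsetPset/ndF/leq_maxr.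
  by move=> [n _ []/= ? ?]; split; exists n.
move=> k; have [? ?] := Foo k; split; first exact: measurableX.
by rewrite product_measure1E// lte_mul_pinfty// ge0_fin_numE.
Qed.

Definition plane_measure (R : realType) : {sigma_finite_measure set _ -> \bar R} :=
  HB.pack (@lebesgue_measure R \x @lebesgue_measure R)%E
    (Measure_isSigmaFinite.Build _ _ _ (@lebesgue_measure R \x @lebesgue_measure R)%E
      (sigma_finite_plane R)).

Lemma fst_level_null (R : realType) (a : R) :
  (@lebesgue_measure R \x @lebesgue_measure R)%E (fst @^-1` [set a]) = 0%E.
Proof.
rewrite product_measure12; last first.
  by rewrite -[X in measurable X]setTI; exact: measurable_fst.
apply: integral0_eq => y _.
rewrite (_ : ysection _ _ = [set a]) ?lebesgue_measure_set1//.
by apply/seteqP; split=> t; rewrite /ysection /= inE.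
Qed.

Lemma snd_level_null (R : realType) (a : R) :
  (@lebesgue_measure R \x @lebesgue_measure R)%E (snd @^-1` [set a]) = 0%E.
Proof.
rewrite /product_measure1 /=; apply: integral0_eq => y _.
rewrite (_ : xsection _ _ = [set a]) ?lebesgue_measure_set1//.
by apply/seteqP; split=> t; rewrite /xsection /= inE.
Qed.

Lemma continuous_affine_fst (R : realType) (a b : R) :
  continuous (fun q : R * R => a * q.1 + b).
Proof.
move=> q; apply: cvgD; last exact: cvg_cst.
by apply: cvgM; [exact: cvg_cst|exact: cvg_fst].
Qed.

Lemma countable_characteristic_times (R : realType) (S : set R) (a c : R) : countable S ->
  countable [set (a - v) / c | v in S] /\ countable [set (v - a) / c | v in S].
Proof. by move=> cS; split; apply: sub_countable cS; exact: card_image_le. Qed.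

Section boundary.
Context (R : realType) (c a1 a2 T : R) (G u : R -> R -> R) (Phi : set (front R)).
Hypotheses (c0 : 0 < c) (a12 : a1 < a2)
  (iG : (@lebesgue_measure R \x @lebesgue_measure R)%E.-integrable
    (`[a1, a2] `*` `[0, T]) (EFin \o uncur G))
  (cs : classical_solution c a1 a2 G u Phi).
Let S : set R := [set F.2 | F in Phi].
Local Notation U := (extend a1 a2 u).
Local Notation pot := (wave_potential c a1 a2 T G).
Local Notation D := (`[a1, a2] `*` `[0, T] : set (R * R)).

Let Uc : continuous (uncur U).
Proof. exact: continuous_extend (ltW a12) (cs_continuous cs). Qed.

Let cS : countable S.
Proof. by apply: countable_front_values; exact: cs_fronts cs. Qed.

Let mD : measurable (D : set (measurableTypeR R * measurableTypeR R)).
Proof. by apply: measurableX; exact: measurable_itv. Qed.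

Let wall_not_on_fronts (a s : R) : ~ S (a - c * s) -> ~ S (a + c * s) ->
  ~ on_fronts c Phi (a, s).
Proof. by move=> h1 h2 /fronts_characteristic; rewrite /slant /= mulNr => -[]. Qed.

(* e is the inward normal at the wall a. *)
Lemma wall_triangle (e a : R) (p : R -> R) (t0 : R) :
  let quad := quadrant (@lebesgue_measure R \x @lebesgue_measure R)%E D (uncur G)
    (fun z => z.2 - e * (z.1 - a) / c) (fun z => z.2 + e * (z.1 - a) / c) in
  let J x y := U (e * c * ((y - x) / 2) + a) ((x + y) / 2) - c / 2 * quad x y in
  e = 1 /\ a = a1 \/ e = -1 /\ a = a2 ->
  boundary_dx c a1 a2 u Phi a p -> 0 < t0 < T ->
  ~ S (a - c * t0) -> ~ S (a + c * t0) ->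
  (forall x1 x2 y1 y2, 0 <= x1 -> x1 <= x2 -> x2 <= y1 -> y1 <= y2 -> y2 <= T ->
    c * ((y2 - x1) / 2) <= a2 - a1 -> ddiff J x1 x2 y1 y2 = 0) ->
  exists2 r, 0 < r & forall q1 q2, t0 - r < q1 -> q1 <= q2 -> q2 < t0 + r ->
    2 * J q1 q2 = U a q1 + U a q2 + e * c * \int[lebesgue_measure]_(s in `[q1, q2]) p s.
Proof.
move=> quad J ea bd /andP[t00 t0T] nS1 nS2 Jex; have T0 : 0 < T by exact: lt_trans t0T.
(* Below half the transit time (a2 - a1) / c, lines leaving the wall do not reach the opposite one;
   the other bounds keep the times within [0, T]. *)
have [r0 r00 [r0t r0T r0a]] : exists2 r0 : R, 0 < r0 & [/\ r0 <= t0, r0 <= T - t0 & c * r0 < a2 - a1].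
  have h : 0 < (a2 - a1) / c / 2 by rewrite !divr_gt0// subr_gt0.
  exists (Num.min t0 (Num.min (T - t0) ((a2 - a1) / c / 2))).
    by rewrite !lt_min t00 subr_gt0 t0T.
  rewrite !ge_min !lexx ?orbT; split => //.
  apply: (@le_lt_trans _ _ (c * ((a2 - a1) / c / 2))).
    by rewrite ler_pM2l// !ge_min lexx !orbT.
  have -> : c * ((a2 - a1) / c / 2) = (a2 - a1) / 2 by field; rewrite gt_eqF.
  by move: a12; lra.
(* All times at which a characteristic in [S] can meet the wall. *)
pose E := [set (a - v) / c | v in S] `|` [set (v - a) / c | v in S].
have cE : countable E.
  by have [? ?] := countable_characteristic_times a c cS; exact: countable_setU.
have nE s : ~ E s -> ~ on_fronts c Phi (a, s).
  move=> nEs; apply: wall_not_on_fronts => Sv; apply: nEs; [left|right].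
    by exists (a - c * s) => //; field; rewrite gt_eqF.
  by exists (a + c * s) => //; field; rewrite gt_eqF.
have trE s (l : R) : trace_is a1 a2 (dx u) (a, s) l ->
    trace_is a1 a2 (fun x t => e * c * dx u x t + 0 * dt u x t) (a, s) (e * c * l).
  move=> h; rewrite /trace_is.
  rewrite (_ : (fun q : R * R => _) = (fun q : R * R => e * c * dx u q.1 q.2)); last first.
    by apply/funext => q; rewrite mul0r addr0.
  by apply: cvgM; [exact: cvg_cst|exact: h].
have nf0 := wall_not_on_fronts nS1 nS2.
have clos : closed_half_strip a1 a2 (a, t0).
  by split; [case: ea => -[_ ->]; rewrite /= lexx ltW|exact: ltW].
have enters q s : 0 < q < r0 -> `|s - t0| < r0 -> half_strip a1 a2 (e * c * q + a, 0 * q + s).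
  move=> /andP[q0 qr] sr; have cq0 : 0 < c * q by exact: mulr_gt0.
  have cqr : c * q < c * r0 by rewrite ltr_pM2l.
  move: sr; rewrite ltr_norml => /andP[sr _]; rewrite /half_strip /= mul0r add0r -mulrA.
  split; last by lra.
  by case: ea => -[-> ->]; rewrite ?mul1r ?mulN1r; apply/andP; split; lra.
have traces s : `|s - t0| < r0 -> ~ E s ->
    trace_is a1 a2 (fun x t => e * c * dx u x t + 0 * dt u x t) (a, s) (e * c * p s).
  rewrite ltr_norml => /andP[sr _] nEs; apply: trE; apply: (bd_trace bd) (nE _ nEs).
  by lra.
have ca : continuous (cst a : R -> R) by move=> ?; exact: cvg_cst.
have ci : continuous (id : R -> R) by move=> ?; exact: cvg_id.
have [r1 [M [r10 der lim]]] := @trace_data R a1 a2 (e * c) 0 t0 r0 (e * c * p t0) u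
  (cst a) id (fun s => e * c * p s) E r00 ca ci
  enters (cs_regular cs clos nf0) (trE _ _ (bd_trace bd t00 nf0)) traces.
(* Depth is measured in travel time, so that characteristics become the lines of slope one or minus
   one expected by [boundary_triangle]. *)
pose w q s := U (e * c * q + a) (0 * q + s).
have wc : continuous (uncur w).
  apply: (@continuous_uncur_comp _ _ U (fun q : R * R => e * c * q.1 + a) (fun q : R * R => 0 * q.1 + q.2)) => //.
    exact: continuous_affine_fst.
  move=> q; apply: cvgD; last exact: cvg_snd.
  by apply: cvgM; [exact: cvg_cst|exact: cvg_fst].
pose r := Num.min r0 r1; have rr0 : 0 < r by rewrite lt_min r00.
have [rr0' rr1] : r <= r0 /\ r <= r1 by rewrite /r !ge_min !lexx orbT.
have lo0 : 0 <= t0 - r by rewrite subr_ge0 (le_trans rr0').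
have hiT : t0 + r <= T by rewrite -lerBrDl (le_trans rr0').
have near_t0 s : t0 - r < s < t0 + r -> `|s - t0| < r1.
  by move=> sr; rewrite (lt_le_trans _ rr1)// ltr_distl.
have width : (t0 + r - (t0 - r)) / 2 <= r0.
  by have -> : (t0 + r - (t0 - r)) / 2 = r by field.
have e0 : e != 0 by case: ea => -[-> _]; rewrite ?oppr_eq0 oner_eq0.
have ecE : e * c != 0 by rewrite mulf_neq0// gt_eqF.
have c2 : c / 2 != 0 by rewrite mulf_neq0// ?invr_eq0 gt_eqF.
have ee : e * e = 1 by case: ea => -[-> _]; ring.
pose P (z : R * R) := e * (z.1 - a) / c.
have mP : measurable_fun setT P.
  by apply: measurable_funM => //; apply: measurable_funM => //; exact: measurable_funB.
have P0 z : D z -> 0 <= P z.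
  case=> /=; rewrite in_itv /= => /andP[z1 z2] _; apply: divr_ge0; last exact: ltW.
  by case: ea => -[-> ->]; rewrite ?mul1r ?mulN1r ?opprB subr_ge0.
have Pn : (@lebesgue_measure R \x @lebesgue_measure R)%E (P @^-1` [set 0]) = 0%E.
  rewrite (_ : _ @^-1` _ = fst @^-1` [set a]) ?fst_level_null//.
  apply/seteqP; split => z /=; rewrite /P.
    move/eqP; rewrite !mulf_eq0 invr_eq0 (gt_eqF c0) (negbTE e0) orbF /= subr_eq0 => /eqP //.
  by move=> ->; rewrite subrr mulr0 mul0r.
have PE z : e * c * P z = z.1 - a.
  by rewrite -[RHS]mul1r -ee /P; field; rewrite gt_eqF.
have Xn s : (@lebesgue_measure R \x @lebesgue_measure R)%E ((fun z => z.2 - P z) @^-1` [set s]) = 0%E.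
  rewrite (_ : _ @^-1` _ = slant (- (e * c)) @^-1` [set a - e * c * s]).
    by apply: slant_level_null; rewrite oppr_eq0.
  apply/seteqP; split => z /=; have Pz := PE z; rewrite /slant.
    by move=> <-; rewrite mulrBr Pz; ring.
  by move=> zs; apply: (mulfI ecE); rewrite mulrBr Pz; lra.
have Yn s : (@lebesgue_measure R \x @lebesgue_measure R)%E ((fun z => z.2 + P z) @^-1` [set s]) = 0%E.
  rewrite (_ : _ @^-1` _ = slant (e * c) @^-1` [set a + e * c * s]).
    exact: slant_level_null.
  apply/seteqP; split => z /=; have Pz := PE z; rewrite /slant.
    by move=> <-; rewrite mulrDr Pz; ring.
  by move=> zs; apply: (mulfI ecE); rewrite mulrDr Pz; lra.
have bt := @boundary_triangle _ _ R (plane_measure R) D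
  (uncur G) P snd w (c / 2) (fun s => e * c * p s) E (t0 - r) (t0 + r) r M.
exists r => // q1 q2 q1r q12 q2r.
have wE q s : w q s = U (e * c * q + a) s by rewrite /w mul0r add0r.
have JE x y : w ((y - x) / 2) ((x + y) / 2) - c / 2 * quad x y = J x y by rewrite wE.
have ip : lebesgue_measure.-integrable `[0, T] (EFin \o p).
  by apply: piecewise_continuous_integrable; exact: (bd_pc bd T0).
have ip' : lebesgue_measure.-integrable `[q1, q2] (EFin \o p).
  by apply: integrableS ip => //; apply: subset_itv; rewrite bnd_simp;
    [exact: le_trans lo0 (ltW q1r)|exact: le_trans (ltW q2r) hiT].
have H : 2 * (w ((q2 - q1) / 2) ((q1 + q2) / 2) - c / 2 * quad q1 q2) = w 0 q1 + w 0 q2 +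
    \int[lebesgue_measure]_(s in `[q1, q2]) (e * c * p s).
  apply: (bt q1 q2 mD iG mP measurable_snd P0 Pn Xn Yn wc c2 _ cE rr0 _ _ _ q1r q12 q2r).
  - move=> x1 x2 y1 y2 x1r x12 x2y1 y12 y2r.
    have -> : (fun x y => w ((y - x) / 2) ((x + y) / 2) - c / 2 * quad x y) = J.
      by apply/funext => x; apply/funext => y; rewrite JE.
    apply: Jex => //; [exact: le_trans lo0 (ltW x1r)|exact: le_trans (ltW y2r) hiT|].
    apply: le_trans (ltW r0a); rewrite ler_pM2l// (le_trans _ width)// ler_pM2r//.
    by rewrite lerB// ltW.
  - move=> q s /andP[q0 qr] sr; apply: der; first by rewrite q0 (lt_le_trans qr).
    exact: near_t0.
  - by move=> s sr nEs; apply: lim => //; exact: near_t0.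
  - apply: measurable_funM => //.
    by move/integrableP : ip' => [/measurable_EFinP].
move: H; rewrite JE !wE mulr0 add0r => ->; congr (_ + _).
by rewrite RintegralZl.
Qed.
End boundary.

Section boundary.
Context (R : realType) (c a1 a2 T : R) (G u : R -> R -> R) (Phi : set (front R)).
Hypotheses (c0 : 0 < c) (a12 : a1 < a2)
  (iG : (@lebesgue_measure R \x @lebesgue_measure R)%E.-integrable
    (`[a1, a2] `*` `[0, T]) (EFin \o uncur G))
  (cs : classical_solution c a1 a2 G u Phi).
Let S : set R := [set F.2 | F in Phi].
Local Notation U := (extend a1 a2 u).
Local Notation pot := (wave_potential c a1 a2 T G).
Local Notation W := (wave_combination c a1 a2 T G u).
Local Notation D := (`[a1, a2] `*` `[0, T] : set (R * R)).

Let cE : c != 0. Proof. by rewrite gt_eqF. Qed.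

Let times (x y q1 q2 : R) : U ((x + y) / 2) ((y - x) / (2 * c)) = U q1 q2 ->
  W x y = 2 * U q1 q2 + c * pot x y.
Proof. by rewrite /wave_combination => ->. Qed.

Lemma left_wall (p : R -> R) (t0 : R) :
  boundary_dx c a1 a2 u Phi a1 p -> 0 < t0 < T ->
  ~ S (a1 - c * t0) -> ~ S (a1 + c * t0) ->
  exists2 r, 0 < r & forall q1 q2, t0 - r < q1 -> q1 <= q2 -> q2 < t0 + r ->
    W (a1 - c * q1) (a1 + c * q2) =
      c * upper_potential c a1 a2 T G (a1 + c * q2) + U a1 q1 + U a1 q2 +
      c * \int[lebesgue_measure]_(s in `[q1, q2]) p s.
Proof.
move=> bd t0T nS1 nS2.
pose quad := quadrant (@lebesgue_measure R \x @lebesgue_measure R)%E D (uncur G)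
  (fun z => z.2 - 1 * (z.1 - a1) / c) (fun z => z.2 + 1 * (z.1 - a1) / c).
pose J x y := U (1 * c * ((y - x) / 2) + a1) ((x + y) / 2) - c / 2 * quad x y.
(* The upper potential depends on y alone and drops out of second-order differences, so [J] inherits
   exactness from the wave combination. *)
have JE x y : J x y = W (a1 - c * x) (a1 + c * y) / 2 -
    c / 2 * upper_potential c a1 a2 T G (a1 + c * y).
  rewrite /J; have -> : quad x y = upper_potential c a1 a2 T G (a1 + c * y) - pot (a1 - c * x) (a1 + c * y).
    rewrite -quadrant_left_wall// /quad.
    by apply: eq_Rintegral => z _; rewrite mul1r.
  rewrite (@times _ _ (1 * c * ((y - x) / 2) + a1) ((x + y) / 2)).
    by field.
  by congr (U _ _); field.
have [||r r0 h] :=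
    @wall_triangle R c a1 a2 T G u Phi c0 a12 iG cs 1 a1 p t0 _ bd t0T nS1 nS2.
- by left.
- move=> x1 x2 y1 y2 x10 x12 xy y12 y2T yx; rewrite -/quad -/J.
  (* The coordinate a1 - c s decreases in s, so x1 and x2 change places. *)
  have : ddiff W (a1 - c * x2) (a1 - c * x1) (a1 + c * y1) (a1 + c * y2) = 0.
    apply: (wave_exact c0 a12 iG cs).
    - by rewrite lerD2l lerN2 ler_pM2l.
    - by rewrite lerD2l -mulrN ler_pM2l//; lra.
    - by rewrite lerD2l ler_pM2l.
    - have -> : (a1 - c * x2 + (a1 + c * y1)) / 2 = a1 + c * (y1 - x2) / 2 by field.
      by rewrite lerDl divr_ge0// mulr_ge0 ?subr_ge0// ltW.
    - have -> : (a1 - c * x1 + (a1 + c * y2)) / 2 = a1 + c * ((y2 - x1) / 2) by field.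
      by rewrite -lerBrDl.
    - have -> : (a1 + c * y2 - (a1 - c * x2)) / (2 * c) = (y2 + x2) / 2 by field.
      lra.
  by rewrite /ddiff !JE; lra.
- exists r => // q1 q2 q1r q12 q2r.
  have : 2 * J q1 q2 = U a1 q1 + U a1 q2 +
      1 * c * \int[lebesgue_measure]_(s in `[q1, q2]) p s by exact: h.
  rewrite JE; lra.
Qed.

Lemma right_wall (p : R -> R) (t0 : R) :
  boundary_dx c a1 a2 u Phi a2 p -> 0 < t0 < T ->
  ~ S (a2 - c * t0) -> ~ S (a2 + c * t0) ->
  exists2 r, 0 < r & forall q1 q2, t0 - r < q1 -> q1 <= q2 -> q2 < t0 + r ->
    W (a2 - c * q2) (a2 + c * q1) =
      c * lower_potential c a1 a2 T G (a2 - c * q2) + U a2 q1 + U a2 q2 -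
      c * \int[lebesgue_measure]_(s in `[q1, q2]) p s.
Proof.
move=> bd t0T nS1 nS2.
pose quad := quadrant (@lebesgue_measure R \x @lebesgue_measure R)%E D (uncur G)
  (fun z => z.2 - -1 * (z.1 - a2) / c) (fun z => z.2 + -1 * (z.1 - a2) / c).
pose J x y := U (-1 * c * ((y - x) / 2) + a2) ((x + y) / 2) - c / 2 * quad x y.
have JE x y : J x y = W (a2 - c * y) (a2 + c * x) / 2 -
    c / 2 * lower_potential c a1 a2 T G (a2 - c * y).
  rewrite /J; have -> : quad x y = lower_potential c a1 a2 T G (a2 - c * y) - pot (a2 - c * y) (a2 + c * x).
    rewrite -quadrant_right_wall// /quad.
    by apply: eq_Rintegral => z _; rewrite mulN1r opprB.
  rewrite (@times _ _ (-1 * c * ((y - x) / 2) + a2) ((x + y) / 2)).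
    by field.
  by congr (U _ _); field.
have [||r r0 h] :=
    @wall_triangle R c a1 a2 T G u Phi c0 a12 iG cs (-1) a2 p t0 _ bd t0T nS1 nS2.
- by right.
- move=> x1 x2 y1 y2 x10 x12 xy y12 y2T yx; rewrite -/quad -/J.
  have : ddiff W (a2 - c * y2) (a2 - c * y1) (a2 + c * x1) (a2 + c * x2) = 0.
    apply: (wave_exact c0 a12 iG cs).
    - by rewrite lerD2l lerN2 ler_pM2l.
    - by rewrite lerD2l -mulrN ler_pM2l//; lra.
    - by rewrite lerD2l ler_pM2l.
    - have -> : (a2 - c * y2 + (a2 + c * x1)) / 2 = a2 - c * ((y2 - x1) / 2) by field.
      by move: yx; lra.
    - have -> : (a2 - c * y1 + (a2 + c * x2)) / 2 = a2 - c * (y1 - x2) / 2 by field.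
      by rewrite gerDl oppr_le0 divr_ge0// mulr_ge0 ?subr_ge0// ltW.
    - have -> : (a2 + c * x2 - (a2 - c * y2)) / (2 * c) = (y2 + x2) / 2 by field.
      lra.
  by rewrite /ddiff !JE; lra.
- exists r => // q1 q2 q1r q12 q2r.
  have : 2 * J q1 q2 = U a2 q1 + U a2 q2 +
      -1 * c * \int[lebesgue_measure]_(s in `[q1, q2]) p s by exact: h.
  rewrite JE; lra.
Qed.

(** Relative to the walls space and time change roles, which reverses the sign of the wave operator;
    the coefficient of the potential is therefore -(c / 2) here and c / 2 there. *)
Lemma initial_line (u0 v0 : R -> R) (x0 : R) :
  initial_data c a1 a2 u Phi u0 v0 -> 0 < T -> a1 < x0 < a2 -> ~ S x0 ->
  exists2 r, 0 < r & forall x y, x0 - r < x -> x <= y -> y < x0 + r ->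
    W x y = U x 0 + U y 0 + c^-1 * \int[lebesgue_measure]_(s in `[x, y]) v0 s.
Proof.
move=> ini T0 /andP[xa1 xa2] nS.
have ci : 0 < c^-1 by rewrite invr_gt0.
have [r0 r00 [r0l r0r]] : exists2 r0 : R, 0 < r0 & r0 <= x0 - a1 /\ r0 <= a2 - x0.
  exists (Num.min (x0 - a1) (a2 - x0)); first by rewrite lt_min !subr_gt0 xa1 xa2.
  by rewrite !ge_min !lexx orbT.
have cS : countable S by apply: countable_front_values; exact: cs_fronts cs.
have nf s : ~ S s -> ~ on_fronts c Phi (s, 0).
  by move=> nSs /fronts_characteristic; rewrite /slant /= !mulr0 addr0 => -[].
have trE s (l : R) : trace_is a1 a2 (dt u) (s, 0) l ->
    trace_is a1 a2 (fun x t => 0 * dx u x t + c^-1 * dt u x t) (s, 0) (c^-1 * l).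
  move=> h; rewrite /trace_is.
  rewrite (_ : (fun q : R * R => _) = (fun q : R * R => c^-1 * dt u q.1 q.2)); last first.
    by apply/funext => q; rewrite mul0r add0r.
  by apply: cvgM; [exact: cvg_cst|exact: h].
have clos : closed_half_strip a1 a2 (x0, 0) by split; rewrite //= !ltW.
have inside s : `|s - x0| < r0 -> a1 < s < a2.
  by rewrite ltr_norml => /andP[? ?]; apply/andP; split; lra.
have enters q s : 0 < q < r0 -> `|s - x0| < r0 -> half_strip a1 a2 (0 * q + s, c^-1 * q + 0).
  move=> /andP[q0 qr] /inside sr; rewrite /half_strip /= mul0r add0r addr0; split => //.
  exact: mulr_gt0.
have traces s : `|s - x0| < r0 -> ~ S s ->
    trace_is a1 a2 (fun x t => 0 * dx u x t + c^-1 * dt u x t) (s, 0) (c^-1 * v0 s).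
  by move=> /inside sr nSs; apply: trE; exact: id_velocity ini _ sr (nf _ nSs).
have ca : continuous (cst 0 : R -> R) by move=> ?; exact: cvg_cst.
have cid : continuous (id : R -> R) by move=> ?; exact: cvg_id.
have x0in : a1 < x0 < a2 by rewrite xa1.
have [r1 [M [r10 der lim]]] := @trace_data R a1 a2 0 c^-1 x0 r0 (c^-1 * v0 x0) u
  id (cst 0) (fun s => c^-1 * v0 s) S r00 cid ca
  enters (cs_regular cs clos (nf _ nS)) (trE _ _ (id_velocity ini x0in (nf _ nS))) traces.
pose w q s := U (0 * q + s) (c^-1 * q + 0).
have Uc : continuous (uncur U) by exact: continuous_extend (ltW a12) (cs_continuous cs).
have wc : continuous (uncur w).
  apply: (@continuous_uncur_comp _ _ U (fun q : R * R => 0 * q.1 + q.2) (fun q : R * R => c^-1 * q.1 + 0)) => //.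
    move=> q; apply: cvgD; last exact: cvg_snd.
    by apply: cvgM; [exact: cvg_cst|exact: cvg_fst].
  exact: continuous_affine_fst.
have [r rr0 [rr0' rr1 rT]] : exists2 r : R, 0 < r & [/\ r <= r0, r <= r1 & r <= c * T].
  exists (Num.min r0 (Num.min r1 (c * T))).
    by rewrite !lt_min r00 r10 mulr_gt0.
  by rewrite !ge_min !lexx ?orbT.
have lo1 : a1 <= x0 - r by rewrite lerBrDr -lerBrDl (le_trans rr0').
have hi2 : x0 + r <= a2 by rewrite -lerBrDl (le_trans rr0').
have near_x0 s : x0 - r < s < x0 + r -> `|s - x0| < r1.
  by move=> sr; rewrite (lt_le_trans _ rr1)// ltr_distl.
have width : x0 + r - (x0 - r) <= T * (2 * c).
  have -> : x0 + r - (x0 - r) = r + r by ring.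
  by have -> : T * (2 * c) = c * T + c * T; [ring|rewrite lerD].
have c2 : - (c / 2) != 0 by rewrite oppr_eq0 mulf_neq0// invr_eq0.
pose P (z : R * R) := c * z.2.
have mP : measurable_fun setT P by apply: measurable_funM.
have P0 z : D z -> 0 <= P z.
  by case=> _ /=; rewrite in_itv /= => /andP[z0 _]; rewrite mulr_ge0// ltW.
have Pn : (@lebesgue_measure R \x @lebesgue_measure R)%E (P @^-1` [set 0]) = 0%E.
  rewrite (_ : _ @^-1` _ = snd @^-1` [set 0]) ?snd_level_null//.
  apply/seteqP; split => z /=; rewrite /P.
    by move/eqP; rewrite mulf_eq0 (negbTE cE) => /eqP.
  by move=> ->; rewrite mulr0.
have Xn s : (@lebesgue_measure R \x @lebesgue_measure R)%E ((fun z => z.1 - P z) @^-1` [set s]) = 0%E.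
  rewrite (_ : _ @^-1` _ = slant (- c) @^-1` [set s]).
    by apply: slant_level_null; rewrite oppr_eq0.
  by apply/seteqP; split => z /=; rewrite /P /slant mulNr.
have Yn s : (@lebesgue_measure R \x @lebesgue_measure R)%E ((fun z => z.1 + P z) @^-1` [set s]) = 0%E.
  exact: (@slant_level_null R c s cE).
pose quad := quadrant (@lebesgue_measure R \x @lebesgue_measure R)%E D (uncur G)
  (fun z => z.1 - P z) (fun z => z.1 + P z).
have JE x y : w ((y - x) / 2) ((x + y) / 2) - - (c / 2) * quad x y = W x y / 2.
  rewrite /quad quadrant_bottom (@times _ _ ((x + y) / 2) ((y - x) / (2 * c)))//.
  rewrite /w mul0r add0r addr0; have -> : c^-1 * ((y - x) / 2) = (y - x) / (2 * c) by field.
  lra.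
have wE s : w 0 s = U s 0 by rewrite /w mul0r mulr0 add0r addr0.
have mD : measurable (D : set (measurableTypeR R * measurableTypeR R)).
  by apply: measurableX; exact: measurable_itv.
exists r => // x y xr xy yr.
have iv : lebesgue_measure.-integrable `[x, y] (EFin \o v0).
  apply: integrableS (piecewise_continuous_integrable (id_v0 ini)) => //.
  by apply: subset_itv; rewrite bnd_simp;
    [exact: le_trans lo1 (ltW xr)|exact: le_trans (ltW yr) hi2].
have bt := @boundary_triangle _ _ R (plane_measure R) D
  (uncur G) P fst w (- (c / 2)) (fun s => c^-1 * v0 s) S (x0 - r) (x0 + r) r M.
have H : 2 * (w ((y - x) / 2) ((x + y) / 2) - - (c / 2) * quad x y) = w 0 x + w 0 y +
    \int[lebesgue_measure]_(s in `[x, y]) (c^-1 * v0 s).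
  apply: (bt x y mD iG mP measurable_fst P0 Pn Xn Yn wc c2 _ cS rr0 _ _ _ xr xy yr).
  - move=> x1 x2 y1 y2 x1r x12 x2y1 y12 y2r.
    have -> : (fun x y => w ((y - x) / 2) ((x + y) / 2) - - (c / 2) * quad x y) =
        (fun x y => W x y / 2).
      by apply/funext => ?; apply/funext => ?; rewrite JE.
    have : ddiff W x1 x2 y1 y2 = 0.
      have x1a : a1 <= x1 by exact: le_trans lo1 (ltW x1r).
      have y2a : y2 <= a2 by exact: le_trans (ltW y2r) hi2.
      have x1y1 := le_trans x12 x2y1; have x2y2 := le_trans x2y1 y12.
      apply: (wave_exact c0 a12 iG cs) => //.
      - by rewrite ler_pdivlMr// mulr_natr mulr2n lerD// (le_trans x1a).
      - by rewrite ler_pdivrMr// mulr_natr mulr2n lerD// (le_trans x2y2).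
      - rewrite ler_pdivrMr ?mulr_gt0// (le_trans _ width)//.
        by rewrite lerB// ltW.
    move=> dW; transitivity (ddiff W x1 x2 y1 y2 / 2); last by rewrite dW mul0r.
    by rewrite /ddiff; field.
  - move=> q s /andP[q0 qr] sr; apply: der; first by rewrite q0 (lt_le_trans qr).
    exact: near_x0.
  - by move=> s sr nEs; apply: lim => //; exact: near_x0.
  - apply: measurable_funM => //.
    by move/integrableP : iv => [/measurable_EFinP].
move: H; rewrite JE !wE RintegralZl// => <-; by field.
Qed.
End boundary.

(** * The defect of the representation *)

Lemma ddiff_fun_of_y (R : realType) (V : R -> R -> R) (x y r : R) (g : R -> R) :
  (forall x' y', x - r < x' -> x' < x + r -> y - r < y' -> y' < y + r -> V x' y' = g y') ->
  forall x1 x2 y1 y2, x1 <= x2 -> y1 <= y2 ->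
    x - r < x1 -> x2 < x + r -> y - r < y1 -> y2 < y + r -> ddiff V x1 x2 y1 y2 = 0.
Proof.
move=> Vg x1 x2 y1 y2 x12 y12 ? ? ? ?.
by rewrite /ddiff !Vg; try (by lra); ring.
Qed.

Lemma ddiff_fun_of_x (R : realType) (V : R -> R -> R) (x y r : R) (f : R -> R) :
  (forall x' y', x - r < x' -> x' < x + r -> y - r < y' -> y' < y + r -> V x' y' = f x') ->
  forall x1 x2 y1 y2, x1 <= x2 -> y1 <= y2 ->
    x - r < x1 -> x2 < x + r -> y - r < y1 -> y2 < y + r -> ddiff V x1 x2 y1 y2 = 0.
Proof.
move=> Vf x1 x2 y1 y2 x12 y12 ? ? ? ?.
by rewrite /ddiff !Vf; try (by lra); ring.
Qed.

Section global.
Context (R : realType) (c a1 a2 T : R) (G u : R -> R -> R) (Phi : set (front R))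
  (u0 v0 p1 p2 : R -> R).
Hypotheses (c0 : 0 < c) (a12 : a1 < a2) (T0 : 0 < T)
  (iG : (@lebesgue_measure R \x @lebesgue_measure R)%E.-integrable
    (`[a1, a2] `*` `[0, T]) (EFin \o uncur G))
  (cs : classical_solution c a1 a2 G u Phi)
  (ini : initial_data c a1 a2 u Phi u0 v0)
  (bd1 : boundary_dx c a1 a2 u Phi a1 p1)
  (bd2 : boundary_dx c a1 a2 u Phi a2 p2).
Let S : set R := [set F.2 | F in Phi].
Local Notation U := (extend a1 a2 u).
Local Notation pot := (wave_potential c a1 a2 T G).
Local Notation W := (wave_combination c a1 a2 T G u).
Local Notation N := (prim a1 a2 v0).
Local Notation P1 := (prim 0 T p1).
Local Notation P2 := (prim 0 T p2).

Let a12' := ltW a12.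
Let T0' := ltW T0.
Let cE : c != 0. Proof. by rewrite gt_eqF. Qed.

(** Summands of 2 u + c times the potential: d'Alembert's two waves from the initial line and one
    wave from each wall. The wall waves subtract the value at time 0, which the constant tails of
    the initial waves already carry, and so vanish for arguments up to 0. *)
Definition initial_up (y : R) : R := U y 0 + c^-1 * N y.
Definition initial_down (x : R) : R := U x 0 - c^-1 * N x.
Definition wall_left (r : R) : R := U a1 r - U a1 0 - c * P1 r.
Definition wall_right (r : R) : R := U a2 r - U a2 0 + c * P2 r.

(* Twice the difference between u, extended continuously to the plane by
   outgoing waves, and its integral representation, in characteristic
   coordinates; constant extension of the data makes every term continuous. *)
Definition defect (x y : R) : R :=
  2 * U ((x + y) / 2) ((y - x) / (2 * c) - `|(x + y) / 2 - clampr a1 a2 ((x + y) / 2)| / c)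
  + c * pot x y
  - initial_up ((x + y) / 2 + c * Num.max 0 ((y - x) / (2 * c)))
  - initial_down ((x + y) / 2 - c * Num.max 0 ((y - x) / (2 * c)))
  - wall_left ((y - x) / (2 * c) - `|(x + y) / 2 - a1| / c)
  - wall_right ((y - x) / (2 * c) - `|(x + y) / 2 - a2| / c).

Lemma extend_past (x t : R) : t <= 0 -> U x t = U x 0.
Proof. by move=> t0; rewrite /extend !max_l. Qed.

Lemma extend_le (x t : R) : x <= a1 -> U x t = U a1 t.
Proof. by move=> xa; rewrite /extend !(clampr_le a12'). Qed.

Lemma extend_ge (x t : R) : a2 <= x -> U x t = U a2 t.
Proof. by move=> xa; rewrite /extend !(clampr_ge a12'). Qed.

Lemma wall_left_past (r : R) : r <= 0 -> wall_left r = 0.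
Proof. by move=> r0; rewrite /wall_left extend_past// subrr sub0r prim_le// mulr0 oppr0. Qed.

Lemma wall_right_past (r : R) : r <= 0 -> wall_right r = 0.
Proof. by move=> r0; rewrite /wall_right extend_past// subrr add0r prim_le// mulr0. Qed.

Lemma initial_down_le (x : R) : x <= a1 -> initial_down x = U a1 0.
Proof. by move=> xa; rewrite /initial_down extend_le// prim_le// mulr0 subr0. Qed.

Lemma initial_up_ge (y : R) : a2 <= y -> initial_up y = U a2 0 + c^-1 * N a2.
Proof. by move=> ya; rewrite /initial_up extend_ge// (prim_ge _ a12'). Qed.

Lemma defect_past (x y : R) : y <= x -> defect x y = 0.
Proof.
move=> yx.
have t0 : (y - x) / (2 * c) <= 0 by rewrite pmulr_lle0 ?subr_le0// invr_gt0 mulr_gt0.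
have le0 (r : R) : (y - x) / (2 * c) - `|r| / c <= 0.
  by rewrite subr_le0 (le_trans t0)// divr_ge0// ltW.
rewrite /defect wall_left_past// wall_right_past// extend_past// (wave_potential_past c0 iG yx).
have -> : Num.max 0 ((y - x) / (2 * c)) = 0 by rewrite max_l.
rewrite !subr0 !(mulr0 c) !addr0 subr0 /initial_up /initial_down; ring.
Qed.

Let present (x y : R) : x <= y ->
  (x + y) / 2 + c * Num.max 0 ((y - x) / (2 * c)) = y /\
  (x + y) / 2 - c * Num.max 0 ((y - x) / (2 * c)) = x.
Proof.
move=> xy; rewrite max_r; last by rewrite divr_ge0 ?subr_ge0// mulr_ge0// ltW.
by split; field.
Qed.

Definition defect_left (y : R) : R :=
  c * upper_potential c a1 a2 T G y + U a1 ((y - a1) / c) + c * P1 ((y - a1) / c) -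
  initial_up y - wall_right ((y - a2) / c).

Definition defect_right (x : R) : R :=
  c * lower_potential c a1 a2 T G x + U a2 ((a2 - x) / c) - c * P2 ((a2 - x) / c) -
  initial_down x - wall_left ((a1 - x) / c) - c^-1 * N a2.

Lemma defect_leftE (x y : R) : x <= y -> x + y <= 2 * a1 -> defect x y = defect_left y.
Proof.
move=> xy xya; have [Ey Ex] := present xy.
have xa : (x + y) / 2 <= a1 by lra.
rewrite /defect Ey Ex (wave_potential_left c0 iG xya) extend_le// (clampr_le a12' xa).
rewrite initial_down_le; last by lra.
have na (a : R) : a1 <= a -> `|(x + y) / 2 - a| = - ((x + y) / 2 - a).
  by move=> aa; rewrite ler0_norm// subr_le0 (le_trans xa).
rewrite !na//.
have -> : (y - x) / (2 * c) - - ((x + y) / 2 - a1) / c = (y - a1) / c by field.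
have -> : (y - x) / (2 * c) - - ((x + y) / 2 - a2) / c = (y - a2) / c by field.
by rewrite /defect_left /wall_left; ring.
Qed.

Lemma defect_rightE (x y : R) : x <= y -> 2 * a2 <= x + y -> defect x y = defect_right x.
Proof.
move=> xy xya; have [Ey Ex] := present xy.
have xa : a2 <= (x + y) / 2 by lra.
rewrite /defect Ey Ex (wave_potential_right c0 iG xya) extend_ge// (clampr_ge a12' xa).
rewrite initial_up_ge; last by lra.
have pa (a : R) : a <= a2 -> `|(x + y) / 2 - a| = (x + y) / 2 - a.
  by move=> aa; rewrite ger0_norm// subr_ge0 (le_trans aa).
rewrite !pa//.
have -> : (y - x) / (2 * c) - ((x + y) / 2 - a1) / c = (a1 - x) / c by field.
have -> : (y - x) / (2 * c) - ((x + y) / 2 - a2) / c = (a2 - x) / c by field.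
by rewrite /defect_right /wall_right; ring.
Qed.

Lemma defect_inE (x y : R) : x <= y -> 2 * a1 <= x + y -> x + y <= 2 * a2 ->
  defect x y = W x y - (initial_down x + wall_left ((a1 - x) / c)) -
    (initial_up y + wall_right ((y - a2) / c)).
Proof.
move=> xy xa1 xa2; have [Ey Ex] := present xy.
rewrite /defect Ey Ex clampr_id; last by lra.
rewrite subrr normr0 mul0r subr0 ger0_norm; last by lra.
rewrite ler0_norm; last by lra.
have -> : (y - x) / (2 * c) - ((x + y) / 2 - a1) / c = (a1 - x) / c by field.
have -> : (y - x) / (2 * c) - - ((x + y) / 2 - a2) / c = (y - a2) / c by field.
by rewrite /wave_combination; ring.
Qed.

Lemma defect_left_past (y : R) : y <= a1 -> defect_left y = 0.
Proof. by move=> ya; rewrite -(@defect_leftE y y)// ?defect_past//; lra. Qed.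

Lemma defect_right_past (x : R) : a2 <= x -> defect_right x = 0.
Proof. by move=> xa; rewrite -(@defect_rightE x x)// ?defect_past//; lra. Qed.

Let Uc : continuous (uncur U).
Proof. exact: continuous_extend a12' (cs_continuous cs). Qed.

Let iv0 : lebesgue_measure.-integrable `[a1, a2] (EFin \o v0).
Proof. exact: piecewise_continuous_integrable (id_v0 ini). Qed.

Let ip1 : lebesgue_measure.-integrable `[0, T] (EFin \o p1).
Proof. exact: piecewise_continuous_integrable (bd_pc bd1 T0). Qed.

Let ip2 : lebesgue_measure.-integrable `[0, T] (EFin \o p2).
Proof. exact: piecewise_continuous_integrable (bd_pc bd2 T0). Qed.

Let cst_c (k : R) : continuous (cst k : R -> R).
Proof. by move=> ?; exact: cvg_cst. Qed.

Let id_c : continuous (fun x : R => x).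
Proof. by move=> ?; exact: cvg_id. Qed.

Let Urc (a : R) : continuous (U a).
Proof. exact: (@continuous_uncur_comp R R U (cst a) id Uc (@cst_c a) id_c). Qed.

Let Ulc (t : R) : continuous (U ^~ t).
Proof. exact: (@continuous_uncur_comp R R U id (cst t) Uc id_c (@cst_c t)). Qed.

Let prim_c (a b k : R) (f : R -> R) : a <= b ->
  lebesgue_measure.-integrable `[a, b] (EFin \o f) -> continuous (fun x => k * prim a b f x).
Proof.
by move=> ab fi x; apply: cvgM; [exact: cvg_cst|exact: continuous_prim].
Qed.

Let initial_up_c : continuous initial_up.
Proof. by move=> y; apply: cvgD; [exact: Ulc|exact: prim_c]. Qed.

Let initial_down_c : continuous initial_down.
Proof. by move=> y; apply: cvgB; [exact: Ulc|exact: prim_c]. Qed.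

Let wall_left_c : continuous wall_left.
Proof.
by move=> y; apply: cvgB; [apply: cvgB; [exact: Urc|exact: cvg_cst]|exact: prim_c].
Qed.

Let wall_right_c : continuous wall_right.
Proof.
by move=> y; apply: cvgD; [apply: cvgB; [exact: Urc|exact: cvg_cst]|exact: prim_c].
Qed.

Let comp_c (f g : R -> R) : continuous f -> continuous g -> continuous (fun x => g (f x)).
Proof. by move=> fc gc x; apply: continuous_comp; [exact: fc|exact: gc]. Qed.

Let smooth_part (X t : R -> R) : continuous X -> continuous t ->
  continuous (fun z => 2 * U (X z) (t z - `|X z - clampr a1 a2 (X z)| / c)
  - initial_up (X z + c * Num.max 0 (t z)) - initial_down (X z - c * Num.max 0 (t z))
  - wall_left (t z - `|X z - a1| / c) - wall_right (t z - `|X z - a2| / c)).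
Proof.
move=> Xc tc.
have dist_c (Y : R -> R) : continuous Y -> continuous (fun z => t z - `|X z - Y z| / c).
  move=> Yc z; apply: cvgB; first exact: tc.
  apply: cvgM; last exact: cvg_cst.
  by apply: cvg_norm; apply: cvgB; [exact: Xc|exact: Yc].
have tpc : continuous (fun z => c * Num.max 0 (t z)).
  move=> z; apply: cvgM; first exact: cvg_cst.
  by apply: continuous_max; [exact: cvg_cst|exact: tc].
have clc : continuous (fun z => clampr a1 a2 (X z)).
  exact: (@comp_c X (clampr a1 a2) Xc (@continuous_clampr R a1 a2)).
move=> z; apply: cvgB; last exact: (@comp_c (fun z => t z - `|X z - a2| / c) _ (dist_c _ (@cst_c a2)) wall_right_c).
apply: cvgB; last exact: (@comp_c (fun z => t z - `|X z - a1| / c) _ (dist_c _ (@cst_c a1)) wall_left_c).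
apply: cvgB; last first.
  apply: (@comp_c (fun z => X z - c * Num.max 0 (t z)) _ _ initial_down_c) => {}z.
  by apply: cvgB; [exact: Xc|exact: tpc].
apply: cvgB; last first.
  apply: (@comp_c (fun z => X z + c * Num.max 0 (t z)) _ _ initial_up_c) => {}z.
  by apply: cvgD; [exact: Xc|exact: tpc].
apply: cvgM; first exact: cvg_cst.
exact: (@continuous_uncur_comp R R U _ _ Uc Xc (dist_c _ clc)).
Qed.

Lemma continuous_defect :
  (forall y, continuous (defect ^~ y)) /\ (forall x, continuous (defect x)).
Proof.
have [potl potr] := continuous_wave_potential c0 iG.
have E x y : defect x y =
    2 * U ((x + y) / 2) ((y - x) / (2 * c) - `|(x + y) / 2 - clampr a1 a2 ((x + y) / 2)| / c)
  - initial_up ((x + y) / 2 + c * Num.max 0 ((y - x) / (2 * c)))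
  - initial_down ((x + y) / 2 - c * Num.max 0 ((y - x) / (2 * c)))
  - wall_left ((y - x) / (2 * c) - `|(x + y) / 2 - a1| / c)
  - wall_right ((y - x) / (2 * c) - `|(x + y) / 2 - a2| / c) + c * pot x y.
  by rewrite /defect; ring.
have ext (f g : R -> R) : (forall z, f z = g z) -> continuous g -> continuous f.
  by move=> /funext ->.
have pot_c (V : R -> R) : continuous V -> continuous (fun z => c * V z).
  by move=> Vc z; apply: cvgM; [exact: cvg_cst|exact: Vc].
split=> [y|x].
  apply: (ext _ _ (fun x => E x y)).
  have Xc : continuous (fun x : R => (x + y) / 2).
    by apply: (@continuous_affine _ _ 2^-1 (y / 2)) => z; lra.
  have tc : continuous (fun x : R => (y - x) / (2 * c)).
    by apply: (@continuous_affine _ _ (- (2 * c)^-1) (y / (2 * c))) => z; ring.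
  move=> x; apply: cvgD; last exact: (pot_c _ (potl y)).
  exact: (smooth_part Xc tc).
apply: (ext _ _ (fun y => E x y)).
have Xc : continuous (fun y : R => (x + y) / 2).
  by apply: (@continuous_affine _ _ 2^-1 (x / 2)) => z; lra.
have tc : continuous (fun y : R => (y - x) / (2 * c)).
  by apply: (@continuous_affine _ _ (2 * c)^-1 (- x / (2 * c))) => z; ring.
move=> y; apply: cvgD; last exact: (pot_c _ (potr x)).
exact: (smooth_part Xc tc).
Qed.

Let flat (x y : R) : Prop := exists2 r, 0 < r & forall x1 x2 y1 y2, x1 <= x2 -> y1 <= y2 ->
  x - r < x1 -> x2 < x + r -> y - r < y1 -> y2 < y + r -> ddiff defect x1 x2 y1 y2 = 0.

Let min3 (p q r : R) : 0 < p -> 0 < q -> 0 < r ->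
  exists2 d : R, 0 < d & [/\ d <= p, d <= q & d <= r].
Proof.
move=> p0 q0 r0; exists (Num.min p (Num.min q r)); first by rewrite !lt_min p0 q0 r0.
by rewrite !ge_min !lexx !orbT.
Qed.

Lemma defect_flat_left (x y : R) : x <= y -> x + y < 2 * a1 -> flat x y.
Proof.
(* On the initial line no radius below y - x is available; there the defect vanishes on both sides
   instead. *)
move=> xy xya; have [d d0 [d1 d2 _]] : exists2 d : R, 0 < d &
    [/\ d <= if x < y then (y - x) / 2 else 1, d <= (2 * a1 - x - y) / 2 & d <= 1].
  by apply: min3 => //; [case: (ltP x y) => ?; lra|lra].
exists d => //; case: ltgtP xy d1 => // [xy|xy] _ d1.
  by apply: (@ddiff_fun_of_y _ _ _ _ _ defect_left) => x' y' ? ? ? ?; apply: defect_leftE; lra.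
apply: (@ddiff_fun_of_y _ _ _ _ _ (fun=> 0)) => x' y' ? ? ? ?.
have [yx|/ltW xy'] := leP y' x'; first exact: defect_past.
by rewrite defect_leftE ?defect_left_past//; lra.
Qed.

Lemma defect_flat_right (x y : R) : x <= y -> 2 * a2 < x + y -> flat x y.
Proof.
move=> xy xya; have [d d0 [d1 d2 _]] : exists2 d : R, 0 < d &
    [/\ d <= if x < y then (y - x) / 2 else 1, d <= (x + y - 2 * a2) / 2 & d <= 1].
  by apply: min3 => //; [case: (ltP x y) => ?; lra|lra].
exists d => //; case: ltgtP xy d1 => // [xy|xy] _ d1.
  by apply: (@ddiff_fun_of_x _ _ _ _ _ defect_right) => x' y' ? ? ? ?; apply: defect_rightE; lra.
apply: (@ddiff_fun_of_x _ _ _ _ _ (fun=> 0)) => x' y' ? ? ? ?.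
have [yx|/ltW xy'] := leP y' x'; first exact: defect_past.
by rewrite defect_rightE ?defect_right_past//; lra.
Qed.

(** Near a point of the wall the defect is one and the same function of y alone on both sides.
    Outside this is its outgoing form; inside it follows from the triangle whose base on the wall
    runs from time (a1 - x) / c to (y - a1) / c. *)
Lemma defect_flat_left_wall (x y : R) : x < y -> x + y = 2 * a1 -> y - x < 2 * c * T ->
  ~ S x -> ~ S y -> flat x y.
Proof.
move=> xy xya yxT Sx Sy; pose t0 := (y - a1) / c.
have t0E : c * t0 = y - a1 by rewrite /t0; field.
have [xE yE] : a1 - c * t0 = x /\ a1 + c * t0 = y by rewrite t0E; split; lra.
have t0T : 0 < t0 < T.
  by apply/andP; split; rewrite -(ltr_pM2l c0) t0E; lra.
have [||r r0 rW] := left_wall c0 a12 iG cs bd1 t0T; rewrite ?xE ?yE//.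
have [d d0 [d1 d2 d3]] : exists2 d : R, 0 < d &
    [/\ d <= (y - x) / 2, d <= a2 - a1 & d <= Num.min (c * r) (c * T - c * t0)].
  apply: min3; [by lra|by rewrite subr_gt0|].
  by rewrite lt_min mulr_gt0// subr_gt0 ltr_pM2l//; case/andP : t0T.
have [d4 d5] : d <= c * r /\ d <= c * T - c * t0.
  by split; apply: (le_trans d3); rewrite ge_min lexx ?orbT.
exists d => //; apply: (@ddiff_fun_of_y _ _ _ _ _ defect_left) => x' y' xd1 xd2 yd1 yd2.
have xy' : x' <= y' by lra.
have [?|/ltW xya'] := leP (x' + y') (2 * a1); first exact: defect_leftE.
rewrite defect_inE//; last by lra.
pose q1 := (a1 - x') / c; pose q2 := (y' - a1) / c.
have q1E : c * q1 = a1 - x' by rewrite /q1; field.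
have q2E : c * q2 = y' - a1 by rewrite /q2; field.
have [q1r q12 q2r] : [/\ t0 - r < q1, q1 <= q2 & q2 < t0 + r].
  split; [rewrite -(ltr_pM2l c0)|rewrite -(ler_pM2l c0)|rewrite -(ltr_pM2l c0)];
    by rewrite ?mulrBr ?mulrDr ?q1E ?q2E; lra.
have [q10 q2T] : 0 <= q1 /\ q2 <= T.
  by split; rewrite -(ler_pM2l c0) ?mulr0 ?q1E ?q2E; lra.
have := rW _ _ q1r q12 q2r; rewrite -(primB ip1 q10 q12 q2T) q1E q2E.
have -> : a1 - (a1 - x') = x' by ring.
have -> : a1 + (y' - a1) = y' by ring.
move=> ->; rewrite initial_down_le; last by lra.
by rewrite /defect_left /wall_left -/q1 -/q2; ring.
Qed.

Lemma defect_flat_right_wall (x y : R) : x < y -> x + y = 2 * a2 -> y - x < 2 * c * T ->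
  ~ S x -> ~ S y -> flat x y.
Proof.
move=> xy xya yxT Sx Sy; pose t0 := (y - a2) / c.
have t0E : c * t0 = y - a2 by rewrite /t0; field.
have [xE yE] : a2 - c * t0 = x /\ a2 + c * t0 = y by rewrite t0E; split; lra.
have t0T : 0 < t0 < T.
  by apply/andP; split; rewrite -(ltr_pM2l c0) t0E; lra.
have [||r r0 rW] := right_wall c0 a12 iG cs bd2 t0T; rewrite ?xE ?yE//.
have [d d0 [d1 d2 d3]] : exists2 d : R, 0 < d &
    [/\ d <= (y - x) / 2, d <= a2 - a1 & d <= Num.min (c * r) (c * T - c * t0)].
  apply: min3; [by lra|by rewrite subr_gt0|].
  by rewrite lt_min mulr_gt0// subr_gt0 ltr_pM2l//; case/andP : t0T.
have [d4 d5] : d <= c * r /\ d <= c * T - c * t0.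
  by split; apply: (le_trans d3); rewrite ge_min lexx ?orbT.
exists d => //; apply: (@ddiff_fun_of_x _ _ _ _ _ defect_right) => x' y' xd1 xd2 yd1 yd2.
have xy' : x' <= y' by lra.
have [?|/ltW xya'] := leP (2 * a2) (x' + y'); first exact: defect_rightE.
rewrite defect_inE//; last by lra.
pose q1 := (y' - a2) / c; pose q2 := (a2 - x') / c.
have q1E : c * q1 = y' - a2 by rewrite /q1; field.
have q2E : c * q2 = a2 - x' by rewrite /q2; field.
have [q1r q12 q2r] : [/\ t0 - r < q1, q1 <= q2 & q2 < t0 + r].
  split; [rewrite -(ltr_pM2l c0)|rewrite -(ler_pM2l c0)|rewrite -(ltr_pM2l c0)];
    by rewrite ?mulrBr ?mulrDr ?q1E ?q2E; lra.
have [q10 q2T] : 0 <= q1 /\ q2 <= T.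
  by split; rewrite -(ler_pM2l c0) ?mulr0 ?q1E ?q2E; lra.
have := rW _ _ q1r q12 q2r; rewrite -(primB ip2 q10 q12 q2T) q1E q2E.
have -> : a2 - (a2 - x') = x' by ring.
have -> : a2 + (y' - a2) = y' by ring.
move=> ->; rewrite initial_up_ge; last by lra.
by rewrite /defect_right /wall_right -/q1 -/q2; ring.
Qed.

(** Inside, the defect differs from the wave combination by a function of x and a function of y,
    invisible to second-order differences. *)
Lemma defect_flat_inside (x y : R) : x < y -> 2 * a1 < x + y -> x + y < 2 * a2 ->
  y - x < 2 * c * T -> flat x y.
Proof.
move=> xy xa1 xa2 yxT; have [d d0 [d1 d2 d3]] : exists2 d : R, 0 < d &
    [/\ d <= (y - x) / 2, d <= (2 * c * T - (y - x)) / 2 &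
      d <= Num.min ((x + y - 2 * a1) / 2) ((2 * a2 - x - y) / 2)].
  by apply: min3; rewrite ?lt_min; [lra|lra|apply/andP; split; lra].
have [d4 d5] : d <= (x + y - 2 * a1) / 2 /\ d <= (2 * a2 - x - y) / 2.
  by split; apply: (le_trans d3); rewrite ge_min lexx ?orbT.
have sepE x' y' : x - d < x' < x + d -> y - d < y' < y + d -> defect x' y' =
    W x' y' - (initial_down x' + wall_left ((a1 - x') / c)) -
      (initial_up y' + wall_right ((y' - a2) / c)).
  by move=> /andP[? ?] /andP[? ?]; apply: defect_inE; lra.
exists d => // x1 x2 y1 y2 x12 y12 xd1 xd2 yd1 yd2.
have [x1d x2d] : x - d < x1 < x + d /\ x - d < x2 < x + d by lra.
have [y1d y2d] : y - d < y1 < y + d /\ y - d < y2 < y + d by lra.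
transitivity (ddiff W x1 x2 y1 y2); first by rewrite /ddiff !sepE//; ring.
apply: (wave_exact c0 a12 iG cs) => //; [lra|lra|lra|].
by rewrite ler_pdivrMr ?mulr_gt0//; lra.
Qed.

Lemma defect_flat_bottom (x : R) : a1 < x -> x < a2 -> ~ S x -> flat x x.
Proof.
move=> xa1 xa2 Sx; have xin : a1 < x < a2 by rewrite xa1.
have [r r0 rW] := initial_line c0 a12 iG cs ini T0 xin Sx.
have [d d0 [d1 d2 d3]] : exists2 d : R, 0 < d & [/\ d <= r, d <= x - a1 & d <= a2 - x].
  by apply: min3; rewrite ?subr_gt0.
exists d => //; apply: (@ddiff_fun_of_y _ _ _ _ _ (fun=> 0)) => x' y' xd1 xd2 yd1 yd2.
have [yx|/ltW xy] := leP y' x'; first exact: defect_past.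
have [xa yb] : a1 <= x' /\ y' <= a2 by lra.
rewrite defect_inE//; [|lra|lra].
rewrite rW//; [|lra|lra].
rewrite -(primB iv0 xa xy yb) wall_left_past ?wall_right_past.
- by rewrite /initial_down /initial_up; ring.
- by rewrite pmulr_lle0 ?invr_gt0// subr_le0.
- by rewrite pmulr_lle0 ?invr_gt0// subr_le0.
Qed.

(** The values a1 and a2 are exceptional because of the corners at time 0, where neither the wall
    triangles nor the one on the initial line are available. *)
Lemma defect_flat (x y : R) : y - x < 2 * c * T ->
  ~ (S `|` [set a1; a2]) x -> ~ (S `|` [set a1; a2]) y -> flat x y.
Proof.
move=> yxT Sx Sy.
have [nSx nSy] : ~ S x /\ ~ S y by split=> h; [apply: Sx|apply: Sy]; left.
have [xy|yx] := leP x y; last first.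
  exists ((x - y) / 2); first by lra.
  apply: (@ddiff_fun_of_y _ _ _ _ _ (fun=> 0)) => x' y' ? ? ? ?.
  by apply: defect_past; lra.
have [|xya1|xya1] := ltgtP (x + y) (2 * a1); first exact: defect_flat_left.
- have [xya2|xya2|xya2] := ltgtP (x + y) (2 * a2); [|exact: defect_flat_right|].
  + move: xy; rewrite le_eqVlt => /predU1P[xy|xy]; last exact: defect_flat_inside.
    by rewrite -{}xy in xya1 xya2 *; apply: defect_flat_bottom => //; lra.
  + apply: defect_flat_right_wall => //; rewrite lt_neqAle xy andbT; apply/eqP => E.
    by apply: Sx; right; right; rewrite /=; lra.
- apply: defect_flat_left_wall => //; rewrite lt_neqAle xy andbT; apply/eqP => E.
  by apply: Sx; right; left; rewrite /=; lra.
Qed.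

(** In the square with both sides [x, y] three corners lie on or below the line t = 0, where the
    defect vanishes; the difference over the square is minus its value at the fourth. *)
Lemma defect0 (x y : R) : y - x < 2 * c * T -> defect x y = 0.
Proof.
move=> yxT; have [yx|/ltW xy] := leP y x; first exact: defect_past.
have [dl dr] := continuous_defect.
have cA : countable (S `|` [set a1; a2]).
  apply: countable_setU; first by apply: countable_front_values; exact: cs_fronts cs.
  exact: finite_set_countable (finite_set2 _ _).
have : ddiff defect x y x y = 0.
  apply: (ddiff_gauge cA cA xy xy dl dr) => x' y' xx' yy' Ax Ay k k0.
  have [|r r0 rd] := @defect_flat x' y' _ Ax Ay; first by lra.
  exists r => // x1 x2 y1 y2 _ x12 _ _ y12 _ h1 h2 h3 h4.
  by rewrite rd// normr0 !mulr_ge0 ?subr_ge0// ltW.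
by rewrite /ddiff (defect_past (lexx y)) (defect_past xy) (defect_past (lexx x)); lra.
Qed.

End global.

(** * Reduction of the representation to the defect *)

(** The reflection preserves Lebesgue measure, by uniqueness on half-open intervals: the preimage is
    half-open at the other end but has the same length. *)
Lemma ge0_integral_reflect (R : realType) (t : R) (D : set R) (f : R -> \bar R) :
  measurable D -> measurable_fun D f -> (forall s, D s -> 0 <= f s)%E ->
  (\int[lebesgue_measure]_(s in (fun s => t - s)%R @^-1` D) f (t - s)%R =
   \int[lebesgue_measure]_(s in D) f s)%E.
Proof.
move=> mD mf f0; pose phi (s : measurableTypeR R) : measurableTypeR R := t - s.
have mphi : measurable_fun setT phi by exact: measurable_funB.
transitivity (\int[pushforward (@lebesgue_measure R) phi]_(s in D) f s)%E.
  by rewrite ge0_integral_pushforward// => s; rewrite inE; exact: f0.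
apply: eq_measure_integral => //= A mA _.
apply/esym/(lebesgue_measure_unique (mu := pushforward (@lebesgue_measure R) phi)) => //= _ [[a b]] _ <-.
rewrite /pushforward (_ : phi @^-1` _ = [set` `[t - b, t - a[]); last first.
  apply/seteqP; split => s; rewrite /phi /= !in_itv /= => /andP[? ?]; apply/andP; split; lra.
rewrite !lebesgue_measure_itv /= !lte_fin (_ : (t - b < t - a) = (a < b)); last first.
  by rewrite ltrD2l ltrN2.
by case: ifPn => // _; rewrite -!EFinD; congr EFin; lra.
Qed.

Lemma Rintegral_reflect (R : realType) (t : R) (D : set R) (f : R -> R) :
  measurable D -> measurable_fun D f ->
  \int[lebesgue_measure]_(s in (fun s => t - s) @^-1` D) f (t - s) =
  \int[lebesgue_measure]_(s in D) f s.
Proof.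
move=> mD /measurable_EFinP mf; rewrite /Rintegral; congr fine.
pose phi (s : R) := t - s.
change (integral lebesgue_measure (phi @^-1` D) ((EFin \o f) \o phi) =
  integral lebesgue_measure D (EFin \o f)).
rewrite [LHS]integralE [RHS]integralE funepos_comp funeneg_comp.
rewrite -(ge0_integral_reflect t mD (measurable_funepos mf))//.
by rewrite -(ge0_integral_reflect t mD (measurable_funeneg mf)).
Qed.

(** For a negative retarded time both sides vanish, for a positive one they agree by reflection. At
    retarded time 0 the interval is a single point, so the value 1/2 does no harm. *)
Lemma heaviside_prim (R : realType) (c t T d : R) (p : R -> R) :
  0 < c -> t <= T -> 0 <= T -> 0 <= d ->
  lebesgue_measure.-integrable `[0, T] (EFin \o p) ->
  heaviside (c * t - d) * (\int[lebesgue_measure]_(s in `[d / c, t]) p (t - s)) =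
  prim 0 T p (t - d / c).
Proof.
move=> c0 tT T0 d0 ip; have d0c : 0 <= d / c by rewrite divr_ge0// ltW.
have ctE : c * t - d = c * (t - d / c) by rewrite mulrBr mulrCA divff ?mulr1 ?gt_eqF.
have [rlt|rgt|rE] := ltgtP (t - d / c) 0.
- rewrite heaviside_lt0 ?ctE ?pmulr_rlt0//.
  by rewrite mul0r prim_le// ltW.
- rewrite heaviside_gt0 ?mul1r; last by rewrite ctE mulr_gt0.
  have mI : measurable_fun `[0, t - d / c] p.
    move/integrableP : ip => [/measurable_EFinP + _]; apply: measurable_funS => //.
    by apply: subset_itvl; rewrite bnd_simp; lra.
  rewrite /prim clampr_id; last by lra.
  rewrite -(@Rintegral_reflect _ t `[0, t - d / c])//; congr Rintegral.
  by apply/seteqP; split => s; rewrite /= !in_itv /=; lra.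
- rewrite rE prim_le//; have -> : d / c = t by move/eqP : rE; rewrite subr_eq0 => /eqP.
  by rewrite set_itv1 Rintegral_set1 mulr0.
Qed.

Lemma prim_clampr (R : realType) (a b x : R) (f : R -> R) : a <= b ->
  prim a b f (clampr a b x) = prim a b f x.
Proof. by move=> ab; rewrite /prim [clampr _ _ (clampr _ _ _)]clampr_id// clampr_in. Qed.

Lemma prim_window (R : realType) (a b x d : R) (f : R -> R) :
  a <= b -> 0 <= d -> lebesgue_measure.-integrable `[a, b] (EFin \o f) ->
  \int[lebesgue_measure]_(y in `[a, b]) (f y * heaviside (d - `|x - y|)) =
  prim a b f (x + d) - prim a b f (x - d).
Proof.
move=> ab d0 fi; rewrite -(prim_clampr (x + d) f ab) -(prim_clampr (x - d) f ab).
set q := clampr a b (x + d); set p := clampr a b (x - d).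
have [ap pb] : a <= p /\ p <= b by apply/andP; exact: clampr_in.
have [aq qb] : a <= q /\ q <= b by apply/andP; exact: clampr_in.
have pq : p <= q.
  rewrite /p /q /clampr ge_max !le_max lexx /= le_min !ge_min !lexx /=.
  by rewrite (_ : x - d <= x + d) ?orbT//; lra.
rewrite (primB fi ap pq qb).
have mf : measurable_fun `[a, b] f by move/integrableP : fi => [/measurable_EFinP].
transitivity (\int[lebesgue_measure]_(y in `[a, b]) (f y * \1_`[p, q] y)).
  (* Excluding the ends of the window and their clamped images makes all comparisons strict, so
     clamping does not affect them. *)
  apply: (@Rintegral_ae_eq _ _ _ lebesgue_measure _ ([set x - d; x + d] `|` [set p; q])) => //.
  - by apply: measurableU; apply: measurableU; exact: measurable_set1.
  - apply: countable_lebesgue_measure0; apply: countable_setU;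
    exact: finite_set_countable (finite_set2 _ _).
  - apply: measurable_funM => //; apply: (measurableT_comp (@measurable_heaviside R setT)).
    apply: measurable_funB => //; apply: measurableT_comp => //.
    exact: measurable_funB.
  - exact: measurable_funM.
  move=> y /=; rewrite in_itv /= => /andP[ay yb] nN; congr (_ * _).
  rewrite indicE; have -> : (y \in `[p, q]%classic) = (p <= y <= q).
    by apply/idP/idP; rewrite inE /= in_itv.
  have [n1 n2] : y <> x - d /\ y <> x + d by split=> h; apply: nN; left; [left|right].
  have [n3 n4] : y <> p /\ y <> q by split=> h; apply: nN; right; [left|right].
  have pl : p < y <-> x - d < y.
    rewrite /p /clampr in n3 *.
    by case: (leP b (x - d)) n3 => ?; case: (leP a _) => ? ?; split; lra.
  have ql : y < q <-> y < x + d.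
    rewrite /q /clampr in n4 *.
    by case: (leP b (x + d)) n4 => ?; case: (leP a _) => ? ?; split; lra.
  have -> : (p <= y <= q) = (x - d < y < x + d).
    by apply/idP/idP => /andP[h1 h2]; apply/andP; split;
      [apply/pl|apply/ql|apply/ltW/pl|apply/ltW/ql] => //; rewrite lt_neqAle ?h1 ?h2 andbT; apply/eqP => // /esym.
  have -> : (x - d < y < x + d) = (`|x - y| < d).
    by rewrite ltr_norml; apply/idP/idP => /andP[h1 h2]; apply/andP; split; lra.
  case: ltP => h; first by rewrite heaviside_gt0// subr_gt0.
  rewrite heaviside_lt0// subr_lt0 lt_neqAle h andbT; apply/eqP => E.
  by case: (leP x y) E => ? E; [apply: n2; move: E; rewrite ler0_norm|apply: n1; move: E; rewrite gtr0_norm]; lra.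
rewrite [LHS]Rintegral_mkcond [RHS]Rintegral_mkcond; apply: eq_Rintegral => y _.
rewrite !patchE indicE; case: (boolP (y \in `[p, q]%classic)) => h.
  rewrite mulr1 mem_set//; move: h; rewrite inE /= !in_itv /= => /andP[? ?].
  by apply/andP; split; lra.
by rewrite mulr0; case: ifP.
Qed.

(** Applied with d = ct and z the signed distance from a wall: where the wave from the wall has not
    arrived, the retarded boundary value is the initial one. Both sides are 0 for |z| < d, and at
    |z| = d the values 1/2 match. *)
Lemma heaviside_reach (R : realType) (z d s0 s1 : R) : 0 < d -> (d <= `|z| -> s1 = s0) ->
  Num.sg z * (1 - heaviside (d - `|z|)) * s1 =
  (1 - heaviside (d - z) - heaviside (- z - d)) * s0.
Proof.
move=> d0 s10; have [dz|zd] := leP d `|z|; last first.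
  rewrite heaviside_gt0 ?subr_gt0// subrr mulr0 mul0r.
  move: zd; rewrite ltr_norml => /andP[zd dz].
  by rewrite heaviside_gt0 ?heaviside_lt0; lra.
rewrite s10//; congr (_ * _); move: dz; case: (ltgtP z 0) => [z0|z0|->]; last first.
- by rewrite normr0; lra.
- rewrite gtr0_norm// gtr0_sg// mul1r (heaviside_lt0 (x := - z - d)); last by lra.
  by rewrite subr0.
- rewrite ltr0_norm// ltr0_sg// => dz.
  rewrite (heaviside_gt0 (x := d - z)); last by lra.
  have -> : d - - z = - (- z - d) by ring.
  rewrite heavisideN; lra.
Qed.

Lemma interval_char_cases (R : realType) (a1 a2 x : R) (P : R -> Prop) :
  a1 < a2 -> (x < a1 -> P 0) -> (x = a1 -> P 2^-1) -> (a1 < x < a2 -> P 1) -> (x = a2 -> P 2^-1) ->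
  (a2 < x -> P 0) -> P (interval_char a1 a2 x).
Proof.
move=> a12 Pl P1 Pin P2 Pr; rewrite /interval_char.
have [xa1|xa1|xa1] := ltgtP x a1; last by apply: P1.
- by rewrite lt_eqF ?(lt_trans xa1)//=; apply: Pl.
- have [xa2|xa2|xa2] /= := ltgtP x a2; last by apply: P2.
  + by apply: Pin; rewrite xa1.
  + exact: Pr.
Qed.

(** The Heaviside terms cut off the two constant tails; at the ends H(0) = 1/2 yields exactly the
    half value of the characteristic function. *)
Lemma extend_initial (R : realType) (a1 a2 : R) (u : R -> R -> R) (u0 : R -> R) (y : R) :
  a1 < a2 ->
  (forall x, a1 <= x <= a2 -> u x 0 = u0 x) ->
  u0 y * interval_char a1 a2 y = extend a1 a2 u y 0 -
    heaviside (a1 - y) * extend a1 a2 u a1 0 - heaviside (y - a2) * extend a1 a2 u a2 0.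
Proof.
move=> a12 uu0; have a12' := ltW a12.
have in1 : a1 <= a1 <= a2 by rewrite lexx.
have in2 : a1 <= a2 <= a2 by rewrite lexx andbT.
pattern (interval_char a1 a2 y); apply: interval_char_cases => // [ya|ya|ya|ya|ya].
- rewrite heaviside_gt0 ?heaviside_lt0; [|lra|lra].
  by rewrite (extend_le u a12 0 (ltW ya)); ring.
- rewrite ya subrr heaviside0 heaviside_lt0; last lra.
  by rewrite !extendE// uu0//; field.
- rewrite !heaviside_lt0; [|lra|lra].
  by rewrite extendE ?uu0//; [ring|lra|lra].
- rewrite ya subrr heaviside0 heaviside_lt0; last lra.
  by rewrite !extendE// uu0//; field.
- rewrite [heaviside (y - a2)]heaviside_gt0 ?heaviside_lt0; [|lra|lra].
  by rewrite (extend_ge u a12 0 (ltW ya)); ring.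
Qed.

(** The sign factors are 0 on the inner side of a wall, 1 on it and 2 beyond it, so they remove the
    outgoing continuation and leave half of it on the wall. *)
Lemma extend_outgoing (R : realType) (a1 a2 c x t : R) (u : R -> R -> R) :
  a1 < a2 -> 0 <= t ->
  2 * (u x t * interval_char a1 a2 x) =
  2 * extend a1 a2 u x (t - `|x - clampr a1 a2 x| / c)
  - (1 - Num.sg (x - a1)) * extend a1 a2 u a1 (t - `|x - a1| / c)
  - (1 + Num.sg (x - a2)) * extend a1 a2 u a2 (t - `|x - a2| / c).
Proof.
move=> a12 t0; have a12' := ltW a12.
have in1 : a1 <= a1 <= a2 by rewrite lexx.
have in2 : a1 <= a2 <= a2 by rewrite lexx andbT.
pattern (interval_char a1 a2 x); apply: interval_char_cases => // [xa|xa|xa|xa|xa].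
- rewrite clampr_le ?ltW// (extend_le u a12 _ (ltW xa)) !ltr0_sg; [|lra|lra].
  by ring.
- rewrite xa clampr_id// subrr normr0 mul0r subr0 sgr0 ltr0_sg; last lra.
  by rewrite extendE//; field.
- rewrite clampr_id; last lra.
  rewrite subrr normr0 mul0r subr0 gtr0_sg ?ltr0_sg; [|lra|lra].
  by rewrite extendE//; [ring|lra].
- rewrite xa clampr_id// subrr normr0 mul0r subr0 sgr0 gtr0_sg; last lra.
  by rewrite extendE//; field.
- rewrite clampr_ge ?ltW// (extend_ge u a12 _ (ltW xa)) !gtr0_sg; [|lra|lra].
  by ring.
Qed.

Lemma heaviside_extend (R : realType) (a1 a2 c t d a : R) (u : R -> R -> R) :
  0 < c -> a1 <= a <= a2 ->
  heaviside (c * t - d) * u a (t - d / c) = heaviside (c * t - d) * extend a1 a2 u a (t - d / c).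
Proof.
move=> c0 aa; have [dt|dt] := ltP (c * t) d; first by rewrite heaviside_lt0 ?mul0r//; lra.
by rewrite extendE// subr_ge0 ler_pdivrMr// mulrC.
Qed.

Theorem theorem7p1 (R : realType) (c a1 a2 : R) (G u : R -> R -> R)
    (Phi : set (front R)) (u0 v0 p1 p2 b1 b2 : R -> R)
    (c_gt0 : 0 < c) (a12 : a1 < a2)
    (hG : locally_integrable_source a1 a2 G)
    (hu : classical_solution c a1 a2 G u Phi)
    (hinit : initial_data c a1 a2 u Phi u0 v0)
    (hp1 : boundary_dx c a1 a2 u Phi a1 p1)
    (hp2 : boundary_dx c a1 a2 u Phi a2 p2)
    (hbvp : first_bvp a1 a2 u u0 b1 b2 \/ second_bvp c a1 a2 u Phi b1 b2)
    (x t : R) (t_gt0 : 0 < t) :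
  2 * uhat a1 a2 u x t =
    c * heaviside (c * t - `|x - a2|) *
      (\int[lebesgue_measure]_(s in `[`|x - a2| / c, t]) p2 (t - s))
  - c * heaviside (c * t - `|x - a1|) *
      (\int[lebesgue_measure]_(s in `[`|x - a1| / c, t]) p1 (t - s))
  + Num.sg (x - a1) * heaviside (c * t - `|x - a1|) * u a1 (t - `|x - a1| / c)
  - Num.sg (x - a2) * heaviside (c * t - `|x - a2|) * u a2 (t - `|x - a2| / c)
  + c^-1 * (\int[lebesgue_measure]_(y in `[a1, a2])
              (v0 y * heaviside (c * t - `|x - y|)))
  + u0 (x + c * t) * interval_char a1 a2 (x + c * t)
  + u0 (x - c * t) * interval_char a1 a2 (x - c * t)
  - c * (\int[(lebesgue_measure \x lebesgue_measure)%E]_(q in `[a1, a2] `*` `[0, t])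
           (G q.1 q.2 * heaviside (c * (t - q.2) - `|x - q.1|))).
Proof.
(* [defect0] needs t strictly below the cut-off time. *)
pose T := t + 1; have [T0 tT] : 0 < T /\ t < T by rewrite /T; lra.
have iG := hG T T0.
have ip1 := piecewise_continuous_integrable (bd_pc hp1 T0).
have ip2 := piecewise_continuous_integrable (bd_pc hp2 T0).
have iv0 := piecewise_continuous_integrable (id_v0 hinit).
have ct0 : 0 < c * t by exact: mulr_gt0.
have in1 : a1 <= a1 <= a2 by rewrite lexx ltW.
have in2 : a1 <= a2 <= a2 by rewrite lexx ltW.
have D0 : defect c a1 a2 T G u v0 p1 p2 (x - c * t) (x + c * t) = 0.
  apply: (defect0 c_gt0 a12 T0 iG hu hinit hp1 hp2).
  rewrite (_ : x + c * t - (x - c * t) = 2 * c * t); last ring.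
  by rewrite ltr_pM2l// mulr_gt0.
have XE : (x - c * t + (x + c * t)) / 2 = x by field.
have tE : (x + c * t - (x - c * t)) / (2 * c) = t by field; rewrite gt_eqF.
move: D0; rewrite /defect XE tE max_r ?ltW// /initial_up /initial_down /wall_left /wall_right.
rewrite -(wave_potential_cone c_gt0 iG x (ltW tT)).
rewrite -(heaviside_prim c_gt0 (ltW tT) (ltW T0) (normr_ge0 (x - a1)) ip1).
rewrite -(heaviside_prim c_gt0 (ltW tT) (ltW T0) (normr_ge0 (x - a2)) ip2).
rewrite (prim_window x (ltW a12) (ltW ct0) iv0).
rewrite /uhat (heaviside_gt0 t_gt0) mulr1 (extend_outgoing c x u a12 (ltW t_gt0)).
rewrite !(extend_initial _ a12 (id_value hinit)).
have h1 := heaviside_extend t `|x - a1| u c_gt0 in1.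
have h2 := heaviside_extend t `|x - a2| u c_gt0 in2.
rewrite -[Num.sg (x - a1) * _ * _]mulrA h1 -[Num.sg (x - a2) * _ * _]mulrA h2 {h1 h2}.
have reach a : t - `|x - a| / c <= 0 = (c * t <= `|x - a|).
  by rewrite subr_le0 ler_pdivlMr// mulrC.
have r1 : c * t <= `|x - a1| ->
    extend a1 a2 u a1 (t - `|x - a1| / c) = extend a1 a2 u a1 0.
  by rewrite -reach => h; rewrite extend_past.
have r2 : c * t <= `|a2 - x| ->
    extend a1 a2 u a2 (t - `|x - a2| / c) = extend a1 a2 u a2 0.
  by rewrite distrC -reach => h; rewrite extend_past.
(* These two identities trade the sign terms not yet reached by the wall waves for the tails cut
   from the initial data; the vanishing of the defect then gives the claim linearly. *)
have := heaviside_reach ct0 r1.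
have := heaviside_reach ct0 r2.
rewrite [in `|a2 - x|]distrC -[a2 - x]opprB sgrN.
rewrite (_ : c * t - (x - a1) = a1 - (x - c * t)); last ring.
rewrite (_ : - (x - a1) - c * t = a1 - (x + c * t)); last ring.
rewrite (_ : c * t - - (x - a2) = x + c * t - a2); last ring.
rewrite (_ : - - (x - a2) - c * t = x - c * t - a2); last ring.
by move=> e2 e1 e0; clear - e0 e1 e2; lra.
Qed.
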